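(* The Lerch transcendent $\Phi(s,z,c)$ analytically continues to a single-valued holomorphic function $\tilde Z(s,z,c,[\gamma])$ on the universal cover $\tilde{\mathcal N}^{\#}$ of $\mathcal N^{\#}=\mathbb C\times(\mathbb P^1(\mathbb C)\setminus\{0,1,\infty\})\times(\mathbb C\setminus\mathbb Z_{\le0})$. All monodromy functions $M_{[\tau]}(\tilde Z)$ vanish identically for $[\tau]$ in the second commutator subgroup $\pi_1(\mathcal N^{\#},x_0')''$. Thus the analytic continuation becomes single-valued on a covering manifold of $\mathcal N^{\#}$ with a two-step solvable group of deck transformations.
   Context: $\Phi(s,z,c)=\sum_{n\ge0}z^n(n+c)^{-s}$ with principal branch powers, holomorphic on $\{\Re s>1\}\times\{|z|<1\}\times\{0<\Re c<1\}$. Base point $x_0'=(\tfrac12,-1,\tfrac12)$. Points of the universal cover are homotopy classes $[\gamma]$ of paths from $x_0'$ in $\mathcal N^{\#}$. For $[\tau]\in\pi_1(\mathcal N^{\#},x_0')$ the monodromy function is $M_{[\tau]}(f)([\gamma])=f([\tau\gamma])-f([\gamma])$ ($\tau\gamma$: first $\tau$, then $\gamma$). For a group $G$, $G''=[G',G']$, $G'=[G,G]$. *)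

(* Defs.v *)
From Stdlib Require Import Reals.
From Coquelicot Require Import Complex.
Open Scope R_scope.

Definition pt : Type := (C * C * C)%type.
Definition pS (p : pt) : C := fst (fst p).
Definition pZ (p : pt) : C := snd (fst p).
Definition pC (p : pt) : C := snd p.
Definition mkpt (s z c : C) : pt := (s, z, c).

Definition dist3 (p q : pt) : R :=
  Rmax (Cmod (Cminus (pS p) (pS q)))
       (Rmax (Cmod (Cminus (pZ p) (pZ q))) (Cmod (Cminus (pC p) (pC q)))).

Definition Nsharp (p : pt) : Prop :=
  pZ p <> RtoC 0 /\ pZ p <> RtoC 1 /\ (forall n : nat, pC p <> RtoC (- INR n)).

Definition Dom (p : pt) : Prop :=
  1 < fst (pS p) /\ Cmod (pZ p) < 1 /\ 0 < fst (pC p) < 1.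

Definition x0' : pt := mkpt (RtoC (1/2)) (RtoC (-1)) (RtoC (1/2)).

Definition cexp (w : C) : C :=
  (exp (fst w) * cos (snd w), exp (fst w) * sin (snd w)).
Definition carg (w : C) : R :=
  let x := fst w in let y := snd w in
  if Rlt_dec 0 x then atan (y / x)
  else if Rlt_dec x 0 then
    (if Rle_dec 0 y then atan (y / x) + PI else atan (y / x) - PI)
  else if Rlt_dec 0 y then PI / 2
  else if Rlt_dec y 0 then - (PI / 2) else 0.
Definition clog (w : C) : C := (ln (Cmod w), carg w).
Definition cpow (a b : C) : C :=
  if Req_EM_T (Cmod a) 0 then RtoC 0 else cexp (Cmult b (clog a)).

Fixpoint lerch_partial (s z c : C) (N : nat) : C :=
  match N with
  | O => RtoC 0
  | S m => Cplus (lerch_partial s z c m)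
                 (Cmult (Cpow z m) (cpow (Cplus (RtoC (INR m)) c) (Copp s)))
  end.
Definition lerch_sum (p : pt) (l : C) : Prop :=
  forall eps : R, 0 < eps -> exists N0 : nat, forall N : nat, (N0 <= N)%nat ->
    Cmod (Cminus (lerch_partial (pS p) (pZ p) (pC p) N) l) < eps.

Definition holo_at (f : pt -> C) (p : pt) : Prop :=
  exists a1 a2 a3 : C, forall eps : R, 0 < eps -> exists delta : R, 0 < delta /\
    forall h : pt, dist3 h (mkpt (RtoC 0) (RtoC 0) (RtoC 0)) < delta ->
      Cmod (Cminus (Cminus (f (mkpt (Cplus (pS p) (pS h)) (Cplus (pZ p) (pZ h))
                                        (Cplus (pC p) (pC h)))) (f p))
                   (Cplus (Cmult a1 (pS h)) (Cplus (Cmult a2 (pZ h)) (Cmult a3 (pC h)))))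
      <= eps * dist3 h (mkpt (RtoC 0) (RtoC 0) (RtoC 0)).
Definition holo_on (U : pt -> Prop) (f : pt -> C) : Prop :=
  forall p, U p -> holo_at f p.

(** Paths: maps [0,1] -> C^3 (represented as functions on R; only [0,1] matters) *)
Definition path := R -> pt.
Definition I01 (t : R) : Prop := 0 <= t <= 1.

Definition path_in_N (g : path) : Prop :=
  (forall t, I01 t -> Nsharp (g t)) /\
  (forall t, I01 t -> forall eps, 0 < eps -> exists delta, 0 < delta /\
     forall t', I01 t' -> Rabs (t' - t) < delta -> dist3 (g t') (g t) < eps).

Definition homotopic (g1 g2 : path) : Prop :=
  exists H : R -> R -> pt,
    (forall u t, I01 u -> I01 t -> Nsharp (H u t)) /\
    (forall u t, I01 u -> I01 t -> forall eps, 0 < eps -> exists delta, 0 < delta /\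
       forall u' t', I01 u' -> I01 t' -> Rabs (u' - u) < delta -> Rabs (t' - t) < delta ->
         dist3 (H u' t') (H u t) < eps) /\
    (forall t, I01 t -> H 0 t = g1 t) /\
    (forall t, I01 t -> H 1 t = g2 t) /\
    (forall u, I01 u -> H u 0 = g1 0) /\
    (forall u, I01 u -> H u 1 = g1 1).

Definition concat (g h : path) : path :=
  fun t => if Rle_dec t (1/2) then g (2 * t) else h (2 * t - 1).
Definition rev (g : path) : path := fun t => g (1 - t).
Definition seg (p q : pt) : path := fun t =>
  mkpt (Cplus (pS p) (Cmult (RtoC t) (Cminus (pS q) (pS p))))
       (Cplus (pZ p) (Cmult (RtoC t) (Cminus (pZ q) (pZ p))))
       (Cplus (pC p) (Cmult (RtoC t) (Cminus (pC q) (pC p)))).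
Definition cpath (p : pt) : path := fun _ => p.

Definition path_from_x0 (g : path) : Prop := path_in_N g /\ g 0 = x0'.
Definition loop_x0 (g : path) : Prop := path_from_x0 g /\ g 1 = x0'.

(** Given a set P of loops (closed under homotopy), the loops representing
    elements of the subgroup of pi_1(N#, x0') generated by commutators of
    elements of P. *)
Inductive derived (P : path -> Prop) : path -> Prop :=
| der_comm : forall a b, P a -> P b ->
    derived P (concat (concat (concat a b) (rev a)) (rev b))
| der_one : derived P (cpath x0')
| der_mul : forall a b, derived P a -> derived P b -> derived P (concat a b)
| der_inv : forall a, derived P a -> derived P (rev a)
| der_homot : forall a b, derived P a -> loop_x0 b -> homotopic a b -> derived P b.

Definition pi1' : path -> Prop := derived loop_x0.
Definition pi1'' : path -> Prop := derived pi1'.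

Definition monodromy (tau : path) (f : path -> C) (g : path) : C :=
  Cminus (f (concat tau g)) (f g).

(* Main.v *)
(** Put [M = log (- z)] and [b = c - 1/2]. For [Re b > 0] and [|Im M| < pi] the Lindelof integral
[1/2 int_R e^(iMr) (b + ir)^(-s) / cosh (pi r) dr] converges for every [s] and, for [|z| < 1], equals the
reflected series [sum_n (-1)^n e^(M(n+1/2)) (b + n + 1/2)^(-s)], that is [e^(M/2)] times the Lerch series.
Expanding [1 / (2 cosh (pi r))] in powers of [e^(-2 pi r)] isolates the terms
[int_0^oo e^(-yr) (b +- ir)^(-s) dr] with [y = (2m+1) pi -+ iM]. Each is an incomplete gamma
function: a first order equation in [y] continues it to an entire function of [log y], and the
remainder after [J] terms is holomorphic for [|Im M| < (2J+1) pi]. The functional equation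
[Phi(c) = c^(-s) + z Phi(c+1)], which becomes a Fourier-type summation at the midpoint of [0,1],
moves [c] into the right half-plane.

The continuation along a path thus depends only on its end point and on the transported values of [M],
of the [log (c + n)], and of the logarithms of the numbers [(2m+1) pi -+ iM]. Loops in the commutator
subgroup bring [M] and the [log (c + n)] back to their initial values and change the remaining
logarithms by a homomorphism to an abelian group, which is trivial on the second commutator subgroup. *)

Require Import Defs.
From Stdlib Require Import Reals Lra Lia Psatz Classical ClassicalEpsilon FunctionalExtensionality.
From Coquelicot Require Import Coquelicot.
Open Scope R_scope.

(** * Complex exponential and logarithm *)

(** No contour is moved and no residue is taken: the Lindelof integral is never compared with the
    series directly. Everything rests on the shift identity [Phi_half_shift], by which [Zval] trades
    one term of the series against a unit step in [b]; iterating it for [|z| < 1] leaves a remainder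
    of size [|z|^(N - 1/2)]. The obstacle is that this identity is needed for arbitrary values of
    the logarithms, where the integral has no meaning. It survives because, for each single term,
    [ray_cont] at [b] minus [e^(d y)] times [ray_cont] at [b + 1] is an integral over [0,1] that is
    entire in [y], hence blind to the branch of [log y]. Adding up [J] of these integrals produces a
    Dirichlet kernel. The numbers [J] and [N] count the terms that are treated one by one. A path is
    compact, so all logarithms of higher index stay principal along it, and the value does not
    change when [J] or [N] grows. The transported logarithms themselves are kept for every index, so
    that monodromy becomes a bookkeeping of increments that never mentions [J] and [N]. *)

Lemma C_eq (a b : C) : fst a = fst b -> snd a = snd b -> a = b.
Proof. destruct a, b; simpl; intros; subst; reflexivity. Qed.

Lemma exp_mono x y : x <= y -> exp x <= exp y.
Proof. intros [H|H]. left; apply exp_increasing; auto. subst; lra. Qed.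

Lemma cexp_plus a b : cexp (a + b)%C = (cexp a * cexp b)%C.
Proof.
  apply C_eq; unfold cexp; simpl; rewrite exp_plus, ?cos_plus, ?sin_plus; ring.
Qed.

Lemma cexp_0 : cexp 0 = RtoC 1.
Proof. apply C_eq; unfold cexp; simpl; rewrite exp_0, ?cos_0, ?sin_0; ring. Qed.

Lemma Cmod_cexp w : Cmod (cexp w) = exp (fst w).
Proof.
  unfold Cmod, cexp; simpl.
  replace (_ + _) with (Rsqr (exp (fst w))).
  - apply sqrt_Rsqr. left; apply exp_pos.
  - generalize (sin2_cos2 (snd w)); unfold Rsqr; intros H.
    transitivity (exp (fst w) * exp (fst w) * (sin (snd w) * sin (snd w) + cos (snd w) * cos (snd w))).
    rewrite H; ring. ring.
Qed.

Lemma cexp_neq0 w : cexp w <> 0.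
Proof.
  intros H. generalize (exp_pos (fst w)). rewrite <- Cmod_cexp, H, Cmod_0. lra.
Qed.

Lemma cexp_opp w : cexp (- w)%C = (/ cexp w)%C.
Proof.
  assert (H : (cexp w * cexp (- w) = 1)%C).
  { rewrite <- cexp_plus, Cplus_opp_r, cexp_0; reflexivity. }
  transitivity (/ cexp w * (cexp w * cexp (- w)))%C.
  - field. apply cexp_neq0.
  - rewrite H. ring.
Qed.

Lemma cexp_minus a b : cexp (a - b)%C = (cexp a / cexp b)%C.
Proof. unfold Cminus; rewrite cexp_plus, cexp_opp. reflexivity. Qed.

Lemma Cmod_fst (a : C) : Rabs (fst a) <= Cmod a.
Proof. eapply Rle_trans. 2: apply Rmax_Cmod. apply Rmax_l. Qed.
Lemma Cmod_snd (a : C) : Rabs (snd a) <= Cmod a.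
Proof. eapply Rle_trans. 2: apply Rmax_Cmod. apply Rmax_r. Qed.
Lemma Cmod_le_sum (a : C) : Cmod a <= Rabs (fst a) + Rabs (snd a).
Proof.
  unfold Cmod. rewrite <- (sqrt_Rsqr (Rabs (fst a) + Rabs (snd a))).
  - apply sqrt_le_1_alt. unfold Rsqr.
    assert (H1 := Rabs_pos (fst a)); assert (H2 := Rabs_pos (snd a)).
    assert (H3 := pow2_abs (fst a)); assert (H4 := pow2_abs (snd a)). nra.
  - assert (H1 := Rabs_pos (fst a)); assert (H2 := Rabs_pos (snd a)). lra.
Qed.
Lemma Cmod_minus_sym (a b : C) : Cmod (a - b)%C = Cmod (b - a)%C.
Proof. rewrite <- Cmod_opp. f_equal. ring. Qed.
Lemma Cmod_minus_le (a b : C) : Cmod (a - b)%C <= Cmod a + Cmod b.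
Proof. unfold Cminus. eapply Rle_trans. apply Cmod_triangle. rewrite Cmod_opp; lra. Qed.
Lemma Cmod_tri_sub (a b : C) : Cmod a <= Cmod (a - b)%C + Cmod b.
Proof. replace a with ((a - b) + b)%C at 1 by ring. apply Cmod_triangle. Qed.

(** * Complex-valued functions of a real variable: derivatives and mean value inequality *)

Definition cder (f : R -> C) (t : R) (l : C) :=
  is_derive (fun x => fst (f x)) t (fst l) /\ is_derive (fun x => snd (f x)) t (snd l).

Lemma cder_eq f t l l' : cder f t l -> l = l' -> cder f t l'.
Proof. intros; subst; auto. Qed.

Lemma is_derive_eqv (f : R -> R) t (l l' : R) : is_derive f t l -> l = l' -> is_derive f t l'.
Proof. intros; subst; auto. Qed.
Lemma is_derive_const_R (a t : R) : is_derive (fun _ : R => a) t 0.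
Proof. exact (is_derive_const a t). Qed.
Lemma is_derive_id_R (t : R) : is_derive (fun x : R => x) t 1.
Proof. exact (is_derive_id t). Qed.
Lemma is_derive_plus_R (f g : R -> R) t a b : is_derive f t a -> is_derive g t b ->
  is_derive (fun x => f x + g x) t (a + b).
Proof. exact (is_derive_plus f g t a b). Qed.
Lemma is_derive_minus_R (f g : R -> R) t a b : is_derive f t a -> is_derive g t b ->
  is_derive (fun x => f x - g x) t (a - b).
Proof. exact (is_derive_minus f g t a b). Qed.
Lemma is_derive_opp_R (f : R -> R) t a : is_derive f t a -> is_derive (fun x => - f x) t (- a).
Proof. exact (is_derive_opp f t a). Qed.
Lemma is_derive_mult_R (f g : R -> R) t a b : is_derive f t a -> is_derive g t b ->
  is_derive (fun x => f x * g x) t (a * g t + f t * b).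
Proof. intros; apply (is_derive_mult f g t a b); auto. intros; apply Rmult_comm. Qed.
Lemma is_derive_cont_R (f : R -> R) t a : is_derive f t a -> continuous f t.
Proof. intros; apply (ex_derive_continuous f t); eexists; eauto. Qed.

Lemma cder_const a t : cder (fun _ => a) t 0.
Proof. split; simpl; apply is_derive_const_R. Qed.
Lemma cder_id t : cder RtoC t 1.
Proof. split; simpl; [apply is_derive_id_R | apply is_derive_const_R]. Qed.
Lemma cder_plus f g t lf lg : cder f t lf -> cder g t lg -> cder (fun x => f x + g x)%C t (lf + lg)%C.
Proof. intros [A1 A2] [B1 B2]; split; apply is_derive_plus_R; auto. Qed.
Lemma cder_opp f t lf : cder f t lf -> cder (fun x => - f x)%C t (- lf)%C.
Proof. intros [A1 A2]; split; apply is_derive_opp_R; auto. Qed.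
Lemma cder_minus f g t lf lg : cder f t lf -> cder g t lg -> cder (fun x => f x - g x)%C t (lf - lg)%C.
Proof. intros; apply cder_plus; auto; apply cder_opp; auto. Qed.
Lemma cder_mult f g t lf lg : cder f t lf -> cder g t lg ->
  cder (fun x => f x * g x)%C t (lf * g t + f t * lg)%C.
Proof.
  intros [A1 A2] [B1 B2]; split; simpl.
  - eapply is_derive_eqv.
    apply is_derive_minus_R; apply is_derive_mult_R; eassumption. simpl; ring.
  - eapply is_derive_eqv.
    apply is_derive_plus_R; apply is_derive_mult_R; eassumption. simpl; ring.
Qed.
Lemma cder_scal a f t lf : cder f t lf -> cder (fun x => a * f x)%C t (a * lf)%C.
Proof.
  intros H. eapply cder_eq. apply cder_mult; [apply cder_const | apply H]. cbv beta; ring.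
Qed.
Lemma cder_exp f t l : cder f t l -> cder (fun x => cexp (f x)) t (cexp (f t) * l)%C.
Proof.
  intros [H1 H2].
  assert (He : is_derive (fun x => exp (fst (f x))) t (fst l * exp (fst (f t)))).
  { apply (is_derive_comp exp (fun x => fst (f x))); auto. apply is_derive_Reals, derivable_pt_lim_exp. }
  assert (Hc : is_derive (fun x => cos (snd (f x))) t (snd l * - sin (snd (f t)))).
  { apply (is_derive_comp cos (fun x => snd (f x))); auto. apply is_derive_Reals, derivable_pt_lim_cos. }
  assert (Hs : is_derive (fun x => sin (snd (f x))) t (snd l * cos (snd (f t)))).
  { apply (is_derive_comp sin (fun x => snd (f x))); auto. apply is_derive_Reals, derivable_pt_lim_sin. }
  split; simpl; (eapply is_derive_eqv; [apply is_derive_mult_R; eassumption|cbv beta; ring]).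
Qed.

Lemma cmvt (f df : R -> C) K a b : a <= b ->
  (forall t, a <= t <= b -> cder f t (df t)) -> (forall t, a <= t <= b -> Cmod (df t) <= K) ->
  Cmod (f b - f a)%C <= K * (b - a).
Proof.
  intros Hab Hd HK.
  (* real mean value theorem for the component of [f] along [f b - f a] *)
  set (w := (f b - f a)%C).
  set (p := fun t => fst w * fst (f t) + snd w * snd (f t)).
  destruct (MVT_gen p a b (fun t => fst w * fst (df t) + snd w * snd (df t))) as [c [Hc E]].
  - intros x. rewrite Rmin_left, Rmax_right by auto. intros Hx.
    destruct (Hd x) as [H1 H2]. lra.
    apply is_derive_plus_R.
    + eapply is_derive_eqv. apply is_derive_mult_R. apply is_derive_const_R. eassumption. cbv beta; ring.
    + eapply is_derive_eqv. apply is_derive_mult_R. apply is_derive_const_R. eassumption. cbv beta; ring.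
  - intros x. rewrite Rmin_left, Rmax_right by auto. intros Hx.
    destruct (Hd x) as [H1 H2]. lra.
    apply continuity_pt_filterlim.
    apply (continuous_plus (fun t => fst w * fst (f t)) (fun t => snd w * snd (f t))).
    + apply (continuous_mult (fun _ => fst w) (fun t => fst (f t))). apply continuous_const. eapply is_derive_cont_R; eassumption.
    + apply (continuous_mult (fun _ => snd w) (fun t => snd (f t))). apply continuous_const. eapply is_derive_cont_R; eassumption.
  - rewrite Rmin_left, Rmax_right in Hc by auto.
    assert (E2 : Cmod w * Cmod w = p b - p a).
    { unfold Cmod at 1 2. rewrite sqrt_sqrt. unfold p, w; simpl; ring.
      generalize (pow2_ge_0 (fst w)) (pow2_ge_0 (snd w)); lra. }
    assert (E3 : fst w * fst (df c) + snd w * snd (df c) <= Cmod w * Cmod (df c)).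
    { rewrite <- (Cmod_conj w), <- Cmod_mult. eapply Rle_trans. 2: apply Cmod_fst.
      eapply Rle_trans. 2: apply Rle_abs. simpl. lra. }
    specialize (HK c Hc).
    assert (0 <= Cmod w) by apply Cmod_ge_0.
    destruct (Req_dec (Cmod w) 0) as [Z|Z].
    + fold w. rewrite Z. assert (0 <= Cmod (df c)) by apply Cmod_ge_0. nra.
    + fold w. apply Rmult_le_reg_l with (Cmod w). lra.
      rewrite E2, E.
      apply Rle_trans with (Cmod w * Cmod (df c) * (b - a)).
      apply Rmult_le_compat_r; lra.
      rewrite Rmult_assoc. apply Rmult_le_compat_l; auto. apply Rmult_le_compat_r; lra.
Qed.

Lemma cexp_bound_line h t : 0 <= t <= 1 -> Cmod (cexp (t * h)%C) <= exp (Cmod h).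
Proof.
  intros Ht. rewrite Cmod_cexp. simpl.
  assert (H := Cmod_fst h). assert (H0 := Rle_abs (fst h)). assert (H1 := Rabs_pos (fst h)).
  assert (t * fst h - 0 * snd h <= Cmod h) by nra.
  destruct (Req_dec (t * fst h - 0 * snd h) (Cmod h)) as [E|E].
  rewrite E; lra. left; apply exp_increasing; lra.
Qed.

Lemma cder_line h t : cder (fun x => (x * h)%C) t h.
Proof.
  eapply cder_eq. apply cder_mult. apply cder_id. apply cder_const. cbv beta; ring.
Qed.

Lemma cexp_1_bound_line h t : 0 <= t <= 1 -> Cmod (cexp (t * h) - 1)%C <= Cmod h * exp (Cmod h).
Proof.
  intros Ht.
  assert (H := cmvt (fun x => cexp (x * h)%C) (fun x => cexp (x * h) * h)%C (Cmod h * exp (Cmod h)) 0 t).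
  cbv beta in H.
  replace (cexp (RtoC 0 * h)%C) with (RtoC 1) in H.
  2: { replace (RtoC 0 * h)%C with (RtoC 0) by ring. now rewrite cexp_0. }
  assert (0 <= Cmod h * exp (Cmod h)).
  { apply Rmult_le_pos. apply Cmod_ge_0. left; apply exp_pos. }
  eapply Rle_trans. apply H. lra.
  - intros. apply cder_exp, cder_line.
  - intros. rewrite Cmod_mult, Rmult_comm. apply Rmult_le_compat_l. apply Cmod_ge_0.
    apply cexp_bound_line; lra.
  - rewrite Rminus_0_r. nra.
Qed.

(** The mean value inequality applied a second time: along the segment from 0 to [h] the derivative
    of [cexp (x h) - x h] is [h (cexp (x h) - 1)], already bounded by [cexp_1_bound_line]. *)
Lemma cexp_2_bound h : Cmod (cexp h - 1 - h)%C <= Cmod h ^ 2 * exp (Cmod h).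
Proof.
  assert (H := cmvt (fun x => cexp (x * h) - x * h)%C (fun x => cexp (x * h) * h - h)%C (Cmod h ^ 2 * exp (Cmod h)) 0 1).
  cbv beta in H.
  replace (cexp (RtoC 0 * h)%C) with (RtoC 1) in H.
  2: { replace (RtoC 0 * h)%C with (RtoC 0) by ring. now rewrite cexp_0. }
  replace (1 * h)%C with h in H by ring.
  replace (cexp h - 1 - h)%C with (cexp h - h - (1 - 0 * h))%C by ring.
  eapply Rle_trans. apply H. lra.
  - intros. apply cder_minus. apply cder_exp, cder_line. apply cder_line.
  - intros. replace (cexp (t * h) * h - h)%C with (h * (cexp (t * h) - 1))%C by ring.
    rewrite Cmod_mult. simpl. rewrite Rmult_1_r, Rmult_assoc.
    apply Rmult_le_compat_l. apply Cmod_ge_0. apply cexp_1_bound_line; lra.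
  - lra.
Qed.

(* Only meaningful on the open right half-plane, which is all that is used. *)
Definition Clog (w : C) : C := (ln (Cmod w), atan (snd w / fst w)).

Lemma Cmod_pos_fst (w : C) : 0 < fst w -> 0 < Cmod w.
Proof. intros. assert (X := Cmod_fst w). assert (Y := Rle_abs (fst w)). lra. Qed.

Lemma cexp_Clog (w : C) : 0 < fst w -> cexp (Clog w) = w.
Proof.
  intros Hw. assert (Hm := Cmod_pos_fst w Hw).
  assert (E : Cmod w = fst w * sqrt (1 + (snd w / fst w)²)).
  { unfold Cmod. rewrite <- (sqrt_Rsqr (fst w)) at 2 by lra.
    rewrite <- sqrt_mult. f_equal. unfold Rsqr. field. lra. apply Rle_0_sqr.
    generalize (Rle_0_sqr (snd w / fst w)); lra. }
  assert (0 < sqrt (1 + (snd w / fst w)²)).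
  { apply sqrt_lt_R0. generalize (Rle_0_sqr (snd w / fst w)); lra. }
  apply C_eq; unfold cexp, Clog; simpl; rewrite exp_ln by auto.
  - rewrite cos_atan, E. field. lra.
  - rewrite sin_atan, E. field. lra.
Qed.

Lemma Clog_im (w : C) : Rabs (snd (Clog w)) < PI / 2.
Proof.
  unfold Clog; simpl. generalize (atan_bound (snd w / fst w)). intros. apply Rabs_def1; lra.
Qed.

Lemma cexp_1_small x : cexp x = 1 -> Rabs (snd x) < 2 * PI -> x = 0.
Proof.
  intros H Hx.
  assert (Hf : fst x = 0).
  { assert (exp (fst x) = 1) by (rewrite <- Cmod_cexp, H; apply Cmod_1).
    rewrite <- exp_0 in H0. apply exp_inv; auto. }
  assert (Hc : cos (snd x) = 1).
  { assert (fst (cexp x) = 1) by (rewrite H; reflexivity). unfold cexp in H0; simpl in H0.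
    rewrite Hf, exp_0 in H0. lra. }
  apply C_eq; auto. simpl.
  (* Since [cos v = 1 - 2 sin(v/2)^2], the half angle has sine zero, and it lies strictly between
     [- PI] and [PI]. *)
  assert (Hs : sin (snd x / 2) = 0).
  { assert (X := cos_2a_sin (snd x / 2)). replace (2 * (snd x / 2)) with (snd x) in X by field. nra. }
  destruct (Rtotal_order (snd x) 0) as [L|[E|G]]; auto.
  - assert (X := sin_gt_0 (- (snd x / 2))). rewrite sin_neg in X.
    rewrite Rabs_left in Hx by auto. lra.
  - assert (X := sin_gt_0 (snd x / 2)). rewrite Rabs_right in Hx by lra. lra.
Qed.

Lemma cexp_eq_small x y : cexp x = cexp y -> Rabs (snd x - snd y) < 2 * PI -> x = y.
Proof.
  intros H Hs.
  assert (x - y = 0)%C.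
  { apply cexp_1_small; auto. rewrite cexp_minus, H. field. apply cexp_neq0. }
  replace x with (x - y + y)%C by ring. rewrite H0; ring.
Qed.

Lemma Clog_1_der q t : Cmod q <= 1/2 -> 0 <= t <= 1 -> cder (fun x => Clog (1 + x * q)%C) t (q / (1 + t * q))%C.
Proof.
  intros Hq Ht. destruct q as [a b].
  assert (Ha := Cmod_fst (a, b)). simpl in Ha.
  assert (Hp : 0 < 1 + t * a).
  { assert (Rabs a <= 1/2) by lra. apply Rabs_le_between in H. nra. }
  assert (Hn : (1 + t * a) * (1 + t * a) + (t * b) * (t * b) <> 0) by nra.
  split; unfold Clog; simpl.
  - apply is_derive_ext with (f := fun x => ln (sqrt ((1 + x * a) ^ 2 + (x * b) ^ 2))).
    { intros x. unfold Cmod; simpl. f_equal. f_equal. ring. }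
    auto_derive.
    + assert (0 < (1 + t * a) * ((1 + t * a) * 1) + t * b * (t * b * 1)) by nra.
      repeat split; auto. apply sqrt_lt_R0. auto.
    + set (u := (1 + t * a) * ((1 + t * a) * 1) + t * b * (t * b * 1)).
      assert (Hu : 0 < u) by (unfold u; nra).
      transitivity (((1 + t * a) * a + t * b * b) / (sqrt u * sqrt u)).
      { assert (0 < sqrt u) by (apply sqrt_lt_R0; auto).
        unfold u in *. field. lra. }
      rewrite sqrt_sqrt by lra. unfold u. field. nra.
  - apply is_derive_ext with (f := fun x => atan ((x * b) / (1 + x * a))).
    { intros x. f_equal. f_equal; ring. }
    auto_derive. lra. field. repeat split; nra.
Qed.

Lemma Clog_1 : Clog 1 = 0.
Proof. unfold Clog. simpl. rewrite Cmod_1, ln_1. unfold Rdiv. rewrite Rmult_0_l, atan_0. reflexivity. Qed.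

Lemma Cmod_1_plus_ge q t : Cmod q <= 1/2 -> 0 <= t <= 1 -> 1/2 <= Cmod (1 + t * q)%C.
Proof.
  intros Hq Ht. assert (H := Cmod_tri_sub 1 (- (t * q))%C). rewrite Cmod_1, Cmod_opp, Cmod_mult, Cmod_R in H.
  replace (1 - - (t * q))%C with (1 + t * q)%C in H by ring. rewrite Rabs_right in H by lra.
  assert (X := Cmod_ge_0 q). nra.
Qed.

Lemma Cmod_neq0 (a : C) : 0 < Cmod a -> a <> 0.
Proof. intros H E. rewrite E, Cmod_0 in H. lra. Qed.

Lemma Clog_1_bound1 q : Cmod q <= 1/2 -> Cmod (Clog (1 + q)%C) <= 2 * Cmod q.
Proof.
  intros Hq.
  assert (H := cmvt (fun x => Clog (1 + x * q)%C) (fun t => (q / (1 + t * q))%C) (2 * Cmod q) 0 1).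
  cbv beta in H. replace (1 + 0 * q)%C with (RtoC 1) in H by ring. rewrite Clog_1 in H.
  replace (1 + 1 * q)%C with (1 + q)%C in H by ring.
  replace (Clog (1 + q) - 0)%C with (Clog (1 + q)) in H by ring.
  eapply Rle_trans. apply H. lra.
  - intros. apply Clog_1_der; auto.
  - intros t Ht. assert (X := Cmod_1_plus_ge q t Hq Ht). rewrite Cmod_div. 2: apply Cmod_neq0; lra.
    apply Rle_div_l. lra. assert (Y := Cmod_ge_0 q). nra.
  - lra.
Qed.

Lemma Clog_1_bound2 q : Cmod q <= 1/2 -> Cmod (Clog (1 + q) - q)%C <= 2 * Cmod q ^ 2.
Proof.
  intros Hq.
  assert (H := cmvt (fun x => Clog (1 + x * q) - x * q)%C (fun t => (q / (1 + t * q) - q)%C) (2 * Cmod q ^ 2) 0 1).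
  cbv beta in H. replace (1 + 0 * q)%C with (RtoC 1) in H by ring. rewrite Clog_1 in H.
  replace (1 + 1 * q)%C with (1 + q)%C in H by ring.
  replace (Clog (1 + q) - 1 * q - (0 - 0 * q))%C with (Clog (1 + q) - q)%C in H by ring.
  eapply Rle_trans. apply H. lra.
  - intros. apply cder_minus. apply Clog_1_der; auto. apply cder_line.
  - intros t Ht. assert (X := Cmod_1_plus_ge q t Hq Ht).
    assert (Z : (1 + t * q)%C <> 0) by (apply Cmod_neq0; lra).
    replace (q / (1 + t * q) - q)%C with ((- (t * (q * q))) / (1 + t * q))%C by (field; auto).
    rewrite Cmod_div by auto. apply Rle_div_l. lra.
    rewrite Cmod_opp, !Cmod_mult, Cmod_R, Rabs_right by lra.
    assert (Y := Cmod_ge_0 q). nra.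
  - lra.
Qed.

Lemma Clog_1_re q : Cmod q <= 1/2 -> 0 < fst (1 + q)%C.
Proof.
  intros H. simpl. assert (X := Cmod_fst q). assert (Y : Rabs (fst q) <= 1/2) by lra.
  apply Rabs_le_between in Y. lra.
Qed.

(** Both sides are logarithms of [w' / w]. Three arguments are involved, each below [PI / 2] in
    absolute value, so the sides differ by less than [2 PI] and must agree. *)
Lemma Clog_diff (w w' : C) : 0 < fst w -> 0 < fst w' -> Cmod ((w' - w) / w)%C <= 1/2 ->
  (Clog w' - Clog w = Clog (1 + (w' - w) / w))%C.
Proof.
  intros Hw Hw' Hq.
  assert (w <> 0) by (apply Cmod_neq0, Cmod_pos_fst; auto).
  assert (X := Clog_im w). assert (X' := Clog_im w'). assert (Y := Clog_im (1 + (w' - w) / w)%C).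
  apply cexp_eq_small.
  - rewrite cexp_minus, !cexp_Clog; auto. field; auto. apply Clog_1_re; auto.
  - assert (Z := PI_RGT_0). apply Rabs_def2 in X; apply Rabs_def2 in X'; apply Rabs_def2 in Y.
    change (snd (Clog w' - Clog w)%C) with (snd (Clog w') + - snd (Clog w)). apply Rabs_def1; lra.
Qed.

(** The errors are measured relative to [Cmod w], so that the same constants serve for all points
    [b + d r] of a ray. *)
Lemma Clog_quad (w w' : C) : 0 < fst w -> 0 < fst w' -> Cmod (w' - w)%C <= Cmod w / 2 ->
  Cmod (Clog w' - Clog w - (w' - w) / w)%C <= 2 * (Cmod (w' - w)%C / Cmod w) ^ 2 /\
  Cmod (Clog w' - Clog w)%C <= 2 * (Cmod (w' - w)%C / Cmod w).
Proof.
  intros Hw Hw' Hq.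
  assert (Hm := Cmod_pos_fst w Hw).
  assert (w <> 0) by (apply Cmod_neq0; auto).
  assert (Hq' : Cmod ((w' - w) / w)%C <= 1/2).
  { rewrite Cmod_div by auto. apply Rle_div_l; lra. }
  rewrite (Clog_diff w w') by auto. rewrite <- Cmod_div by auto. split.
  - apply Clog_1_bound2; auto.
  - apply Clog_1_bound1; auto.
Qed.

(** The slope [eps] is arbitrary: this is what lets [e^(-y r)] dominate [(b + d r)^(-s)] for every
    [s] as soon as [Re y > 0]. *)
Lemma Clog_growth (d b : C) eps : (d = Ci \/ d = (- Ci)%C) -> 0 < fst b -> 0 < eps ->
  exists K, 0 <= K /\ forall r, 0 <= r -> Cmod (Clog (b + d * r)%C) <= K + eps * r.
Proof.
  intros Hd Hb He.
  exists (Rabs (ln (fst b)) + Rabs (- ln eps - 1) + eps * Cmod b + PI / 2).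
  assert (HP := PI_RGT_0).
  assert (Hcb := Cmod_ge_0 b).
  split. { generalize (Rabs_pos (ln (fst b))) (Rabs_pos (- ln eps - 1)). nra. }
  intros r Hr.
  assert (Hf : fst (b + d * r)%C = fst b) by (destruct Hd; subst; simpl; ring).
  assert (Hge : fst b <= Cmod (b + d * r)%C).
  { rewrite <- Hf. eapply Rle_trans. apply Rle_abs. apply Cmod_fst. }
  assert (Hdm : Cmod d = 1) by (destruct Hd; subst; rewrite ?Cmod_opp; apply Cmod_Ci).
  assert (Hle : Cmod (b + d * r)%C <= Cmod b + r).
  { eapply Rle_trans. apply Cmod_triangle. rewrite Cmod_mult, Hdm, Cmod_R, Rabs_right by lra. lra. }
  set (m := Cmod (b + d * r)%C) in *.
  eapply Rle_trans. apply Cmod_le_sum.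
  assert (I := Clog_im (b + d * r)%C).
  assert (Rabs (fst (Clog (b + d * r)%C)) <= Rabs (ln (fst b)) + Rabs (- ln eps - 1) + eps * Cmod b + eps * r).
  { unfold Clog; simpl. fold m.
    assert (L : ln (fst b) <= ln m).
    { destruct Hge as [G|G]. left; apply ln_increasing; lra. rewrite <- G; lra. }
    (* This is [1 + x <= e^x] at [x = ln (eps m)]. *)
    assert (U : ln m <= eps * m - ln eps - 1).
    { assert (X := exp_ineq1_le (ln (eps * m) - 0)).
      assert (0 < eps * m) by (apply Rmult_lt_0_compat; lra).
      rewrite Rminus_0_r, exp_ln, ln_mult in X by lra. lra. }
    assert (eps * m <= eps * (Cmod b + r)) by (apply Rmult_le_compat_l; lra).
    assert (A1 := Rle_abs (- ln eps - 1)). assert (A2 := Rabs_pos (ln (fst b))).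
    assert (A3 := Rle_abs (- ln (fst b))). rewrite Rabs_Ropp in A3.
    assert (A4 := Rabs_pos (- ln eps - 1)).
    assert (0 <= eps * Cmod b) by nra. assert (0 <= eps * r) by nra.
    apply Rabs_le_between. split; lra. }
  lra.
Qed.

(** * Integrals of complex-valued functions *)

Definition ccont {U : UniformSpace} (f : U -> C) (x : U) :=
  continuous (fun y => fst (f y)) x /\ continuous (fun y => snd (f y)) x.

Section Ccont.
Context {U : UniformSpace}.
Implicit Types (f g : U -> C) (x : U).

Lemma cont_plus_R (f g : U -> R) x : continuous f x -> continuous g x -> continuous (fun y => f y + g y) x.
Proof. exact (continuous_plus f g x). Qed.
Lemma cont_minus_R (f g : U -> R) x : continuous f x -> continuous g x -> continuous (fun y => f y - g y) x.
Proof. exact (continuous_minus f g x). Qed.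
Lemma cont_opp_R (f : U -> R) x : continuous f x -> continuous (fun y => - f y) x.
Proof. exact (continuous_opp f x). Qed.
Lemma cont_mult_R (f g : U -> R) x : continuous f x -> continuous g x -> continuous (fun y => f y * g y) x.
Proof. exact (continuous_mult f g x). Qed.
Lemma cont_pow2_R (f : U -> R) x : continuous f x -> continuous (fun y => f y ^ 2) x.
Proof. intros H. apply (cont_mult_R f (fun y => f y * 1)); auto. apply (cont_mult_R f (fun _ => 1)); auto. apply continuous_const. Qed.
Lemma cont_comp_R (f : U -> R) (h : R -> R) x : continuous f x -> continuity_pt h (f x) -> continuous (fun y => h (f y)) x.
Proof. intros H1 H2. apply continuous_comp; auto. apply continuity_pt_filterlim; auto. Qed.

Lemma ccont_const a x : ccont (fun _ => a) x.
Proof. split; apply continuous_const. Qed.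
Lemma ccont_RtoC (h : U -> R) x : continuous h x -> ccont (fun y => RtoC (h y)) x.
Proof. split; simpl; auto. apply continuous_const. Qed.
Lemma ccont_plus f g x : ccont f x -> ccont g x -> ccont (fun y => f y + g y)%C x.
Proof. intros [] []; split; simpl; apply cont_plus_R; auto. Qed.
Lemma ccont_opp f x : ccont f x -> ccont (fun y => - f y)%C x.
Proof. intros []; split; simpl; apply cont_opp_R; auto. Qed.
Lemma ccont_minus f g x : ccont f x -> ccont g x -> ccont (fun y => f y - g y)%C x.
Proof. intros; apply ccont_plus; auto; apply ccont_opp; auto. Qed.
Lemma ccont_mult f g x : ccont f x -> ccont g x -> ccont (fun y => f y * g y)%C x.
Proof.
  intros [] []; split; simpl; [apply cont_minus_R | apply cont_plus_R]; apply cont_mult_R; auto.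
Qed.
Lemma ccont_exp f x : ccont f x -> ccont (fun y => cexp (f y)) x.
Proof.
  intros []; split; simpl; apply cont_mult_R.
  - apply (cont_comp_R (fun y => fst (f y))); auto. apply derivable_continuous_pt, derivable_pt_exp.
  - apply (cont_comp_R (fun y => snd (f y)) cos); auto. apply continuity_cos.
  - apply (cont_comp_R (fun y => fst (f y))); auto. apply derivable_continuous_pt, derivable_pt_exp.
  - apply (cont_comp_R (fun y => snd (f y)) sin); auto. apply continuity_sin.
Qed.
Lemma cont_Cmod f x : ccont f x -> continuous (fun y => Cmod (f y)) x.
Proof.
  intros [A B]. unfold Cmod.
  apply (cont_comp_R (fun y => fst (f y) ^ 2 + snd (f y) ^ 2) sqrt).
  - apply cont_plus_R; apply cont_pow2_R; auto.
  - apply continuity_pt_sqrt. generalize (pow2_ge_0 (fst (f x))) (pow2_ge_0 (snd (f x))). lra.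
Qed.
Lemma cont_inv_R (f : U -> R) x : continuous f x -> f x <> 0 -> continuous (fun y => / f y) x.
Proof.
  intros H Hn. apply (cont_comp_R f Rinv); auto.
  apply (continuity_pt_inv (fun y => y)); auto. apply derivable_continuous_pt, derivable_pt_id.
Qed.
Lemma ccont_inv f x : ccont f x -> f x <> RtoC 0 -> ccont (fun y => / f y)%C x.
Proof.
  intros Hf Hn.
  assert (Hm : fst (f x) ^ 2 + snd (f x) ^ 2 <> 0).
  { intros H. apply Hn. apply C_eq; simpl; generalize (pow2_ge_0 (fst (f x))) (pow2_ge_0 (snd (f x))); nra. }
  destruct Hf as [A B].
  assert (X : continuous (fun y => / (fst (f y) ^ 2 + snd (f y) ^ 2)) x).
  { apply cont_inv_R; auto. apply cont_plus_R; apply cont_pow2_R; auto. }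
  split; unfold Cinv; simpl; unfold Rdiv; apply cont_mult_R; auto. apply cont_opp_R; auto.
Qed.
Lemma ccont_div f g x : ccont f x -> ccont g x -> g x <> RtoC 0 -> ccont (fun y => f y / g y)%C x.
Proof. intros; apply ccont_mult; auto. apply ccont_inv; auto. Qed.
Lemma ccont_Clog f x : ccont f x -> 0 < fst (f x) -> ccont (fun y => Clog (f y)) x.
Proof.
  intros Hf Hp. split; unfold Clog; simpl.
  - apply (cont_comp_R (fun y => Cmod (f y)) ln). apply cont_Cmod; auto.
    apply derivable_continuous_pt. exists (/ Cmod (f x)). apply derivable_pt_lim_ln. apply Cmod_pos_fst; auto.
  - destruct Hf. apply (cont_comp_R (fun y => snd (f y) / fst (f y)) atan).
    unfold Rdiv. apply cont_mult_R; auto. apply cont_inv_R; auto. lra.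
    apply derivable_continuous_pt. apply derivable_pt_atan.
Qed.
Lemma ccont_ext f g x : (forall y, f y = g y) -> ccont f x -> ccont g x.
Proof. intros H [A B]; split; [apply (continuous_ext (fun y => fst (f y))) | apply (continuous_ext (fun y => snd (f y)))]; auto; intros y; now rewrite (H y). Qed.
End Ccont.

Lemma ccont_id_R x : ccont RtoC x.
Proof. apply (ccont_RtoC (fun y : R => y)). apply continuous_id. Qed.
Lemma ccont_comp {U V : UniformSpace} (h : U -> V) (f : V -> C) x :
  continuous h x -> ccont f (h x) -> ccont (fun y => f (h y)) x.
Proof.
  intros H [A B]; split; [apply (continuous_comp h (fun y => fst (f y))) | apply (continuous_comp h (fun y => snd (f y)))]; auto.
Qed.

(** The last case closes a goal by a hypothesis of the form [forall x, ccont g x] whose [g] is the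
    function of the goal up to beta. Continuity facts outside the syntactic cases are therefore put
    into the context before [cc] is called. *)
Ltac cc1 :=
  lazymatch goal with
  | |- ccont (fun _ => ?a) _ => apply (ccont_const a)
  | |- ccont RtoC _ => apply ccont_id_R
  | |- ccont (fun x => RtoC x) _ => apply ccont_id_R
  | |- ccont (fun y => Cplus (@?f y) (@?g y)) _ => apply (ccont_plus f g); cbv beta
  | |- ccont (fun y => Cminus (@?f y) (@?g y)) _ => apply (ccont_minus f g); cbv beta
  | |- ccont (fun y => Cmult (@?f y) (@?g y)) _ => apply (ccont_mult f g); cbv beta
  | |- ccont (fun y => Copp (@?f y)) _ => apply (ccont_opp f); cbv beta
  | |- ccont (fun y => cexp (@?f y)) _ => apply (ccont_exp f); cbv beta
  | |- ccont ?f ?x => match goal with H : _ |- _ =>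
      let T := type of (H x) in let T' := eval cbv beta in T in
      lazymatch T' with ccont ?g x =>
        let f1 := eval cbv beta in (fun t : R => f t) in let g1 := eval cbv beta in (fun t : R => g t) in
        constr_eq f1 g1; exact (H x) end end
  end.
Ltac cc := cbv beta; repeat cc1.

Definition CInt (f : R -> C) (a b : R) : C :=
  (RInt (fun x => fst (f x)) a b, RInt (fun x => snd (f x)) a b).

Lemma ex_RInt_fst (f : R -> C) a b : (forall x : R, ccont f x) -> ex_RInt (fun x => fst (f x)) a b.
Proof. intros H. apply (ex_RInt_continuous (V := R_CompleteNormedModule)). intros z _; exact (proj1 (H z)). Qed.
Lemma ex_RInt_snd (f : R -> C) a b : (forall x : R, ccont f x) -> ex_RInt (fun x => snd (f x)) a b.
Proof. intros H. apply (ex_RInt_continuous (V := R_CompleteNormedModule)). intros z _; exact (proj2 (H z)). Qed.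

Lemma CInt_ext (f g : R -> C) a b : (forall x, Rmin a b <= x <= Rmax a b -> f x = g x) -> CInt f a b = CInt g a b.
Proof.
  intros H; unfold CInt; f_equal; apply RInt_ext; intros; rewrite H; auto; lra.
Qed.
Lemma RInt_plus_R (f g : R -> R) a b : ex_RInt f a b -> ex_RInt g a b ->
  RInt (fun x => f x + g x) a b = RInt f a b + RInt g a b.
Proof. exact (RInt_plus f g a b). Qed.
Lemma RInt_minus_R (f g : R -> R) a b : ex_RInt f a b -> ex_RInt g a b ->
  RInt (fun x => f x - g x) a b = RInt f a b - RInt g a b.
Proof. exact (RInt_minus f g a b). Qed.
Lemma RInt_scal_R (f : R -> R) a b c : ex_RInt f a b ->
  RInt (fun x => c * f x) a b = c * RInt f a b.
Proof. exact (RInt_scal f a b c). Qed.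
Lemma ex_RInt_scal_R (f : R -> R) a b c : ex_RInt f a b -> ex_RInt (fun x => c * f x) a b.
Proof. exact (ex_RInt_scal f a b c). Qed.

Lemma CInt_plus (f g : R -> C) a b : (forall x : R, ccont f x) -> (forall x : R, ccont g x) ->
  CInt (fun x => f x + g x)%C a b = (CInt f a b + CInt g a b)%C.
Proof.
  intros Hf Hg. apply C_eq; unfold CInt; simpl; apply RInt_plus_R; auto using ex_RInt_fst, ex_RInt_snd.
Qed.
Lemma CInt_scal c (f : R -> C) a b : (forall x : R, ccont f x) ->
  CInt (fun x => c * f x)%C a b = (c * CInt f a b)%C.
Proof.
  intros Hf. assert (A := ex_RInt_fst f a b Hf). assert (B := ex_RInt_snd f a b Hf).
  apply C_eq; unfold CInt; simpl; rewrite ?RInt_minus_R, ?RInt_plus_R, !RInt_scal_R; auto using ex_RInt_scal_R.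
Qed.
Lemma CInt_minus (f g : R -> C) a b : (forall x : R, ccont f x) -> (forall x : R, ccont g x) ->
  CInt (fun x => f x - g x)%C a b = (CInt f a b - CInt g a b)%C.
Proof.
  intros Hf Hg. apply C_eq; unfold CInt; simpl.
  apply RInt_minus_R; auto using ex_RInt_fst. apply RInt_minus_R; auto using ex_RInt_snd.
Qed.
Lemma CInt_Chasles (f : R -> C) a b c : (forall x : R, ccont f x) -> (CInt f a b + CInt f b c)%C = CInt f a c.
Proof.
  intros Hf. apply C_eq; unfold CInt; simpl.
  apply (RInt_Chasles (fun x => fst (f x)) a b c); apply ex_RInt_fst; auto.
  apply (RInt_Chasles (fun x => snd (f x)) a b c); apply ex_RInt_snd; auto.
Qed.

(** As in [cmvt], the integrand is projected onto the direction of its own integral, which keeps the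
    constant 1 that coordinatewise estimates would lose. *)
Lemma CInt_norm (f : R -> C) (g : R -> R) a b : a <= b -> (forall x : R, ccont f x) -> ex_RInt g a b ->
  (forall x, a <= x <= b -> Cmod (f x) <= g x) -> Cmod (CInt f a b) <= RInt g a b.
Proof.
  intros Hab Hf Hg Hle.
  set (w := CInt f a b).
  assert (A := ex_RInt_fst f a b Hf). assert (B := ex_RInt_snd f a b Hf).
  assert (E : Cmod w * Cmod w = RInt (fun x => fst w * fst (f x) + snd w * snd (f x)) a b).
  { rewrite RInt_plus_R, !RInt_scal_R; auto using ex_RInt_scal_R.
    unfold Cmod. rewrite sqrt_sqrt. unfold w at 1 2; simpl. ring.
    generalize (pow2_ge_0 (fst w)) (pow2_ge_0 (snd w)); lra. }
  assert (L : Cmod w * Cmod w <= Cmod w * RInt g a b).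
  { rewrite E. rewrite <- RInt_scal_R by auto. apply RInt_le; auto.
    - apply (ex_RInt_plus (V := R_NormedModule) (fun x => fst w * fst (f x)) (fun x => snd w * snd (f x))); auto using ex_RInt_scal_R.
    - apply ex_RInt_scal_R; auto.
    - intros x Hx. apply Rle_trans with (Cmod w * Cmod (f x)).
      + rewrite <- (Cmod_conj w), <- Cmod_mult. eapply Rle_trans. 2: apply Cmod_fst.
        eapply Rle_trans. 2: apply Rle_abs. simpl. lra.
      + apply Rmult_le_compat_l. apply Cmod_ge_0. apply Hle; lra. }
  assert (Hw := Cmod_ge_0 w).
  destruct (Req_dec (Cmod w) 0) as [Z|Z].
  - rewrite Z. rewrite <- (Rmult_0_l (b - a)).
    replace (0 * (b - a)) with (RInt (fun _ => 0) a b).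
    apply RInt_le; auto. apply ex_RInt_const. intros x Hx. eapply Rle_trans. apply Cmod_ge_0. apply Hle; lra.
    rewrite RInt_const. unfold scal; simpl; unfold mult; simpl. ring.
  - apply Rmult_le_reg_l with (Cmod w); lra.
Qed.
Lemma CInt_norm_const (f : R -> C) K a b : a <= b -> (forall x : R, ccont f x) ->
  (forall x, a <= x <= b -> Cmod (f x) <= K) -> Cmod (CInt f a b) <= K * (b - a).
Proof.
  intros. replace (K * (b - a)) with (RInt (fun _ => K) a b).
  apply CInt_norm; auto. apply ex_RInt_const.
  rewrite RInt_const. unfold scal; simpl; unfold mult; simpl. ring.
Qed.

Lemma CInt_FTC (f df : R -> C) a b : a <= b -> (forall x, a <= x <= b -> cder f x (df x)) -> (forall x : R, ccont df x) ->
  CInt df a b = (f b - f a)%C.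
Proof.
  intros Hab Hd Hc. unfold CInt.
  apply C_eq; simpl; apply is_RInt_unique.
  - apply (is_RInt_derive (fun x => fst (f x)) (fun x => fst (df x)) a b);
    rewrite Rmin_left, Rmax_right by auto; intros z Hz; [exact (proj1 (Hd z Hz)) | exact (proj1 (Hc z))].
  - apply (is_RInt_derive (fun x => snd (f x)) (fun x => snd (df x)) a b);
    rewrite Rmin_left, Rmax_right by auto; intros z Hz; [exact (proj2 (Hd z Hz)) | exact (proj2 (Hc z))].
Qed.

Definition is_CInt_inf (f : R -> C) (l : C) :=
  forall eps, 0 < eps -> exists A, forall x, A <= x -> Cmod (CInt f 0 x - l)%C < eps.
(** A total function, arbitrary on divergent integrals; it acquires meaning through
    [is_CInt_inf_ex], whose hypothesis is an exponential bound. *)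
Definition CInt_inf (f : R -> C) : C := epsilon (inhabits (RtoC 0)) (is_CInt_inf f).

Lemma Cmod_small_0 (a : C) : (forall eps, 0 < eps -> Cmod a <= eps) -> a = 0.
Proof.
  intros H. apply Cmod_eq_0. apply Rle_antisym. 2: apply Cmod_ge_0.
  apply le_epsilon. intros. rewrite Rplus_0_l; auto.
Qed.
Lemma C_eq_eps (a b : C) : (forall eps, 0 < eps -> Cmod (a - b)%C <= eps) -> a = b.
Proof. intros H. apply Ceq_minus, Cmod_small_0; auto. Qed.

Lemma is_CInt_inf_unique (f : R -> C) l l' : is_CInt_inf f l -> is_CInt_inf f l' -> l = l'.
Proof.
  intros H H'. apply C_eq_eps. intros eps He.
  destruct (H (eps/2)) as [A HA]. lra. destruct (H' (eps/2)) as [B HB]. lra.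
  specialize (HA (Rmax A B) (Rmax_l _ _)). specialize (HB (Rmax A B) (Rmax_r _ _)).
  replace (l - l')%C with ((CInt f 0 (Rmax A B) - l') - (CInt f 0 (Rmax A B) - l))%C by ring.
  eapply Rle_trans. apply Cmod_minus_le. lra.
Qed.
Lemma is_CInt_inf_plus (f g : R -> C) l m : (forall x : R, ccont f x) -> (forall x : R, ccont g x) ->
  is_CInt_inf f l -> is_CInt_inf g m -> is_CInt_inf (fun x => f x + g x)%C (l + m)%C.
Proof.
  intros Hf Hg H H' eps He.
  destruct (H (eps/2)) as [A HA]. lra. destruct (H' (eps/2)) as [B HB]. lra.
  exists (Rmax A B). intros x Hx. rewrite CInt_plus by auto.
  assert (X := Rmax_l A B). assert (Y := Rmax_r A B).
  specialize (HA x ltac:(lra)). specialize (HB x ltac:(lra)).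
  replace (CInt f 0 x + CInt g 0 x - (l + m))%C with ((CInt f 0 x - l) + (CInt g 0 x - m))%C by ring.
  eapply Rle_lt_trans. apply Cmod_triangle. lra.
Qed.
Lemma is_CInt_inf_scal c (f : R -> C) l : (forall x : R, ccont f x) -> is_CInt_inf f l -> is_CInt_inf (fun x => c * f x)%C (c * l)%C.
Proof.
  intros Hf H eps He. assert (Hc := Cmod_ge_0 c).
  destruct (H (eps / (Cmod c + 1))) as [A HA]. apply Rdiv_lt_0_compat; lra.
  exists A. intros x Hx. rewrite CInt_scal by auto.
  replace (c * CInt f 0 x - c * l)%C with (c * (CInt f 0 x - l))%C by ring.
  rewrite Cmod_mult. specialize (HA x Hx). assert (X := Cmod_ge_0 (CInt f 0 x - l)%C).
  apply Rlt_div_r in HA; [|lra]. nra.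
Qed.
Lemma is_CInt_inf_ext (f g : R -> C) l : (forall x, 0 <= x -> f x = g x) -> is_CInt_inf f l -> is_CInt_inf g l.
Proof.
  intros H Hf eps He. destruct (Hf eps He) as [A HA]. exists (Rmax A 0). intros x Hx.
  assert (X := Rmax_l A 0). assert (Y := Rmax_r A 0).
  rewrite <- (CInt_ext f g). apply HA; lra. intros y. rewrite Rmin_left by lra. intros. apply H; lra.
Qed.

Lemma exp_decay_small a eps K : 0 < a -> 0 < eps -> exists A, 0 <= A /\ forall x, A <= x -> K * exp (- a * x) < eps.
Proof.
  intros Ha He.
  exists (Rmax 0 ((Rabs K + 1) / eps / a)). split. apply Rmax_l. intros x Hx.
  assert (X := Rmax_r 0 ((Rabs K + 1) / eps / a)). assert (X0 := Rmax_l 0 ((Rabs K + 1) / eps / a)).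
  assert ((Rabs K + 1) / eps / a <= x) by lra.
  apply (proj1 (Rle_div_l _ _ _ Ha)) in H. apply (proj1 (Rle_div_l _ _ _ He)) in H.
  assert (H1 := exp_ineq1_le (a * x)).
  replace (- a * x) with (- (a * x)) by ring. rewrite exp_Ropp.
  assert (P := exp_pos (a * x)). assert (Q := Rle_abs K).
  apply Rlt_div_l; auto.
  assert (Z : eps * (1 + a * x) <= eps * exp (a * x)) by (apply Rmult_le_compat_l; lra).
  assert (Z2 : x * a * eps = eps * (a * x)) by ring. lra.
Qed.

Lemma RInt_exp K a x y : a <> 0 -> RInt (fun r => K * exp (- a * r)) x y = K / a * (exp (- a * x) - exp (- a * y)).
Proof.
  intros Ha. apply is_RInt_unique.
  replace (K / a * (exp (- a * x) - exp (- a * y))) with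
    (minus (- K / a * exp (- a * y)) (- K / a * exp (- a * x))).
  2: { unfold minus, plus, opp; simpl. field; auto. }
  apply (is_RInt_derive (fun r => - K / a * exp (- a * r)) (fun r => K * exp (- a * r)) x y).
  - intros; auto_derive; auto. field; auto.
  - intros. apply (ex_derive_continuous (fun r => K * exp (- a * r))). auto_derive; auto.
Qed.
Lemma ex_RInt_exp K a x y : ex_RInt (fun r => K * exp (- a * r)) x y.
Proof.
  apply (ex_RInt_continuous (V := R_CompleteNormedModule)). intros.
  apply (ex_derive_continuous (fun r => K * exp (- a * r))). auto_derive; auto.
Qed.

Definition expbd (f : R -> C) (K a : R) := forall r, 0 <= r -> Cmod (f r) <= K * exp (- a * r).

Lemma CInt_tail (f : R -> C) K a x y : 0 < a -> 0 <= x <= y -> (forall x : R, ccont f x) -> expbd f K a ->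
  Cmod (CInt f x y) <= K / a * exp (- a * x).
Proof.
  intros Ha Hx Hc Hb.
  assert (HK : 0 <= K).
  { specialize (Hb 0 ltac:(lra)). rewrite Rmult_0_r, exp_0 in Hb. assert (X := Cmod_ge_0 (f 0)). lra. }
  eapply Rle_trans. apply CInt_norm with (g := fun r => K * exp (- a * r)); auto. lra. apply ex_RInt_exp.
  intros; apply Hb; lra.
  rewrite RInt_exp by lra. assert (X := exp_pos (- a * y)).
  assert (0 <= K / a) by (apply Rle_div_r; lra). nra.
Qed.

(** Completeness of the reals is used coordinatewise for the sequence of integer upper limits; the
    tail bound then carries the limit over to real ones. *)
Lemma is_CInt_inf_ex (f : R -> C) K a : 0 < a -> (forall x : R, ccont f x) -> expbd f K a -> is_CInt_inf f (CInt_inf f).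
Proof.
  intros Ha Hc Hb. unfold CInt_inf. apply epsilon_spec.
  set (u := fun n => fst (CInt f 0 (INR n))). set (v := fun n => snd (CInt f 0 (INR n))).
  assert (Cau : forall eps, 0 < eps -> exists N, forall n m, (N <= n)%nat -> (N <= m)%nat ->
     Cmod (CInt f 0 (INR m) - CInt f 0 (INR n))%C < eps).
  { intros eps He. destruct (exp_decay_small a (eps) (K / a) Ha He) as [A [HA0 HA]].
    destruct (nfloor_ex A HA0) as [N HN]. exists (S N).
    assert (W : forall n m, (S N <= n)%nat -> (n <= m)%nat -> Cmod (CInt f 0 (INR m) - CInt f 0 (INR n))%C < eps).
    { intros n m Hn Hm. rewrite <- (CInt_Chasles f 0 (INR n) (INR m)) by auto.
      replace (CInt f 0 (INR n) + CInt f (INR n) (INR m) - CInt f 0 (INR n))%C with (CInt f (INR n) (INR m)) by ring.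
      eapply Rle_lt_trans. apply CInt_tail with (a := a) (K := K); auto. split. apply pos_INR. apply le_INR; auto.
      apply HA. apply le_INR in Hn. rewrite S_INR in Hn. lra. }
    intros n m Hn Hm. destruct (Nat.le_ge_cases n m). apply W; auto.
    rewrite Cmod_minus_sym. apply W; auto. }
  assert (Cu : Cauchy_crit u).
  { intros eps He. destruct (Cau eps He) as [N HN]. exists N. intros n m Hn Hm. unfold R_dist.
    eapply Rle_lt_trans. 2: apply (HN m n); auto. eapply Rle_trans. 2: apply Cmod_fst. right. f_equal. }
  assert (Cv : Cauchy_crit v).
  { intros eps He. destruct (Cau eps He) as [N HN]. exists N. intros n m Hn Hm. unfold R_dist.
    eapply Rle_lt_trans. 2: apply (HN m n); auto. eapply Rle_trans. 2: apply Cmod_snd. right. f_equal. }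
  destruct (Rcomplete.R_complete u Cu) as [l1 H1]. destruct (Rcomplete.R_complete v Cv) as [l2 H2].
  exists (l1, l2). intros eps He.
  destruct (exp_decay_small a (eps/2) (K / a) Ha ltac:(lra)) as [A [HA0 HA]].
  exists (A). intros x Hx.
  destruct (H1 (eps/4)) as [N1 HN1]. lra. destruct (H2 (eps/4)) as [N2 HN2]. lra.
  destruct (nfloor_ex x ltac:(lra)) as [M HM].
  set (n := (N1 + N2 + S M)%nat). specialize (HN1 n ltac:(lia)). specialize (HN2 n ltac:(lia)).
  assert (Hxn : x <= INR n). { apply Rle_trans with (INR (S M)). rewrite S_INR; lra. apply le_INR; lia. }
  replace (CInt f 0 x - (l1, l2))%C with ((CInt f 0 (INR n) - (l1, l2)) - CInt f x (INR n))%C.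
  2: { rewrite <- (CInt_Chasles f 0 x (INR n)) by auto. ring. }
  eapply Rle_lt_trans. apply Cmod_minus_le.
  assert (T := CInt_tail f K a x (INR n) Ha ltac:(lra) Hc Hb). specialize (HA x Hx).
  assert (S := Cmod_le_sum (CInt f 0 (INR n) - (l1, l2))%C).
  unfold R_dist, u, v in *.
  change (fst (CInt f 0 (INR n) - (l1, l2))%C) with (fst (CInt f 0 (INR n)) - l1) in S.
  change (snd (CInt f 0 (INR n) - (l1, l2))%C) with (snd (CInt f 0 (INR n)) - l2) in S. lra.
Qed.

Lemma is_CInt_inf_bound (f : R -> C) l K a : 0 < a -> (forall x : R, ccont f x) -> expbd f K a -> is_CInt_inf f l -> Cmod l <= K / a.
Proof.
  intros Ha Hc Hb Hl. apply le_epsilon. intros eps He. destruct (Hl eps He) as [A HA].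
  set (x := Rmax A 0). assert (X := Rmax_l A 0). assert (Y := Rmax_r A 0).
  specialize (HA x ltac:(unfold x; lra)).
  assert (T := CInt_tail f K a 0 x Ha ltac:(unfold x; lra) Hc Hb). rewrite Rmult_0_r, exp_0 in T.
  rewrite Cmod_minus_sym in HA. assert (Z := Cmod_tri_sub l (CInt f 0 x)). lra.
Qed.
Lemma CInt_inf_bound (f : R -> C) K a : 0 < a -> (forall x : R, ccont f x) -> expbd f K a -> Cmod (CInt_inf f) <= K / a.
Proof. intros. eapply is_CInt_inf_bound; eauto. eapply is_CInt_inf_ex; eauto. Qed.

Lemma is_CInt_inf_FTC (F f : R -> C) K a : 0 < a -> (forall x, 0 <= x -> cder F x (f x)) -> (forall x : R, ccont f x) ->
  expbd F K a -> is_CInt_inf f (- F 0)%C.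
Proof.
  intros Ha Hd Hc Hb eps He. destruct (exp_decay_small a eps K Ha He) as [A [HA0 HA]].
  exists A. intros x Hx. rewrite (CInt_FTC F f); auto; [|lra | intros; apply Hd; lra].
  replace (F x - F 0 - - F 0)%C with (F x) by ring.
  eapply Rle_lt_trans. apply Hb. lra. apply HA; auto.
Qed.

Lemma ccont_bounded (f : R -> C) a b : a <= b -> (forall x : R, ccont f x) ->
  exists B, 0 <= B /\ forall x, a <= x <= b -> Cmod (f x) <= B.
Proof.
  intros Hab Hf.
  destruct (continuity_ab_maj (fun x => Cmod (f x)) a b Hab) as [M [HM _]].
  { intros c _. apply continuity_pt_filterlim. apply (cont_Cmod f c). apply Hf. }
  exists (Cmod (f M)). split. apply Cmod_ge_0. exact HM.
Qed.

(** * Complex differentiability *)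

Definition padd (p h : pt) : pt := mkpt (pS p + pS h)%C (pZ p + pZ h)%C (pC p + pC h)%C.
Definition pt0 : pt := mkpt 0 0 0.
Definition nrm (h : pt) : R := dist3 h pt0.

Lemma nrm_eq h : nrm h = Rmax (Cmod (pS h)) (Rmax (Cmod (pZ h)) (Cmod (pC h))).
Proof.
  unfold nrm, dist3, pt0, mkpt; simpl.
  f_equal; [|f_equal]; f_equal; unfold pS, pZ, pC; simpl; ring.
Qed.
Lemma nrm_S h : Cmod (pS h) <= nrm h.
Proof. rewrite nrm_eq. apply Rmax_l. Qed.
Lemma nrm_Z h : Cmod (pZ h) <= nrm h.
Proof. rewrite nrm_eq. eapply Rle_trans. 2: apply Rmax_r. apply Rmax_l. Qed.
Lemma nrm_C h : Cmod (pC h) <= nrm h.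
Proof. rewrite nrm_eq. eapply Rle_trans. 2: apply Rmax_r. apply Rmax_r. Qed.
Lemma nrm_lub h M : Cmod (pS h) <= M -> Cmod (pZ h) <= M -> Cmod (pC h) <= M -> nrm h <= M.
Proof. intros. rewrite nrm_eq. repeat apply Rmax_lub; auto. Qed.
Lemma nrm_ge0 h : 0 <= nrm h.
Proof. eapply Rle_trans. apply (Cmod_ge_0 (pS h)). apply nrm_S. Qed.

Definition lin (D : pt -> C) := exists a1 a2 a3 : C, forall h, D h = (a1 * pS h + (a2 * pZ h + a3 * pC h))%C.

Lemma lin_bound D : lin D -> exists B, 0 <= B /\ forall h, Cmod (D h) <= B * nrm h.
Proof.
  intros (a1 & a2 & a3 & H). exists (Cmod a1 + (Cmod a2 + Cmod a3)).
  assert (A1 := Cmod_ge_0 a1). assert (A2 := Cmod_ge_0 a2). assert (A3 := Cmod_ge_0 a3).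
  split. lra. intros h. rewrite H.
  eapply Rle_trans. apply Cmod_triangle.
  assert (X := Cmod_triangle (a2 * pZ h) (a3 * pC h)). rewrite !Cmod_mult in *.
  assert (Y1 := nrm_S h). assert (Y2 := nrm_Z h). assert (Y3 := nrm_C h). nra.
Qed.
Lemma lin_sub D h k : lin D -> D (padd h k) = (D h + D k)%C.
Proof. intros (a1 & a2 & a3 & H). rewrite !H. unfold padd, mkpt, pS, pZ, pC; simpl. ring. Qed.
Lemma lin_0 : lin (fun _ => RtoC 0).
Proof. exists 0, 0, 0. intros; ring. Qed.
Lemma lin_S : lin pS.
Proof. exists 1, 0, 0. intros; ring. Qed.
Lemma lin_Z : lin pZ.
Proof. exists 0, 1, 0. intros; ring. Qed.
Lemma lin_C : lin pC.
Proof. exists 0, 0, 1. intros; ring. Qed.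
Lemma lin_plus D E : lin D -> lin E -> lin (fun h => D h + E h)%C.
Proof.
  intros (a1 & a2 & a3 & H) (b1 & b2 & b3 & H'). exists (a1 + b1)%C, (a2 + b2)%C, (a3 + b3)%C.
  intros; rewrite H, H'; ring.
Qed.
Lemma lin_scal a D : lin D -> lin (fun h => a * D h)%C.
Proof.
  intros (a1 & a2 & a3 & H). exists (a * a1)%C, (a * a2)%C, (a * a3)%C. intros; rewrite H; ring.
Qed.
Lemma lin_comp D E1 E2 E3 : lin D -> lin E1 -> lin E2 -> lin E3 -> lin (fun h => D (mkpt (E1 h) (E2 h) (E3 h))).
Proof.
  intros (a1 & a2 & a3 & H) L1 L2 L3.
  assert (L : lin (fun h => a1 * E1 h + (a2 * E2 h + a3 * E3 h))%C).
  { apply lin_plus; [|apply lin_plus]; apply lin_scal; auto. }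
  destruct L as (b1 & b2 & b3 & L). exists b1, b2, b3. intros h. rewrite <- L, H. reflexivity.
Qed.

(* Uniformity in the index [t] is what allows differentiation under an integral over [t]. *)
Definition ufdiff (A : R -> Prop) (f : R -> pt -> C) (p : pt) (D : R -> pt -> C) :=
  (exists B, 0 <= B /\ forall t, A t -> Cmod (f t p) <= B /\ forall h, Cmod (D t h) <= B * nrm h) /\
  (forall t, A t -> lin (D t)) /\
  (forall eps, 0 < eps -> exists delta, 0 < delta /\ forall t, A t -> forall h, nrm h < delta ->
     Cmod (f t (padd p h) - f t p - D t h)%C <= eps * nrm h).
(** The constant family, so that each rule of calculus is proved once, in its uniform version. *)
Definition fdiff (f : pt -> C) (p : pt) (D : pt -> C) := ufdiff (fun _ => True) (fun _ => f) p (fun _ => D).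

Lemma fdiff_intro f p D : lin D -> (forall eps, 0 < eps -> exists delta, 0 < delta /\ forall h, nrm h < delta ->
     Cmod (f (padd p h) - f p - D h)%C <= eps * nrm h) -> fdiff f p D.
Proof.
  intros HL H. split; [|split; auto].
  - destruct (lin_bound D HL) as [B [HB0 HB]]. exists (Rmax B (Cmod (f p))).
    assert (X := Rmax_l B (Cmod (f p))). assert (Y := Rmax_r B (Cmod (f p))).
    split. lra. intros _ _. split. auto. intros h. specialize (HB h). assert (Z := nrm_ge0 h). nra.
  - intros eps He. destruct (H eps He) as [d [Hd0 Hd1]]. exists d; split; auto.
Qed.
Lemma fdiff_lin f p D : fdiff f p D -> lin D.
Proof. intros (_ & H & _). apply (H 0); auto. Qed.
Lemma fdiff_eps f p D : fdiff f p D -> forall eps, 0 < eps -> exists delta, 0 < delta /\ forall h, nrm h < delta ->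
     Cmod (f (padd p h) - f p - D h)%C <= eps * nrm h.
Proof.
  intros (_ & _ & H) eps He. destruct (H eps He) as [d [H0 H1]]. exists d. split. auto.
  intros; apply (H1 0); auto.
Qed.

Lemma fdiff_holo f p D : fdiff f p D -> holo_at f p.
Proof.
  intros H. destruct (fdiff_lin _ _ _ H) as (a1 & a2 & a3 & E). exists a1, a2, a3.
  intros eps He. destruct (fdiff_eps _ _ _ H eps He) as [d [H0 H1]]. exists d; split; auto.
  intros h Hh. rewrite <- E. apply H1. exact Hh.
Qed.

Lemma ufdiff_lip A f p D : ufdiff A f p D -> exists B d, 0 <= B /\ 0 < d /\ forall t, A t -> forall h, nrm h < d ->
  Cmod (f t (padd p h) - f t p)%C <= B * nrm h.
Proof.
  intros ((B & HB0 & HB) & _ & H). destruct (H 1 Rlt_0_1) as [d [Hd0 Hd1]].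
  exists (B + 1), d. split; [lra|split; auto]. intros t Ht h Hh.
  specialize (Hd1 t Ht h Hh). destruct (HB t Ht) as [_ HB1]. specialize (HB1 h).
  assert (X := Cmod_tri_sub (f t (padd p h) - f t p)%C (D t h)). lra.
Qed.
Lemma fdiff_lip f p D : fdiff f p D -> exists B d, 0 <= B /\ 0 < d /\ forall h, nrm h < d ->
  Cmod (f (padd p h) - f p)%C <= B * nrm h.
Proof. intros H. destruct (ufdiff_lip _ _ _ _ H) as (B & d & H1 & H2 & H3). exists B, d; split; [auto|split;[auto|]]; intros h Hh; exact (H3 0 I h Hh). Qed.

Section HduOps.
Variable A : R -> Prop.
Variable p : pt.

Lemma ufdiff_const (a : R -> C) : (exists B, forall t, A t -> Cmod (a t) <= B) -> ufdiff A (fun t _ => a t) p (fun _ _ => 0).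
Proof.
  intros [B HB]. split; [|split].
  - exists (Rmax B 0). assert (X := Rmax_l B 0). assert (Y := Rmax_r B 0). split; auto. intros t Ht.
    specialize (HB t Ht). split. lra. intros h. rewrite Cmod_0. assert (Z := nrm_ge0 h). nra.
  - intros; apply lin_0.
  - intros eps He. exists 1. split. lra. intros. replace (a t - a t - 0)%C with (RtoC 0) by ring.
    rewrite Cmod_0. assert (Z := nrm_ge0 h). nra.
Qed.
Lemma ufdiff_proj (P : pt -> C) : lin P -> (forall h, P (padd p h) = (P p + P h)%C) -> ufdiff A (fun _ => P) p (fun _ => P).
Proof.
  intros HL HP. split; [|split]; auto.
  - destruct (lin_bound P HL) as [B [HB0 HB]]. exists (Rmax B (Cmod (P p))).
    assert (X := Rmax_l B (Cmod (P p))). assert (Y := Rmax_r B (Cmod (P p))).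
    split. lra. intros _ _. split. auto. intros h. specialize (HB h). assert (Z := nrm_ge0 h). nra.
  - intros eps He. exists 1. split. lra. intros. rewrite HP. replace (P p + P h - P p - P h)%C with (RtoC 0) by ring.
    rewrite Cmod_0. assert (Z := nrm_ge0 h). nra.
Qed.
Lemma ufdiff_S : ufdiff A (fun _ => pS) p (fun _ => pS).
Proof. apply ufdiff_proj. apply lin_S. reflexivity. Qed.
Lemma ufdiff_Z : ufdiff A (fun _ => pZ) p (fun _ => pZ).
Proof. apply ufdiff_proj. apply lin_Z. reflexivity. Qed.
Lemma ufdiff_C : ufdiff A (fun _ => pC) p (fun _ => pC).
Proof. apply ufdiff_proj. apply lin_C. reflexivity. Qed.

Lemma ufdiff_plus f g D E : ufdiff A f p D -> ufdiff A g p E -> ufdiff A (fun t q => f t q + g t q)%C p (fun t h => D t h + E t h)%C.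
Proof.
  intros ((B & HB0 & HB) & HL & H) ((B' & HB0' & HB') & HL' & H'). split; [|split].
  - exists (B + B'). split. lra. intros t Ht. destruct (HB t Ht) as [X Y]. destruct (HB' t Ht) as [X' Y']. split.
    eapply Rle_trans. apply Cmod_triangle. lra.
    intros h. eapply Rle_trans. apply Cmod_triangle. specialize (Y h). specialize (Y' h). lra.
  - intros. apply lin_plus; auto.
  - intros eps He. destruct (H (eps/2)) as [d [Hd0 Hd1]]. lra. destruct (H' (eps/2)) as [d' [Hd0' Hd1']]. lra.
    exists (Rmin d d'). split. apply Rmin_pos; auto. intros t Ht h Hh.
    assert (X := Rmin_l d d'). assert (Y := Rmin_r d d').
    specialize (Hd1 t Ht h ltac:(lra)). specialize (Hd1' t Ht h ltac:(lra)).
    replace (f t (padd p h) + g t (padd p h) - (f t p + g t p) - (D t h + E t h))%C with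
      ((f t (padd p h) - f t p - D t h) + (g t (padd p h) - g t p - E t h))%C by ring.
    eapply Rle_trans. apply Cmod_triangle. lra.
Qed.

Lemma ufdiff_mult f g D E : ufdiff A f p D -> ufdiff A g p E ->
  ufdiff A (fun t q => f t q * g t q)%C p (fun t h => g t p * D t h + f t p * E t h)%C.
Proof.
  intros Hf Hg. destruct (ufdiff_lip _ _ _ _ Hg) as (Bl & dl & HBl & Hdl & Hl).
  destruct Hf as ((B & HB0 & HB) & HL & H). destruct Hg as ((B' & HB0' & HB') & HL' & H'). split; [|split].
  - exists (B * B' + B' * B + B * B'). split. nra. intros t Ht. destruct (HB t Ht) as [X Y]. destruct (HB' t Ht) as [X' Y'].
    assert (Z1 := Cmod_ge_0 (f t p)). assert (Z2 := Cmod_ge_0 (g t p)). split.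
    rewrite Cmod_mult. nra.
    intros h. eapply Rle_trans. apply Cmod_triangle. rewrite !Cmod_mult. specialize (Y h). specialize (Y' h).
    assert (Z3 := nrm_ge0 h). assert (Z4 := Cmod_ge_0 (D t h)). assert (Z5 := Cmod_ge_0 (E t h)).
    assert (Cmod (g t p) * Cmod (D t h) <= B' * (B * nrm h)) by (apply Rmult_le_compat; auto).
    assert (Cmod (f t p) * Cmod (E t h) <= B * (B' * nrm h)) by (apply Rmult_le_compat; auto).
    assert (0 <= B * B' * nrm h) by (repeat apply Rmult_le_pos; auto). lra.
  - intros. apply lin_plus; apply lin_scal; auto.
  - intros eps He.
    set (e1 := eps / 4 / (B' + 1)). assert (He1 : 0 < e1) by (unfold e1; apply Rdiv_lt_0_compat; lra).
    set (e2 := eps / 4 / (B + 1)). assert (He2 : 0 < e2) by (unfold e2; apply Rdiv_lt_0_compat; lra).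
    destruct (H (Rmin 1 e1)) as [d [Hd0 Hd1]]. apply Rmin_pos; lra. destruct (H' e2) as [d' [Hd0' Hd1']]. lra.
    (* The product of the two increments is quadratic in [nrm h]; below [d3] it uses up a quarter of
       [eps]. The two linear errors take a quarter each through [e1] and [e2]. *)
    set (d3 := eps / 4 / ((B + 1) * (Bl + 1))). assert (Hd3 : 0 < d3). { unfold d3; apply Rdiv_lt_0_compat. lra. nra. }
    set (dd := Rmin (Rmin d d') (Rmin dl d3)).
    assert (M : 0 < dd /\ dd <= d /\ dd <= d' /\ dd <= dl /\ dd <= d3).
    { unfold dd. split. repeat apply Rmin_pos; auto.
      assert (X1 := Rmin_l (Rmin d d') (Rmin dl d3)). assert (X2 := Rmin_r (Rmin d d') (Rmin dl d3)).
      assert (X3 := Rmin_l d d'). assert (X4 := Rmin_r d d'). assert (X5 := Rmin_l dl d3). assert (X6 := Rmin_r dl d3). lra. }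
    exists dd. split. tauto. intros t Ht h Hh.
    specialize (Hd1 t Ht h ltac:(lra)). specialize (Hd1' t Ht h ltac:(lra)). specialize (Hl t Ht h ltac:(lra)).
    destruct (HB t Ht) as [X Y]. destruct (HB' t Ht) as [X' Y']. specialize (Y h). specialize (Y' h).
    assert (Z3 := nrm_ge0 h).
    assert (M1 := Rmin_l 1 e1). assert (M2 := Rmin_r 1 e1).
    assert (Hfl : Cmod (f t (padd p h) - f t p)%C <= (B + 1) * nrm h).
    { assert (Q := Cmod_tri_sub (f t (padd p h) - f t p)%C (D t h)). nra. }
    replace (f t (padd p h) * g t (padd p h) - f t p * g t p - (g t p * D t h + f t p * E t h))%C with
      (g t p * (f t (padd p h) - f t p - D t h) + f t p * (g t (padd p h) - g t p - E t h) +
       (f t (padd p h) - f t p) * (g t (padd p h) - g t p))%C by ring.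
    eapply Rle_trans. apply Cmod_triangle. eapply Rle_trans. apply Rplus_le_compat_r. apply Cmod_triangle.
    rewrite !Cmod_mult.
    assert (T1 : Cmod (g t p) * Cmod (f t (padd p h) - f t p - D t h)%C <= B' * (e1 * nrm h)).
    { apply Rmult_le_compat; auto using Cmod_ge_0. nra. }
    assert (T2 : Cmod (f t p) * Cmod (g t (padd p h) - g t p - E t h)%C <= B * (e2 * nrm h)).
    { apply Rmult_le_compat; auto using Cmod_ge_0. }
    assert (T3 : Cmod (f t (padd p h) - f t p)%C * Cmod (g t (padd p h) - g t p)%C <= ((B + 1) * nrm h) * (Bl * nrm h)).
    { apply Rmult_le_compat; auto using Cmod_ge_0. }
    assert (U1 : B' * e1 <= eps / 4). { unfold e1. replace (B' * (eps / 4 / (B' + 1))) with (eps / 4 * (B' / (B' + 1))) by (field; lra).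
      rewrite <- (Rmult_1_r (eps / 4)) at 2. apply Rmult_le_compat_l. lra. apply Rle_div_l; lra. }
    assert (U2 : B * e2 <= eps / 4). { unfold e2. replace (B * (eps / 4 / (B + 1))) with (eps / 4 * (B / (B + 1))) by (field; lra).
      rewrite <- (Rmult_1_r (eps / 4)) at 2. apply Rmult_le_compat_l. lra. apply Rle_div_l; lra. }
    assert (U3 : (B + 1) * (Bl + 1) * d3 = eps / 4). { unfold d3. field. lra. }
    assert (U4 : (B + 1) * nrm h * (Bl * nrm h) <= eps / 4 * nrm h).
    { rewrite <- U3. replace ((B + 1) * nrm h * (Bl * nrm h)) with ((B + 1) * Bl * nrm h * nrm h) by ring.
      apply Rmult_le_compat_r; auto. apply Rmult_le_compat; auto. apply Rmult_le_pos; lra. apply Rmult_le_compat_l; lra. lra. }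
    assert (B' * (e1 * nrm h) <= eps / 4 * nrm h). { rewrite <- Rmult_assoc. apply Rmult_le_compat_r; auto. }
    assert (B * (e2 * nrm h) <= eps / 4 * nrm h). { rewrite <- Rmult_assoc. apply Rmult_le_compat_r; auto. }
    assert (0 <= eps * nrm h) by nra. lra.
Qed.

Lemma ufdiff_exp f D : ufdiff A f p D -> ufdiff A (fun t q => cexp (f t q)) p (fun t h => cexp (f t p) * D t h)%C.
Proof.
  intros Hf. destruct (ufdiff_lip _ _ _ _ Hf) as (Bl & dl & HBl & Hdl & Hl).
  destruct Hf as ((B & HB0 & HB) & HL & H).
  assert (Hbd : forall t, A t -> Cmod (cexp (f t p)) <= exp B).
  { intros t Ht. rewrite Cmod_cexp. destruct (HB t Ht) as [X _]. assert (Y := Cmod_fst (f t p)). assert (Z := Rle_abs (fst (f t p))).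
    apply exp_mono; lra. }
  assert (HeB := exp_pos B).
  split; [|split].
  - exists (exp B + exp B * B). split. nra. intros t Ht. specialize (Hbd t Ht). destruct (HB t Ht) as [X Y]. split.
    nra. intros h. specialize (Y h). rewrite Cmod_mult. assert (Z := nrm_ge0 h).
    assert (Cmod (cexp (f t p)) * Cmod (D t h) <= exp B * (B * nrm h)).
    { apply Rmult_le_compat; auto using Cmod_ge_0. } nra.
  - intros. apply lin_scal; auto.
  - intros eps He.
    set (e1 := eps / 2 / exp B). assert (He1 : 0 < e1) by (unfold e1; apply Rdiv_lt_0_compat; lra).
    destruct (H e1 He1) as [d [Hd0 Hd1]].
    (* For [nrm h <= / (Bl + 1)] the increment [k] of [f] has modulus at most 1, which turns the
       bound of [cexp_2_bound] into a multiple of [nrm h ^ 2] with this constant. *)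
    set (K := exp B * ((Bl + 1) * (Bl + 1)) * exp 1). assert (HK : 0 < K).
    { unfold K. apply Rmult_lt_0_compat. apply Rmult_lt_0_compat; auto. nra. apply exp_pos. }
    set (dd := Rmin (Rmin d dl) (Rmin (/ (Bl + 1)) (eps / 2 / K))).
    assert (M : 0 < dd /\ dd <= d /\ dd <= dl /\ dd <= / (Bl + 1) /\ dd <= eps / 2 / K).
    { unfold dd. set (u := / (Bl + 1)). set (v := eps / 2 / K).
      assert (0 < u) by (apply Rinv_0_lt_compat; lra). assert (0 < v) by (apply Rdiv_lt_0_compat; lra).
      split. repeat apply Rmin_pos; auto.
      assert (X1 := Rmin_l (Rmin d dl) (Rmin u v)). assert (X2 := Rmin_r (Rmin d dl) (Rmin u v)).
      assert (X3 := Rmin_l d dl). assert (X4 := Rmin_r d dl). assert (X5 := Rmin_l u v). assert (X6 := Rmin_r u v). lra. }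
    exists dd. split. tauto. intros t Ht h Hh.
    specialize (Hd1 t Ht h ltac:(lra)). specialize (Hl t Ht h ltac:(lra)). specialize (Hbd t Ht).
    assert (Z := nrm_ge0 h).
    set (k := (f t (padd p h) - f t p)%C) in *.
    replace (cexp (f t (padd p h)) - cexp (f t p) - cexp (f t p) * D t h)%C with
       (cexp (f t p) * ((cexp k - 1 - k) + (k - D t h)))%C.
    2: { replace (f t (padd p h)) with (f t p + k)%C by (unfold k; ring). rewrite cexp_plus. ring. }
    rewrite Cmod_mult.
    assert (Q := cexp_2_bound k).
    assert (Hk1 : Cmod k <= 1).
    { assert (nrm h * (Bl + 1) <= 1). { apply Rle_div_r. lra. unfold Rdiv; rewrite Rmult_1_l; lra. } nra. }
    assert (Hk2 : exp (Cmod k) <= exp 1) by (apply exp_mono; auto).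
    assert (Hk0 := Cmod_ge_0 k).
    assert (Hk3 : Cmod k ^ 2 <= (Bl + 1) * (Bl + 1) * (nrm h * nrm h)).
    { replace ((Bl + 1) * (Bl + 1) * (nrm h * nrm h)) with (((Bl + 1) * nrm h) ^ 2) by ring. apply pow_incr. nra. }
    assert (Hk4 : Cmod (cexp k - 1 - k)%C <= (Bl + 1) * (Bl + 1) * (nrm h * nrm h) * exp 1).
    { eapply Rle_trans. apply Q. apply Rmult_le_compat; auto. apply pow2_ge_0. left; apply exp_pos. }
    eapply Rle_trans. apply Rmult_le_compat. apply Cmod_ge_0. apply Cmod_ge_0. apply Hbd. apply Cmod_triangle.
    rewrite Rmult_plus_distr_l.
    assert (exp B * Cmod (k - D t h)%C <= eps / 2 * nrm h).
    { replace (eps / 2) with (exp B * e1). 2: unfold e1; field; lra. rewrite Rmult_assoc. apply Rmult_le_compat_l; lra. }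
    assert (exp B * Cmod (cexp k - 1 - k)%C <= eps / 2 * nrm h).
    { eapply Rle_trans. apply Rmult_le_compat_l. lra. apply Hk4.
      replace (exp B * ((Bl + 1) * (Bl + 1) * (nrm h * nrm h) * exp 1)) with (K * nrm h * nrm h) by (unfold K; ring).
      apply Rmult_le_compat_r; auto. rewrite Rmult_comm. apply Rle_div_r; lra. }
    lra.
Qed.
Lemma ufdiff_ext f g D E : (forall t q, f t q = g t q) -> (forall t h, D t h = E t h) -> ufdiff A f p D -> ufdiff A g p E.
Proof.
  intros H1 H2. replace g with f by (extensionality t; extensionality q; auto).
  replace E with D by (extensionality t; extensionality q; auto). auto.
Qed.
End HduOps.

Lemma fdiff_const p a : fdiff (fun _ => a) p (fun _ => 0).
Proof. apply (ufdiff_const _ p (fun _ => a)). exists (Cmod a). intros; lra. Qed.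
Lemma fdiff_S p : fdiff pS p pS. Proof. apply ufdiff_S. Qed.
Lemma fdiff_Z p : fdiff pZ p pZ. Proof. apply ufdiff_Z. Qed.
Lemma fdiff_C p : fdiff pC p pC. Proof. apply ufdiff_C. Qed.
Lemma fdiff_plus p f g D E : fdiff f p D -> fdiff g p E -> fdiff (fun q => f q + g q)%C p (fun h => D h + E h)%C.
Proof. apply ufdiff_plus. Qed.
Lemma fdiff_mult p f g D E : fdiff f p D -> fdiff g p E -> fdiff (fun q => f q * g q)%C p (fun h => g p * D h + f p * E h)%C.
Proof. apply ufdiff_mult. Qed.
Lemma fdiff_exp p f D : fdiff f p D -> fdiff (fun q => cexp (f q)) p (fun h => cexp (f p) * D h)%C.
Proof. apply ufdiff_exp. Qed.
Lemma fdiff_ext p f g D E : (forall q, f q = g q) -> (forall h, D h = E h) -> fdiff f p D -> fdiff g p E.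
Proof. intros HF HD H. apply (ufdiff_ext _ p (fun _ => f) (fun _ => g) (fun _ => D) (fun _ => E)); auto. Qed.
Lemma fdiff_D p f D E : (forall h, D h = E h) -> fdiff f p D -> fdiff f p E.
Proof. intros. apply (fdiff_ext p f f D E); auto. Qed.
Lemma fdiff_scal p a f D : fdiff f p D -> fdiff (fun q => a * f q)%C p (fun h => a * D h)%C.
Proof. intros H. eapply fdiff_D. 2: apply fdiff_mult; [apply fdiff_const|apply H]. intros; cbv beta; ring. Qed.
Lemma fdiff_opp p f D : fdiff f p D -> fdiff (fun q => - f q)%C p (fun h => - D h)%C.
Proof. intros H. eapply fdiff_ext. 3: apply (fdiff_scal p (- (1))%C f D H). intros; cbv beta; ring. intros; cbv beta; ring. Qed.
Lemma fdiff_minus p f g D E : fdiff f p D -> fdiff g p E -> fdiff (fun q => f q - g q)%C p (fun h => D h - E h)%C.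
Proof. intros. apply fdiff_plus; auto. apply fdiff_opp; auto. Qed.

Lemma fdiff_local p f g D r : 0 < r -> (forall h, nrm h < r -> f (padd p h) = g (padd p h)) -> fdiff f p D -> fdiff g p D.
Proof.
  intros Hr H Hf. apply fdiff_intro. eapply fdiff_lin; eauto. intros eps He.
  destruct (fdiff_eps _ _ _ Hf eps He) as [d [H0 H1]]. exists (Rmin r d). split. apply Rmin_pos; auto.
  intros h Hh. assert (X := Rmin_l r d). assert (Y := Rmin_r r d).
  rewrite <- H by lra.
  assert (Hp : f p = g p).
  { specialize (H pt0). replace (padd p pt0) with p in H. apply H.
    replace (nrm pt0) with 0; auto. rewrite nrm_eq. unfold pt0, pS, pZ, pC; simpl. rewrite Cmod_0.
    rewrite (Rmax_left 0 0) by lra. rewrite (Rmax_left 0 0); lra.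
    destruct p as [[a b] c]. unfold padd, pt0, mkpt, pS, pZ, pC; simpl. f_equal; [f_equal|]; ring. }
  rewrite <- Hp. apply H1. lra.
Qed.

Lemma fdiff_comp p f g1 g2 g3 D E1 E2 E3 : fdiff f (mkpt (g1 p) (g2 p) (g3 p)) D ->
  fdiff g1 p E1 -> fdiff g2 p E2 -> fdiff g3 p E3 ->
  fdiff (fun q => f (mkpt (g1 q) (g2 q) (g3 q))) p (fun h => D (mkpt (E1 h) (E2 h) (E3 h))).
Proof.
  intros Hf H1 H2 H3.
  assert (LD := fdiff_lin _ _ _ Hf).
  apply fdiff_intro. { apply lin_comp; eauto using fdiff_lin. }
  intros eps He.
  destruct (lin_bound D LD) as [B [HB0 HB]].
  destruct (fdiff_lip _ _ _ H1) as (B1 & d1 & HB1 & Hd1 & L1).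
  destruct (fdiff_lip _ _ _ H2) as (B2 & d2 & HB2 & Hd2 & L2).
  destruct (fdiff_lip _ _ _ H3) as (B3 & d3 & HB3 & Hd3 & L3).
  set (BB := B1 + B2 + B3 + 1).
  set (e1 := eps / 2 / BB). assert (He1 : 0 < e1) by (unfold e1, BB; apply Rdiv_lt_0_compat; lra).
  set (e2 := eps / 2 / (B + 1)). assert (He2 : 0 < e2) by (unfold e2; apply Rdiv_lt_0_compat; lra).
  destruct (fdiff_eps _ _ _ Hf e1 He1) as [df [Hdf F]].
  destruct (fdiff_eps _ _ _ H1 e2 He2) as [r1 [Hr1 F1]].
  destruct (fdiff_eps _ _ _ H2 e2 He2) as [r2 [Hr2 F2]].
  destruct (fdiff_eps _ _ _ H3 e2 He2) as [r3 [Hr3 F3]].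
  assert (Hbb : 0 < df / BB) by (unfold BB; apply Rdiv_lt_0_compat; lra).
  assert (M : exists m, 0 < m /\ m <= d1 /\ m <= d2 /\ m <= d3 /\ m <= r1 /\ m <= r2 /\ m <= r3 /\ m <= df / BB).
  { exists (Rmin (Rmin d1 (Rmin d2 d3)) (Rmin (Rmin r1 (Rmin r2 r3)) (df / BB))).
    split. repeat apply Rmin_pos; auto.
    repeat split; unfold Rmin; repeat destruct Rle_dec; lra. }
  destruct M as (m & Hm & M1 & M2 & M3 & M4 & M5 & M6 & M7). exists m. split; auto.
  intros h Hh.
  specialize (L1 h ltac:(lra)). specialize (L2 h ltac:(lra)). specialize (L3 h ltac:(lra)).
  specialize (F1 h ltac:(lra)). specialize (F2 h ltac:(lra)). specialize (F3 h ltac:(lra)).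
  assert (Z := nrm_ge0 h).
  set (k := mkpt (g1 (padd p h) - g1 p)%C (g2 (padd p h) - g2 p)%C (g3 (padd p h) - g3 p)%C).
  assert (Nk : nrm k <= BB * nrm h).
  { assert (0 <= B1 * nrm h) by nra. assert (0 <= B2 * nrm h) by nra. assert (0 <= B3 * nrm h) by nra.
    apply nrm_lub; unfold k, mkpt, pS, pZ, pC; simpl; unfold BB; lra. }
  set (k' := mkpt (g1 (padd p h) - g1 p - E1 h)%C (g2 (padd p h) - g2 p - E2 h)%C (g3 (padd p h) - g3 p - E3 h)%C).
  assert (Nk' : nrm k' <= e2 * nrm h).
  { apply nrm_lub; unfold k', mkpt, pS, pZ, pC; simpl; lra. }
  assert (Fk : nrm k < df).
  { eapply Rle_lt_trans. apply Nk. rewrite Rmult_comm. apply Rlt_div_r. unfold BB; lra. lra. }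
  specialize (F k Fk).
  replace (padd (mkpt (g1 p) (g2 p) (g3 p)) k) with (mkpt (g1 (padd p h)) (g2 (padd p h)) (g3 (padd p h))) in F.
  2: { unfold k, padd at 4, mkpt, pS, pZ, pC; simpl. f_equal; [f_equal|]; ring. }
  set (kl := mkpt (E1 h) (E2 h) (E3 h)).
  assert (Dk : D k = (D kl + D k')%C).
  { rewrite <- lin_sub by auto. f_equal. unfold k, k', kl, padd at 4, mkpt, pS, pZ, pC; simpl. f_equal; [f_equal|]; ring. }
  rewrite Dk in F. specialize (HB k').
  assert (Q := Cmod_tri_sub (f (mkpt (g1 (padd p h)) (g2 (padd p h)) (g3 (padd p h))) - f (mkpt (g1 p) (g2 p) (g3 p)) - D kl)%C (D k')).
  match type of Q with _ <= Cmod ?a + _ => match type of F with Cmod ?b <= _ => replace a with b in Q by ring end end.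
  assert (e1 * nrm k <= eps / 2 * nrm h).
  { replace (eps / 2) with (e1 * BB) by (unfold e1, BB; field; lra). rewrite Rmult_assoc. apply Rmult_le_compat_l; lra. }
  assert (B * nrm k' <= eps / 2 * nrm h).
  { apply Rle_trans with ((B + 1) * (e2 * nrm h)). apply Rmult_le_compat; auto using nrm_ge0. lra.
    right. unfold e2. field. lra. }
  lra.
Qed.

Lemma fdiff_Clog p f D : 0 < fst (f p) -> fdiff f p D -> fdiff (fun q => Clog (f q)) p (fun h => / f p * D h)%C.
Proof.
  intros Hp Hf. assert (Hm := Cmod_pos_fst _ Hp).
  destruct (fdiff_lip _ _ _ Hf) as (B & d & HB & Hd0 & L).
  apply fdiff_intro. apply lin_scal. eapply fdiff_lin; eauto.
  intros eps He.
  set (m := Cmod (f p)) in *. set (a := fst (f p)) in *.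
  destruct (fdiff_eps _ _ _ Hf (eps / 2 * m)) as [d2 [Hd2 F]]. nra.
  set (K := 2 * (B / m) * (B / m) + 1).
  assert (HBm : 0 <= B / m) by (apply Rle_div_r; lra).
  assert (HK : 0 < K) by (unfold K; nra).
  assert (M : exists r, 0 < r /\ r <= d /\ r <= d2 /\ r <= a / 2 / (B + 1) /\ r <= eps / 2 / K).
  { exists (Rmin (Rmin d d2) (Rmin (a / 2 / (B + 1)) (eps / 2 / K))).
    assert (0 < a / 2 / (B + 1)) by (apply Rdiv_lt_0_compat; lra). assert (0 < eps / 2 / K) by (apply Rdiv_lt_0_compat; lra).
    split. repeat apply Rmin_pos; auto. repeat split; unfold Rmin; repeat destruct Rle_dec; lra. }
  destruct M as (r & Hr & M1 & M2 & M3 & M4). exists r. split; auto. intros h Hh.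
  specialize (L h ltac:(lra)). specialize (F h ltac:(lra)). assert (Z := nrm_ge0 h).
  set (w := f p) in *. set (w' := f (padd p h)) in *.
  assert (am : a <= m). { unfold a, m. assert (X := Cmod_fst w). assert (Y := Rle_abs (fst w)). lra. }
  assert (Hs : Cmod (w' - w)%C <= a / 2).
  { assert (nrm h * (B + 1) <= a / 2). { apply Rle_div_r; lra. } nra. }
  assert (Hw' : 0 < fst w').
  { assert (X := Cmod_fst (w' - w)%C). change (fst (w' - w)%C) with (fst w' - a) in X.
    assert (Y : Rabs (fst w' - a) <= a / 2) by lra. apply Rabs_le_between in Y. lra. }
  destruct (Clog_quad w w' Hp Hw') as [Q _]. fold m. lra. fold m in Q.
  assert (wn : w <> RtoC 0) by (apply Cmod_neq0; auto).
  replace (Clog w' - Clog w - / w * D h)%C with ((Clog w' - Clog w - (w' - w) / w) + (w' - w - D h) / w)%C by (field; auto).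
  eapply Rle_trans. apply Cmod_triangle.
  assert (T1 : Cmod ((w' - w - D h) / w)%C <= eps / 2 * nrm h).
  { rewrite Cmod_div by auto. fold m. apply Rle_div_l; auto. lra. }
  assert (T2 : 2 * (Cmod (w' - w)%C / m) ^ 2 <= eps / 2 * nrm h).
  { apply Rle_trans with (2 * (B / m * nrm h) ^ 2).
    - apply Rmult_le_compat_l. lra. apply pow_incr. split. apply Rle_div_r; auto. rewrite Rmult_0_l; apply Cmod_ge_0.
      unfold Rdiv. rewrite Rmult_assoc, (Rmult_comm (/ m)), <- Rmult_assoc. apply Rmult_le_compat_r. left; apply Rinv_0_lt_compat; auto. auto.
    - assert (nrm h * K <= eps / 2) by (apply Rle_div_r; lra).
      replace (2 * (B / m * nrm h) ^ 2) with ((K - 1) * nrm h * nrm h) by (unfold K; ring).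
      apply Rmult_le_compat_r; auto. nra. }
  lra.
Qed.

(** The first coordinate doubles as a time parameter. To differentiate along a curve, a function is
    composed with a map that reads the time from [pS], and the chain rule [fdiff_comp] does the
    rest. *)
Lemma fdiff_cder f (t : R) a b D : fdiff f (mkpt (RtoC t) a b) D ->
  cder (fun x => f (mkpt (RtoC x) a b)) t (D (mkpt 1 0 0)).
Proof.
  intros H. destruct (fdiff_lin _ _ _ H) as (a1 & a2 & a3 & E).
  assert (X : forall eps : posreal, exists delta : posreal, forall h, h <> 0 -> Rabs h < delta ->
     Cmod (f (mkpt (RtoC (t + h)) a b) - f (mkpt (RtoC t) a b) - RtoC h * D (mkpt 1 0 0))%C <= eps * Rabs h).
  { intros eps. destruct (fdiff_eps _ _ _ H eps (cond_pos eps)) as [d [Hd0 F]]. exists (mkposreal d Hd0). simpl.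
    intros h _ Hh.
    assert (N : nrm (mkpt (RtoC h) 0 0) = Rabs h).
    { rewrite nrm_eq. unfold mkpt, pS, pZ, pC; simpl. rewrite Cmod_0, Cmod_R. rewrite (Rmax_left 0 0) by lra.
      apply Rmax_left. apply Rabs_pos. }
    specialize (F (mkpt (RtoC h) 0 0)). rewrite N in F. specialize (F Hh).
    rewrite !E in *. unfold padd, mkpt, pS, pZ, pC in *; simpl in *.
    rewrite RtoC_plus. rewrite !Cplus_0_r in F.
    match type of F with Cmod ?u <= _ => match goal with |- Cmod ?v <= _ => replace v with u by ring end end. auto. }
  split; apply is_derive_Reals; intros eps He; destruct (X (mkposreal (eps/2) ltac:(lra))) as [d F]; exists d; intros h Hn Hh;
    specialize (F h Hn Hh); simpl in F.
  - assert (G := Cmod_fst (f (mkpt (RtoC (t + h)) a b) - f (mkpt (RtoC t) a b) - RtoC h * D (mkpt 1 0 0))%C).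
    simpl in G.
    match goal with |- Rabs ?u < _ => replace u with ((fst (f (mkpt (RtoC (t + h)) a b)) - fst (f (mkpt (RtoC t) a b)) - h * fst (D (mkpt 1 0 0))) / h) by (field; auto) end.
    unfold Rdiv. rewrite Rabs_mult, Rabs_inv. assert (Hp := Rabs_pos_lt h Hn).
    apply Rlt_div_l; auto.
    match type of G with Rabs ?u <= _ => match goal with |- Rabs ?v < _ => replace v with u by ring end end. nra.
  - assert (G := Cmod_snd (f (mkpt (RtoC (t + h)) a b) - f (mkpt (RtoC t) a b) - RtoC h * D (mkpt 1 0 0))%C).
    simpl in G.
    match goal with |- Rabs ?u < _ => replace u with ((snd (f (mkpt (RtoC (t + h)) a b)) - snd (f (mkpt (RtoC t) a b)) - h * snd (D (mkpt 1 0 0))) / h) by (field; auto) end.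
    unfold Rdiv. rewrite Rabs_mult, Rabs_inv. assert (Hp := Rabs_pos_lt h Hn).
    apply Rlt_div_l; auto.
    match type of G with Rabs ?u <= _ => match goal with |- Rabs ?v < _ => replace v with u by ring end end. nra.
Qed.

(** * Integrals depending on a parameter *)

Lemma ufdiff_CInt f p D : ufdiff (fun t => 0 <= t <= 1) f p D ->
  (forall q (x : R), ccont (fun t => f t q) x) -> (forall h (x : R), ccont (fun t => D t h) x) ->
  fdiff (fun q => CInt (fun t => f t q) 0 1) p (fun h => CInt (fun t => D t h) 0 1).
Proof.
  intros (HB & HL & H) Cf CD. apply fdiff_intro.
  - exists (CInt (fun t => D t (mkpt 1 0 0)) 0 1), (CInt (fun t => D t (mkpt 0 1 0)) 0 1), (CInt (fun t => D t (mkpt 0 0 1)) 0 1).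
    intros h.
    rewrite !(Cmult_comm (CInt _ _ _)).
    assert (C1 := CD (mkpt 1 0 0)). assert (C2 := CD (mkpt 0 1 0)). assert (C3 := CD (mkpt 0 0 1)).
    rewrite <- (CInt_scal (pS h)), <- (CInt_scal (pZ h)), <- (CInt_scal (pC h)) by assumption.
    rewrite <- (CInt_plus (fun x => pZ h * D x (mkpt 0 1 0))%C), <- (CInt_plus (fun x => pS h * D x (mkpt 1 0 0))%C) by (intros; cc).
    apply CInt_ext. intros x. rewrite Rmin_left, Rmax_right by lra. intros Hx.
    destruct (HL x Hx) as (a1 & a2 & a3 & E). rewrite !E. unfold mkpt, pS, pZ, pC; simpl. ring.
  - intros eps He. destruct (H eps He) as [d [Hd0 Hd1]]. exists d. split; auto. intros h Hh.
    assert (C1 := Cf (padd p h)). assert (C2 := Cf p). assert (C3 := CD h).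
    rewrite <- (CInt_minus (fun t => f t (padd p h)) (fun t => f t p)) by assumption.
    rewrite <- (CInt_minus (fun t => f t (padd p h) - f t p)%C (fun t => D t h)) by (intros; cc).
    replace (eps * nrm h) with (eps * nrm h * (1 - 0)) by ring.
    apply CInt_norm_const. lra. intros; cc.
    intros x Hx. apply Hd1; auto.
Qed.

(** * Laplace integrals along the two vertical rays from [b] *)

Definition unit_dir (d : C) := d = Ci \/ d = (- Ci)%C.
Lemma dir_Re (d b : C) (r : R) : unit_dir d -> fst (b + d * r)%C = fst b.
Proof. intros [H|H]; subst; simpl; ring. Qed.
Lemma dir_mod (d : C) : unit_dir d -> Cmod d = 1.
Proof. intros [H|H]; subst; rewrite ?Cmod_opp; apply Cmod_Ci. Qed.
Lemma dir_sq (d : C) : unit_dir d -> (d * d = - (1))%C.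
Proof. intros [H|H]; subst; apply C_eq; simpl; ring. Qed.

(* [p] packs [(s, b, y)]: the integrand is [om r * e^(-yr) * (b + d r)^(-s)] with [d = +-i]. *)
Definition ray_fun (om : R -> R) (d : C) (p : pt) (r : R) : C :=
  (RtoC (om r) * cexp (- (pC p * r) - pS p * Clog (pZ p + d * r)))%C.
Definition ray_int (om : R -> R) (d : C) (p : pt) : C := CInt_inf (ray_fun om d p).

(** Continuity and the bound by 1 suffice for all estimates, so that one derivation serves the
    single terms and the remainder of the kernel alike. *)
Definition weight (om : R -> R) := (forall x, continuous om x) /\ (forall x, 0 <= x -> 0 <= om x <= 1).

Section TIder.
Variables (om : R -> R) (d : C).
Hypothesis Hom : weight om.
Hypothesis Hdir : unit_dir d.

Lemma ccont_dir b x : ccont (fun r : R => (b + d * r)%C) x.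
Proof. apply ccont_plus. apply ccont_const. apply ccont_mult. apply ccont_const. apply ccont_id_R. Qed.
Lemma ccont_Clog_dir (b : C) x : 0 < fst b -> ccont (fun r : R => Clog (b + d * r)%C) x.
Proof. intros. apply ccont_Clog. apply ccont_dir. rewrite dir_Re; auto. Qed.
Lemma ccont_ray_fun p x : 0 < fst (pZ p) -> ccont (ray_fun om d p) x.
Proof.
  intros. unfold ray_fun. apply ccont_mult. apply ccont_RtoC. apply Hom.
  apply ccont_exp. apply ccont_minus. apply ccont_opp. apply ccont_mult. apply ccont_const. apply ccont_id_R.
  apply ccont_mult. apply ccont_const. apply ccont_Clog_dir; auto.
Qed.

Lemma dir_mod_ge (b : C) (r : R) : fst b <= Cmod (b + d * r)%C.
Proof. rewrite <- (dir_Re d b r) by auto. eapply Rle_trans. apply Rle_abs. apply Cmod_fst. Qed.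

Lemma ray_fun_decay p a : 0 < fst (pZ p) -> a < fst (pC p) -> exists K, 0 <= K /\ expbd (ray_fun om d p) K a.
Proof.
  intros Hb Ha. set (s := pS p).
  assert (Hs := Cmod_ge_0 s).
  (* With this slope, [Cmod s * e] stays below the gap between the rate of [e^(-y r)] and the rate
     [a] asked for, so the growth of the power is paid by that gap. *)
  set (e := (fst (pC p) - a) / (Cmod s + 1)). assert (He : 0 < e) by (unfold e; apply Rdiv_lt_0_compat; lra).
  destruct (Clog_growth d (pZ p) e Hdir Hb He) as [K [HK0 HK]].
  exists (exp (Cmod s * K)). split. left; apply exp_pos. intros r Hr.
  unfold ray_fun. rewrite Cmod_mult, Cmod_R, Cmod_cexp. destruct (proj2 Hom r Hr) as [O1 O2]. rewrite Rabs_right by lra.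
  rewrite <- exp_plus.
  assert (X := exp_pos (fst (- (pC p * r) - pS p * Clog (pZ p + d * r))%C)).
  apply Rle_trans with (exp (fst (- (pC p * r) - pS p * Clog (pZ p + d * r))%C)). nra.
  apply exp_mono. fold s. set (L := Clog (pZ p + d * r)%C) in *.
  assert (Y : - fst (s * L)%C <= Cmod s * Cmod L).
  { rewrite <- Cmod_mult. eapply Rle_trans. apply Rle_abs. rewrite Rabs_Ropp. apply Cmod_fst. }
  replace (fst (- (pC p * r) - s * L)%C) with (- (fst (pC p) * r) - fst (s * L)%C) by (simpl; ring).
  specialize (HK r Hr). fold L in HK.
  assert (Cmod s * Cmod L <= Cmod s * (K + e * r)) by (apply Rmult_le_compat_l; auto).
  assert (Cmod s * (e * r) <= (fst (pC p) - a) * r).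
  { rewrite <- Rmult_assoc. apply Rmult_le_compat_r; auto.
    replace (fst (pC p) - a) with ((Cmod s + 1) * e) by (unfold e; field; lra). nra. }
  lra.
Qed.

Lemma x_le_exp c x : 0 < c -> x <= / c * exp (c * x).
Proof.
  intros Hc. assert (X := exp_ineq1_le (c * x)). apply Rmult_le_reg_l with c; auto.
  rewrite <- Rmult_assoc, Rinv_r, Rmult_1_l by lra. lra.
Qed.

(** Half of the gap between [a] and [Re y] is kept to absorb the linear factor through
    [x_le_exp]. *)
Lemma ray_fun_decay_poly p a g K : 0 < fst (pZ p) -> a < fst (pC p) -> (forall r, 0 <= r -> Cmod (g r) <= K * (1 + r)) ->
  exists K', 0 <= K' /\ expbd (fun r => ray_fun om d p r * g r)%C K' a.
Proof.
  intros Hb Ha Hg. set (a' := (a + fst (pC p)) / 2).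
  destruct (ray_fun_decay p a' Hb ltac:(unfold a'; lra)) as [K1 [HK0 HK1]].
  set (c := a' - a). assert (Hc : 0 < c) by (unfold c, a'; lra).
  assert (HK : 0 <= K). { specialize (Hg 0 ltac:(lra)). assert (X := Cmod_ge_0 (g 0)). lra. }
  exists (K1 * (K * (/ c * exp c))).
  assert (0 < / c * exp c). { apply Rmult_lt_0_compat. apply Rinv_0_lt_compat; auto. apply exp_pos. }
  split. { apply Rmult_le_pos; auto. apply Rmult_le_pos; auto. lra. }
  intros r Hr. rewrite Cmod_mult. specialize (HK1 r Hr). specialize (Hg r Hr).
  eapply Rle_trans. apply Rmult_le_compat; eauto using Cmod_ge_0.
  assert (X := x_le_exp c (1 + r) Hc).
  replace (exp (- a * r)) with (exp (- a' * r) * exp (c * r)) by (rewrite <- exp_plus; f_equal; unfold c; ring).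
  rewrite Rmult_plus_distr_l, Rmult_1_r, exp_plus in X.
  assert (E := exp_pos (- a' * r)).
  replace (K1 * exp (- a' * r) * (K * (1 + r))) with (K1 * exp (- a' * r) * K * (1 + r)) by ring.
  replace (K1 * (K * (/ c * exp c)) * (exp (- a' * r) * exp (c * r))) with (K1 * exp (- a' * r) * K * (/ c * (exp c * exp (c * r)))) by ring.
  apply Rmult_le_compat_l; auto. apply Rmult_le_pos; auto. apply Rmult_le_pos; lra.
Qed.

Lemma ray_int_is p : 0 < fst (pZ p) -> 0 < fst (pC p) -> is_CInt_inf (ray_fun om d p) (ray_int om d p).
Proof.
  intros Hb Hy. destruct (ray_fun_decay p (fst (pC p) / 2) Hb) as [K [_ HK]]. lra.
  apply is_CInt_inf_ex with K (fst (pC p) / 2); auto. lra. intros; apply ccont_ray_fun; auto.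
Qed.

(** [theta_s], [theta_b] and [theta_y] are the logarithmic derivatives of the integrand in [s], [b]
    and [y]. Each grows at most linearly in [r]. *)
Definition theta_s (p : pt) (r : R) : C := (- Clog (pZ p + d * r))%C.
Definition theta_b (p : pt) (r : R) : C := (- (pS p / (pZ p + d * r)))%C.
Definition theta_y (r : R) : C := (- RtoC r)%C.
Definition ray_int_D (p : pt) (h : pt) : C :=
  (CInt_inf (fun r => ray_fun om d p r * theta_s p r)%C * pS h + (CInt_inf (fun r => ray_fun om d p r * theta_b p r)%C * pZ h +
   CInt_inf (fun r => ray_fun om d p r * theta_y r)%C * pC h))%C.

Lemma dir_neq0 (b : C) (r : R) : 0 < fst b -> (b + d * r)%C <> 0.
Proof. intros H. apply Cmod_neq0. assert (X := dir_mod_ge b r). lra. Qed.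

Lemma ccont_theta_s p (x : R) : 0 < fst (pZ p) -> ccont (fun r => ray_fun om d p r * theta_s p r)%C x.
Proof. intros. apply ccont_mult. apply ccont_ray_fun; auto. apply ccont_opp. apply ccont_Clog_dir; auto. Qed.
Lemma ccont_theta_b p (x : R) : 0 < fst (pZ p) -> ccont (fun r => ray_fun om d p r * theta_b p r)%C x.
Proof. intros. apply ccont_mult. apply ccont_ray_fun; auto. apply ccont_opp. apply ccont_div. apply ccont_const. apply ccont_dir. apply dir_neq0; auto. Qed.
Lemma ccont_theta_y p (x : R) : 0 < fst (pZ p) -> ccont (fun r => ray_fun om d p r * theta_y r)%C x.
Proof. intros. apply ccont_mult. apply ccont_ray_fun; auto. apply ccont_opp. apply ccont_id_R. Qed.

Lemma theta_s_bd p : 0 < fst (pZ p) -> exists K, 0 <= K /\ forall r, 0 <= r -> Cmod (theta_s p r) <= K * (1 + r).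
Proof.
  intros Hb. destruct (Clog_growth d (pZ p) 1 Hdir Hb Rlt_0_1) as [K [HK0 HK]]. exists (K + 1). split. lra.
  intros r Hr. unfold theta_s. rewrite Cmod_opp. specialize (HK r Hr). nra.
Qed.
Lemma theta_b_bd p : 0 < fst (pZ p) -> exists K, 0 <= K /\ forall r, 0 <= r -> Cmod (theta_b p r) <= K * (1 + r).
Proof.
  intros Hb. exists (Cmod (pS p) / fst (pZ p)). assert (Hs := Cmod_ge_0 (pS p)).
  assert (0 <= Cmod (pS p) / fst (pZ p)) by (apply Rle_div_r; lra). split. auto.
  intros r Hr. unfold theta_b. rewrite Cmod_opp, Cmod_div by (apply dir_neq0; auto).
  assert (X := dir_mod_ge (pZ p) r).
  apply Rle_trans with (Cmod (pS p) / fst (pZ p)). 2: nra.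
  apply Rmult_le_compat_l; auto. apply Rinv_le_contravar; auto.
Qed.
Lemma theta_y_bd : forall r, 0 <= r -> Cmod (theta_y r) <= 1 * (1 + r).
Proof. intros r Hr. unfold theta_y. rewrite Cmod_opp, Cmod_R, Rabs_right; lra. Qed.

Lemma ray_int_D_is p h : 0 < fst (pZ p) -> 0 < fst (pC p) ->
  is_CInt_inf (fun r => ray_fun om d p r * (theta_s p r * pS h + (theta_b p r * pZ h + theta_y r * pC h)))%C (ray_int_D p h).
Proof.
  intros Hb Hy. set (a := fst (pC p) / 2).
  destruct (theta_s_bd p Hb) as [K1 [_ B1]]. destruct (theta_b_bd p Hb) as [K2 [_ B2]].
  destruct (ray_fun_decay_poly p a _ K1 Hb ltac:(unfold a; lra) B1) as [L1 [_ E1]].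
  destruct (ray_fun_decay_poly p a _ K2 Hb ltac:(unfold a; lra) B2) as [L2 [_ E2]].
  destruct (ray_fun_decay_poly p a _ 1 Hb ltac:(unfold a; lra) theta_y_bd) as [L3 [_ E3]].
  assert (Ha : 0 < a) by (unfold a; lra).
  assert (C1 := fun x : R => ccont_theta_s p x Hb). assert (C2 := fun x : R => ccont_theta_b p x Hb). assert (C3 := fun x : R => ccont_theta_y p x Hb).
  apply is_CInt_inf_ext with (f := fun r => (pS h * (ray_fun om d p r * theta_s p r) + (pZ h * (ray_fun om d p r * theta_b p r) + pC h * (ray_fun om d p r * theta_y r)))%C).
  { intros; ring. }
  unfold ray_int_D. rewrite !(Cmult_comm (CInt_inf _)).
  assert (S1 : forall x : R, ccont (fun r => pS h * (ray_fun om d p r * theta_s p r))%C x) by (intros; apply ccont_mult; auto using ccont_const).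
  assert (S2 : forall x : R, ccont (fun r => pZ h * (ray_fun om d p r * theta_b p r))%C x) by (intros; apply ccont_mult; auto using ccont_const).
  assert (S3 : forall x : R, ccont (fun r => pC h * (ray_fun om d p r * theta_y r))%C x) by (intros; apply ccont_mult; auto using ccont_const).
  apply is_CInt_inf_plus; auto. { intros; apply ccont_plus; auto. }
  { apply is_CInt_inf_scal; auto. eapply is_CInt_inf_ex; eauto. }
  apply is_CInt_inf_plus; auto; apply is_CInt_inf_scal; auto; eapply is_CInt_inf_ex; eauto.
Qed.

(** Instead of dominated convergence, an explicit second order estimate: the integrand at [p + h] is
    the one at [p] times [cexp del], and [del] agrees with its linear part [dl] up to a multiple of
    [n^2]. The error of the integrand is then at most [K7 n^2 e^(-Y r / 2)], which integrates to a
    multiple of [n^2]. *)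
Lemma fdiff_ray_int p : 0 < fst (pZ p) -> 0 < fst (pC p) -> fdiff (ray_int om d) p (ray_int_D p).
Proof.
  intros Hb Hy. apply fdiff_intro. { eexists _, _, _. intros; reflexivity. }
  intros eps He.
  set (s := pS p) in *. set (b := pZ p) in *. set (Y := fst (pC p)) in *. set (be := fst b) in *.
  assert (Hs := Cmod_ge_0 s).
  destruct (theta_s_bd p Hb) as [K1 [HK1 B1]]. destruct (theta_b_bd p Hb) as [K2 [HK2 B2]].
  set (K3 := K1 + (K2 + 1)).
  set (K4 := 2 * Cmod s / (be * be) + 2 / be).
  assert (HK4 : 0 <= K4). { unfold K4. assert (0 <= 2 * Cmod s / (be * be)) by (apply Rle_div_r; nra). assert (0 <= 2 / be) by (apply Rle_div_r; lra). lra. }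
  set (K5 := K3 + K4 + 1). assert (HK5 : 0 < K5) by (unfold K5, K3; lra).
  (* Budget of exponential rates: out of [7/8 Y], an eighth pays for [exp (Cmod del)] and
     [c = Y / 32] twice for the factor [(1 + r)^2]. What remains exceeds [Y / 2]. *)
  destruct (ray_fun_decay p (7/8 * Y) Hb ltac:(fold Y; lra)) as [Kq [HKq Eq]].
  set (c := Y / 32). assert (Hc : 0 < c) by (unfold c; lra).
  set (K6 := K5 * K5 * (/ c * exp c) * (/ c * exp c) * exp (Y / 8) + K4).
  assert (HK6 : 0 <= K6). { unfold K6. assert (Z1 := exp_pos c). assert (Z2 := exp_pos (Y/8)). assert (Z3 : 0 < / c) by (apply Rinv_0_lt_compat; auto).
     assert (0 <= K5 * K5 * (/ c * exp c) * (/ c * exp c) * exp (Y / 8)). repeat apply Rmult_le_pos; lra. lra. }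
  set (K7 := Kq * K6). assert (HK7 : 0 <= K7) by (unfold K7; apply Rmult_le_pos; auto).
  (* The bounds in turn: [n^2 <= n (1 + r)]; [b + h] stays in the half-plane and within reach of
     [Clog_quad]; [Cmod del <= Y / 8 (1 + r)]; [Re y] stays positive; the final error is below
     [eps n]. *)
  set (rho := Rmin (Rmin 1 (be / 2)) (Rmin (Y / 8 / K5) (Rmin (Y / 2) (eps * (Y / 2) / (K7 + 1))))).
  assert (M : 0 < rho /\ rho <= 1 /\ rho <= be / 2 /\ rho <= Y / 8 / K5 /\ rho <= Y / 2 /\ rho <= eps * (Y / 2) / (K7 + 1)).
  { assert (0 < Y / 8 / K5) by (apply Rdiv_lt_0_compat; lra). assert (0 < eps * (Y / 2) / (K7 + 1)) by (apply Rdiv_lt_0_compat; nra).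
    unfold rho. set (u := Y / 8 / K5) in *. set (v := eps * (Y / 2) / (K7 + 1)) in *. split. repeat apply Rmin_pos; lra.
    assert (W1 := Rmin_l (Rmin 1 (be / 2)) (Rmin u (Rmin (Y / 2) v))). assert (W2 := Rmin_r (Rmin 1 (be / 2)) (Rmin u (Rmin (Y / 2) v))).
    assert (W3 := Rmin_l 1 (be / 2)). assert (W4 := Rmin_r 1 (be / 2)).
    assert (W5 := Rmin_l u (Rmin (Y / 2) v)). assert (W6 := Rmin_r u (Rmin (Y / 2) v)).
    assert (W7 := Rmin_l (Y / 2) v). assert (W8 := Rmin_r (Y / 2) v). lra. }
  destruct M as (M0 & M1 & M2 & M3 & M4 & M5).
  exists rho. split; auto. intros h Hh.
  assert (N := nrm_ge0 h). assert (NS := nrm_S h). assert (NZ := nrm_Z h). assert (NC := nrm_C h).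
  set (n := nrm h) in *.
  assert (Hb' : 0 < fst (pZ (padd p h))).
  { change (pZ (padd p h)) with (b + pZ h)%C. simpl. fold be. assert (X := Cmod_fst (pZ h)).
    assert (X2 : Rabs (fst (pZ h)) <= be / 2) by lra. apply Rabs_le_between in X2. lra. }
  assert (Hy' : 0 < fst (pC (padd p h))).
  { change (pC (padd p h)) with (pC p + pC h)%C. simpl. fold Y. assert (X := Cmod_fst (pC h)).
    assert (X2 : Rabs (fst (pC h)) < Y / 2) by lra. apply Rabs_def2 in X2. lra. }
  set (dl := fun r : R => (theta_s p r * pS h + (theta_b p r * pZ h + theta_y r * pC h))%C).
  assert (Bd : expbd (fun r => ray_fun om d (padd p h) r - ray_fun om d p r - ray_fun om d p r * dl r)%C (K7 * (n * n)) (Y / 2)).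
  { intros r Hr.
    set (w := (b + d * r)%C). set (w' := (b + pZ h + d * r)%C).
    assert (Hw : be <= Cmod w) by (apply dir_mod_ge).
    assert (Hfw : fst w = be) by (unfold w; rewrite dir_Re; auto).
    assert (Hfw' : 0 < fst w') by (unfold w'; rewrite dir_Re; auto).
    assert (Ew : (w' - w = pZ h)%C) by (unfold w, w'; ring).
    destruct (Clog_quad w w') as [Q1 Q2]. lra. auto. rewrite Ew; lra. rewrite Ew in Q1, Q2.
    assert (Hr1 : Cmod (pZ h) / Cmod w <= n / be).
    { apply Rmult_le_compat; auto using Cmod_ge_0. left; apply Rinv_0_lt_compat; lra. apply Rinv_le_contravar; auto. }
    assert (Hr0 : 0 <= Cmod (pZ h) / Cmod w). { apply Rle_div_r. lra. rewrite Rmult_0_l; apply Cmod_ge_0. }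
    (* The exact change of the exponent. Its difference from [dl r] consists of a second order error
       of the logarithm times [s] and a product of two first order increments, both covered by
       [Clog_quad]. *)
    set (del := (- (pC h * r) - pS h * Clog w - (s + pS h) * (Clog w' - Clog w))%C).
    assert (Eq' : ray_fun om d (padd p h) r = (ray_fun om d p r * cexp del)%C).
    { unfold ray_fun. rewrite <- Cmult_assoc, <- cexp_plus. f_equal. f_equal.
      change (pZ (padd p h)) with (b + pZ h)%C. change (pC (padd p h)) with (pC p + pC h)%C. change (pS (padd p h)) with (s + pS h)%C.
      fold w'. fold b. fold w. fold s. unfold del. ring. }
    rewrite Eq'.
    replace (ray_fun om d p r * cexp del - ray_fun om d p r - ray_fun om d p r * dl r)%C with
      (ray_fun om d p r * ((cexp del - 1 - del) + (del - dl r)))%C by ring.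
    assert (Ed : Cmod (del - dl r)%C <= K4 * (n * n)).
    { replace (del - dl r)%C with (- (s * (Clog w' - Clog w - pZ h / w)) - pS h * (Clog w' - Clog w))%C.
      2: { unfold del, dl, theta_s, theta_b, theta_y. fold b. fold w. fold s. field. apply Cmod_neq0; lra. }
      eapply Rle_trans. apply Cmod_minus_le. rewrite Cmod_opp, !Cmod_mult.
      assert (A1 : (Cmod (pZ h) / Cmod w) ^ 2 <= (n / be) ^ 2) by (apply pow_incr; lra).
      assert (A2 : Cmod s * Cmod (Clog w' - Clog w - pZ h / w)%C <= Cmod s * (2 * (n / be) ^ 2)) by (apply Rmult_le_compat_l; lra).
      assert (A3 : Cmod (pS h) * Cmod (Clog w' - Clog w)%C <= n * (2 * (n / be))) by (apply Rmult_le_compat; auto using Cmod_ge_0; lra).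
      replace (K4 * (n * n)) with (Cmod s * (2 * (n / be) ^ 2) + n * (2 * (n / be))) by (unfold K4; field; lra). lra. }
    assert (Edl : Cmod (dl r) <= K3 * (n * (1 + r))).
    { unfold dl. eapply Rle_trans. apply Cmod_triangle. eapply Rle_trans. apply Rplus_le_compat_l. apply Cmod_triangle.
      rewrite !Cmod_mult.
      assert (A1 : Cmod (theta_s p r) * Cmod (pS h) <= K1 * (1 + r) * n) by (apply Rmult_le_compat; auto using Cmod_ge_0).
      assert (A2 : Cmod (theta_b p r) * Cmod (pZ h) <= K2 * (1 + r) * n) by (apply Rmult_le_compat; auto using Cmod_ge_0).
      assert (A3 : Cmod (theta_y r) * Cmod (pC h) <= 1 * (1 + r) * n) by (apply Rmult_le_compat; auto using Cmod_ge_0, theta_y_bd).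
      unfold K3. lra. }
    assert (Edel : Cmod del <= K5 * (n * (1 + r))).
    { assert (T := Cmod_tri_sub del (dl r)). unfold K5.
      assert (n * n <= n * (1 + r)) by (apply Rmult_le_compat_l; lra).
      assert (K4 * (n * n) <= K4 * (n * (1 + r))) by (apply Rmult_le_compat_l; lra).
      assert (0 <= n * (1 + r)) by nra. lra. }
    assert (Hn8 : K5 * n <= Y / 8). { assert (n * K5 <= Y / 8). apply Rle_div_r; lra. lra. }
    assert (Ede : exp (Cmod del) <= exp (Y / 8) * exp (Y / 8 * r)).
    { rewrite <- exp_plus. apply exp_mono. nra. }
    assert (E2 := cexp_2_bound del).
    assert (X1 := x_le_exp c (1 + r) Hc). rewrite Rmult_plus_distr_l, Rmult_1_r, exp_plus in X1.
    assert (X2 : (1 + r) ^ 2 <= (/ c * (exp c * exp (c * r))) ^ 2) by (apply pow_incr; lra).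
    assert (E3 : Cmod del ^ 2 <= K5 * K5 * (n * n) * (/ c * (exp c * exp (c * r))) ^ 2).
    { apply Rle_trans with ((K5 * (n * (1 + r))) ^ 2). apply pow_incr. split; auto using Cmod_ge_0.
      replace ((K5 * (n * (1 + r))) ^ 2) with (K5 * K5 * (n * n) * (1 + r) ^ 2) by ring. apply Rmult_le_compat_l; auto.
      apply Rmult_le_pos; nra. }
    assert (E4 : Cmod (cexp del - 1 - del)%C <= (K6 - K4) * (n * n) * exp (3 / 16 * Y * r)).
    { eapply Rle_trans. apply E2. eapply Rle_trans. apply Rmult_le_compat. apply pow2_ge_0. left; apply exp_pos. apply E3. apply Ede.
      right. unfold K6. replace (3 / 16 * Y * r) with (c * r + (c * r + Y / 8 * r)) by (unfold c; field). rewrite !exp_plus. ring. }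
    assert (Xe : 1 <= exp (3 / 16 * Y * r)). { rewrite <- exp_0. apply exp_mono. assert (0 <= Y * r) by nra. nra. }
    assert (E5 : Cmod (cexp del - 1 - del + (del - dl r))%C <= K6 * (n * n) * exp (3 / 16 * Y * r)).
    { eapply Rle_trans. apply Cmod_triangle.
      assert (K4 * (n * n) <= K4 * (n * n) * exp (3 / 16 * Y * r)). { rewrite <- (Rmult_1_r (K4 * (n * n))) at 1. apply Rmult_le_compat_l; auto. apply Rmult_le_pos; nra. }
      lra. }
    rewrite Cmod_mult. eapply Rle_trans. apply Rmult_le_compat; eauto using Cmod_ge_0.
    unfold K7.
    assert (F : exp (- (7 / 8 * Y) * r) * exp (3 / 16 * Y * r) <= exp (- (Y / 2) * r)).
    { rewrite <- exp_plus. apply exp_mono. assert (0 <= Y * r) by nra. lra. }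
    replace (Kq * exp (- (7 / 8 * Y) * r) * (K6 * (n * n) * exp (3 / 16 * Y * r))) with
      (Kq * K6 * (n * n) * (exp (- (7 / 8 * Y) * r) * exp (3 / 16 * Y * r))) by ring.
    apply Rmult_le_compat_l; auto. apply Rmult_le_pos; auto. nra. }
  assert (Hcq := fun x : R => ccont_ray_fun p x Hb). assert (Hcq' := fun x : R => ccont_ray_fun (padd p h) x Hb').
  assert (Hcdl : forall x : R, ccont (fun r => ray_fun om d p r * dl r)%C x).
  { intros x. apply ccont_ext with (f := fun r => ((ray_fun om d p r * theta_s p r) * pS h + ((ray_fun om d p r * theta_b p r) * pZ h + (ray_fun om d p r * theta_y r) * pC h))%C).
    intros; unfold dl; ring.
    assert (G1 := fun y : R => ccont_theta_s p y Hb). assert (G2 := fun y : R => ccont_theta_b p y Hb). assert (G3 := fun y : R => ccont_theta_y p y Hb).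
    cbv beta in G1, G2, G3.
    apply ccont_plus; [|apply ccont_plus]; apply ccont_mult; try apply ccont_const; [exact (G1 x)|exact (G2 x)|exact (G3 x)]. }
  assert (I1 := ray_int_is p Hb Hy). assert (I2 := ray_int_is (padd p h) Hb' Hy'). assert (I3 := ray_int_D_is p h Hb Hy). fold dl in I3.
  assert (I4 : is_CInt_inf (fun r => ray_fun om d (padd p h) r - ray_fun om d p r - ray_fun om d p r * dl r)%C (ray_int om d (padd p h) - ray_int om d p - ray_int_D p h)%C).
  { replace (ray_int om d (padd p h) - ray_int om d p - ray_int_D p h)%C with (ray_int om d (padd p h) + (- (1)) * (ray_int om d p + ray_int_D p h))%C by ring.
    apply is_CInt_inf_ext with (f := fun r => (ray_fun om d (padd p h) r + (- (1)) * (ray_fun om d p r + ray_fun om d p r * dl r))%C). intros; ring.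
    apply is_CInt_inf_plus; auto. intros; apply ccont_mult. apply ccont_const. apply ccont_plus; auto.
    apply is_CInt_inf_scal. intros; apply ccont_plus; auto. apply is_CInt_inf_plus; auto. }
  eapply Rle_trans. eapply is_CInt_inf_bound. 4: apply I4. 3: apply Bd. lra. intros; apply ccont_minus; [apply ccont_minus; [apply Hcq'|apply Hcq]|apply Hcdl].
  apply Rle_div_l. lra.
  assert (n * (K7 + 1) <= eps * (Y / 2)). { apply Rle_div_r; lra. }
  assert (n * (n * (K7 + 1)) <= n * (eps * (Y / 2))) by (apply Rmult_le_compat_l; lra). nra.
Qed.
End TIder.

(** * Incomplete gamma functions *)

Definition weight1 (_ : R) : R := 1.
Lemma weight_one : weight weight1.
Proof. split. intros; apply continuous_const. intros; unfold weight1; lra. Qed.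
(* The factor left over when [1 / (2 cosh (pi r))] is expanded in powers of [e^(-2 pi r)]. *)
Definition tail_weight (r : R) : R := / (1 + exp (- (2 * PI) * r)).
Lemma weight_tail_weight : weight tail_weight.
Proof.
  split.
  - intros x. apply (ex_derive_continuous tail_weight). unfold tail_weight. assert (X := exp_pos (- (2 * PI) * x)). auto_derive. lra.
  - intros x Hx. unfold tail_weight. assert (X := exp_pos (- (2 * PI) * x)). split.
    left; apply Rinv_0_lt_compat; lra. rewrite <- Rinv_1 at 2. apply Rinv_le_contravar; lra.
Qed.

Definition ray (d : C) (p : pt) : C := ray_int weight1 d p.
Definition ray_tail (d : C) (p : pt) : C := ray_int tail_weight d p.
(** The power [b^a]: the exponent comes first, opposite to [cpow]. *)
Definition cpw (a b : C) : C := cexp (a * Clog b)%C.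

(** Pointwise [tail_weight r * (1 + e^(-2 PI r)) = 1]: one term of the geometric expansion of the
    kernel is split off, and the remainder is of the same shape with [y] moved by [2 PI]. *)
Lemma ray_tail_step (d s b y : C) : unit_dir d -> 0 < fst b -> 0 < fst y ->
  (ray_tail d (mkpt s b y) + ray_tail d (mkpt s b (y + RtoC (2 * PI))))%C = ray d (mkpt s b y).
Proof.
  intros Hd Hb Hy. assert (HP := PI_RGT_0).
  assert (I1 := ray_int_is tail_weight d weight_tail_weight Hd (mkpt s b y) Hb Hy).
  assert (I2 := ray_int_is tail_weight d weight_tail_weight Hd (mkpt s b (y + RtoC (2 * PI))) Hb ltac:(simpl; lra)).
  assert (I3 := ray_int_is weight1 d weight_one Hd (mkpt s b y) Hb Hy).
  eapply is_CInt_inf_unique. 2: apply I3.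
  apply is_CInt_inf_ext with (f := fun r => (ray_fun tail_weight d (mkpt s b y) r + ray_fun tail_weight d (mkpt s b (y + RtoC (2 * PI))) r)%C).
  2: { apply is_CInt_inf_plus; [intros; apply ccont_ray_fun; [exact weight_tail_weight|exact Hd|exact Hb]|intros; apply ccont_ray_fun; [exact weight_tail_weight|exact Hd|exact Hb]|exact I1|exact I2]. }
  intros r Hr. unfold ray_fun, weight1, mkpt, pS, pZ, pC; simpl.
  replace (- ((y + (2 * PI)%R) * r) - s * Clog (b + d * r))%C with (RtoC (- (2 * PI) * r) + (- (y * r) - s * Clog (b + d * r)))%C.
  2: { rewrite RtoC_mult, RtoC_opp. ring. }
  rewrite cexp_plus.
  replace (cexp (RtoC (- (2 * PI) * r))) with (RtoC (exp (- (2 * PI) * r))).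
  2: { apply C_eq; unfold cexp; simpl; rewrite ?cos_0, ?sin_0; ring. }
  rewrite Cmult_assoc, <- Cmult_plus_distr_r. f_equal.
  rewrite <- RtoC_mult, <- RtoC_plus. f_equal. unfold tail_weight. field. assert (X := exp_pos (- (2 * PI) * r)). lra.
Qed.

Lemma cder_Clog f t l : 0 < fst (f t) -> cder f t l -> cder (fun x => Clog (f x)) t (l / f t)%C.
Proof.
  intros Hp [H1 H2]. set (u := fun x => fst (f x)). set (v := fun x => snd (f x)).
  assert (Hn : u t * u t + v t * v t <> 0) by (unfold u; nra).
  assert (Hm : 0 < u t * u t + v t * v t) by (unfold u in *; nra).
  assert (Hu : 0 < u t) by exact Hp.
  split; unfold Clog; simpl.
  - apply is_derive_ext with (f := fun x => ln (sqrt (u x * u x + v x * v x))).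
    { intros x. unfold Cmod, u, v. f_equal. f_equal. ring. }
    eapply is_derive_eqv.
    + apply (is_derive_comp ln (fun x => sqrt (u x * u x + v x * v x)) t).
      * apply is_derive_Reals. apply derivable_pt_lim_ln. apply sqrt_lt_R0; auto.
      * apply (is_derive_comp sqrt (fun x => u x * u x + v x * v x) t).
        apply is_derive_Reals. apply derivable_pt_lim_sqrt; auto.
        apply is_derive_plus_R; apply is_derive_mult_R; eassumption.
    + unfold scal; simpl; unfold mult; simpl. fold (u t) (v t).
      set (m := u t * u t + v t * v t) in *. assert (Hsm : 0 < sqrt m) by (apply sqrt_lt_R0; auto).
      transitivity ((fst l * u t + u t * fst l + (snd l * v t + v t * snd l)) / (2 * (sqrt m * sqrt m))).
      field; lra. rewrite sqrt_sqrt by lra. unfold m. field. auto.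
  - eapply is_derive_eqv.
    + apply (is_derive_comp atan (fun x => v x / u x) t).
      * apply is_derive_Reals. apply derivable_pt_lim_atan.
      * unfold Rdiv. apply is_derive_mult_R. exact H2. apply (is_derive_inv u). exact H1. lra.
    + unfold scal; simpl; unfold mult; simpl. unfold Rsqr. fold (u t) (v t). field. repeat split; nra.
Qed.

Lemma cder_ray_fun (d s b y : C) (r : R) : unit_dir d -> 0 < fst b ->
  cder (ray_fun weight1 d (mkpt s b y)) r (ray_fun weight1 d (mkpt s b y) r * (- y - s * d / (b + d * r)))%C.
Proof.
  intros Hd Hb. unfold ray_fun, weight1, mkpt, pS, pZ, pC; simpl.
  eapply cder_eq. apply cder_scal. apply cder_exp. apply cder_minus. apply cder_opp. apply cder_scal. apply cder_id.
  apply cder_scal. apply cder_Clog. rewrite dir_Re; auto. apply cder_plus. apply cder_const. apply cder_scal. apply cder_id.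
  cbv beta. field. apply dir_neq0; auto.
Qed.

(* Integral over [0,oo) of the [r]-derivative of [- d e^(-yr) (b + d r)^(1-s)]; since
   [CInt_inf (ray_fun * theta_y)] is [d ray / d y], this is a first order equation for [ray] in [y]. *)
Lemma ray_ode (d s b y : C) : unit_dir d -> 0 < fst b -> 0 < fst y ->
  (y * CInt_inf (fun r => ray_fun weight1 d (mkpt s b y) r * theta_y r) + (1 - s + d * b * y) * ray d (mkpt s b y) = d * cpw (1 - s) b)%C.
Proof.
  intros Hd Hb Hy. set (p := mkpt s b y).
  assert (I1 := ray_int_is weight1 d weight_one Hd p Hb Hy).
  assert (Hw := weight_one).
  destruct (ray_fun_decay_poly weight1 d Hw Hd p (fst y / 2) _ 1 Hb ltac:(simpl; lra) theta_y_bd) as [L3 [_ E3]].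
  assert (C0 := fun x : R => ccont_ray_fun weight1 d Hw Hd p x Hb).
  assert (C3 := fun x : R => ccont_theta_y weight1 d Hw Hd p x Hb). cbv beta in C0, C3.
  assert (I3 : is_CInt_inf (fun r => ray_fun weight1 d p r * theta_y r)%C (CInt_inf (fun r => ray_fun weight1 d p r * theta_y r)%C)).
  { eapply is_CInt_inf_ex with (a := fst y / 2). lra. exact C3. exact E3. }
  destruct (ray_fun_decay weight1 d Hw Hd (mkpt (s - 1)%C b y) (fst y / 2) Hb ltac:(simpl; lra)) as [L4 [_ E4]].
  set (F := fun r => (- d * ray_fun weight1 d (mkpt (s - 1)%C b y) r)%C).
  set (f := fun r => (y * (ray_fun weight1 d p r * theta_y r) + (1 - s + d * b * y) * ray_fun weight1 d p r)%C).
  assert (Cf : forall x : R, ccont f x).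
  { intros x; unfold f. apply ccont_plus; apply ccont_mult; try apply ccont_const; [apply C3|apply C0]. }
  assert (X : is_CInt_inf f (- F 0)%C).
  { apply is_CInt_inf_FTC with (K := L4) (a := fst y / 2); auto. lra.
    - intros x Hx. eapply cder_eq. apply cder_scal. apply cder_ray_fun; auto.
      assert (W := dir_neq0 d Hd b x Hb).
      assert (Q : ray_fun weight1 d (mkpt (s - 1)%C b y) x = (ray_fun weight1 d p x * (b + d * x))%C).
      { unfold ray_fun, p, mkpt, pS, pZ, pC; simpl. rewrite <- Cmult_assoc. f_equal.
        rewrite <- (cexp_Clog (b + d * x)%C) at 3 by (rewrite dir_Re; auto). rewrite <- cexp_plus. f_equal. ring. }
      rewrite Q. unfold f, theta_y.
      transitivity (ray_fun weight1 d p x * (d * y * b + d * d * (y * x) + d * d * (s - 1)))%C. field; auto.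
      rewrite (dir_sq d Hd). ring.
    - intros r Hr. unfold F. rewrite Cmod_mult, Cmod_opp, dir_mod, Rmult_1_l by auto. apply E4; auto. }
  assert (Y : is_CInt_inf f (y * CInt_inf (fun r => ray_fun weight1 d p r * theta_y r) + (1 - s + d * b * y) * ray d p)%C).
  { unfold f. apply is_CInt_inf_plus.
    intros; apply ccont_mult; [apply ccont_const|apply C3]. intros; apply ccont_mult; [apply ccont_const|apply C0].
    apply is_CInt_inf_scal; auto. apply is_CInt_inf_scal; auto. }
  rewrite (is_CInt_inf_unique _ _ _ Y X). unfold F, ray_fun, weight1, cpw, mkpt, pS, pZ, pC; simpl.
  replace (b + d * 0)%C with b by ring.
  replace (- (y * 0) - (s - 1) * Clog b)%C with ((1 - s) * Clog b)%C by ring. ring.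
Qed.

(** Integrating over [t] gives the primitive of [e^((1-s) u + d b e^u)] from 0 to [lambda = pC p]
    along [u = t lambda]. It makes sense for all complex [lambda], which is how the half-plane
    [Re y > 0] is left. *)
Definition ray_prim_fun (d : C) (p : pt) (t : R) : C :=
  (pC p * cexp ((1 - pS p) * (t * pC p) + d * pZ p * cexp (t * pC p)))%C.
Definition ray_prim (d : C) (p : pt) : C := CInt (ray_prim_fun d p) 0 1.
(* In [lambda = log y] the equation reads [d/d lambda (e^(d b y) y^(1-s) ray) = d b^(1-s) y^(1-s) e^(d b y)];
   its solution with the initial value at [y = 1] is entire in [s] and [lambda]. *)
Definition ray_cont (d : C) (p : pt) : C :=
  (cexp (- (d * pZ p * cexp (pC p)) + (pS p - 1) * pC p) *
   (cexp (d * pZ p) * ray d (mkpt (pS p) (pZ p) 1) + d * cpw (1 - pS p) (pZ p) * ray_prim d p))%C.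

Lemma ccont_ray_prim_fun d p x : ccont (ray_prim_fun d p) x.
Proof. unfold ray_prim_fun. cc. Qed.

Lemma cexp_re_pos (l : C) (t : R) : 0 <= t <= 1 -> Rabs (snd l) < PI / 2 -> 0 < fst (cexp (RtoC t * l)%C).
Proof.
  intros Ht Hl. unfold cexp; simpl. apply Rmult_lt_0_compat. apply exp_pos.
  apply Rabs_def2 in Hl. apply cos_gt_0; rewrite Rmult_0_l, Rplus_0_r; nra.
Qed.

(** For [|Im l| < PI / 2] the whole curve [e^(t l)] stays in the half-plane of convergence, so the
    differential equation can be integrated from [y = 1] to [y = e^l]. The function [ph] is [ray]
    times the integrating factor. *)
Lemma ray_cont_eq (d s b l : C) : unit_dir d -> 0 < fst b -> Rabs (snd l) < PI / 2 ->
  ray_cont d (mkpt s b l) = ray d (mkpt s b (cexp l)).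
Proof.
  intros Hd Hb Hl.
  set (ph := fun t : R => (cexp (d * b * cexp (t * l) + (1 - s) * (t * l)) * ray d (mkpt s b (cexp (t * l))))%C).
  assert (Hder : forall t, 0 <= t <= 1 -> cder ph t (d * cpw (1 - s) b * ray_prim_fun d (mkpt s b l) t)%C).
  { intros t Ht. assert (Hy := cexp_re_pos l t Ht Hl).
    assert (HT : cder (fun x : R => ray d (mkpt s b (cexp (x * l)))) t
       (CInt_inf (fun r => ray_fun weight1 d (mkpt s b (cexp (t * l))) r * theta_y r) * (cexp (t * l) * l))%C).
    { eapply cder_eq.
      apply (fdiff_cder (fun q => ray d (mkpt s b (cexp (pS q * l)))) t 0 0).
      apply (fdiff_comp _ (ray d) (fun _ => s) (fun _ => b) (fun q => cexp (pS q * l)%C)).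
      - apply fdiff_ray_int; auto using weight_one.
      - apply fdiff_const.
      - apply fdiff_const.
      - apply fdiff_exp. apply fdiff_mult. apply fdiff_S. apply fdiff_const.
      - unfold ray_int_D, mkpt, pS, pZ, pC; simpl. ring. }
    eapply cder_eq. apply cder_mult. apply cder_exp. apply cder_plus. apply cder_scal. apply cder_exp. apply cder_line.
    apply cder_scal. apply cder_line. apply HT. cbv beta.
    rewrite <- (ray_ode d s b (cexp (t * l)%C)) by auto.
    unfold ray_prim_fun, mkpt, pS, pZ, pC; simpl. rewrite (Cplus_comm ((1 - s) * (t * l))). ring. }
  assert (E := CInt_FTC ph _ 0 1 Rle_0_1 Hder).
  rewrite CInt_scal in E by (intros; apply ccont_ray_prim_fun).
  unfold ray_cont, mkpt, pS, pZ, pC in *; simpl in *. fold (mkpt s b 1).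
  change (s, b, l) with (mkpt s b l) in *.
  unfold ray_prim. rewrite E.
  2: { intros x. apply ccont_mult. apply ccont_const. apply ccont_ray_prim_fun. }
  unfold ph, mkpt. replace (0 * l)%C with (RtoC 0) by ring. rewrite cexp_0. replace (1 * l)%C with l by ring.
  replace (d * b * 1 + (1 - s) * 0)%C with (d * b)%C by ring.
  match goal with |- (?a * (?u + (?v - ?u')))%C = _ => replace (u + (v - u'))%C with v by ring end.
  rewrite Cmult_assoc, <- cexp_plus.
  replace (- (d * b * cexp l) + (s - 1) * l + (d * b * cexp l + (1 - s) * l))%C with (RtoC 0) by ring.
  rewrite cexp_0. ring.
Qed.

(* Used on [0,1] only; [Rabs] makes it continuous on the whole line. *)
Definition strip_fun (s b w : C) (u : R) : C := cexp (w * u - s * Clog (b + RtoC (Rabs u)))%C.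

Lemma ccont_Rabs (x : R) : ccont (fun u : R => RtoC (Rabs u)) x.
Proof. apply (ccont_RtoC Rabs). apply (continuous_Rabs x). Qed.
Lemma ccont_Clog_abs (b : C) (x : R) : 0 < fst b -> ccont (fun u : R => Clog (b + RtoC (Rabs u))%C) x.
Proof.
  intros Hb. apply ccont_Clog. apply ccont_plus. apply ccont_const. apply ccont_Rabs.
  simpl. assert (X := Rabs_pos x). lra.
Qed.
Lemma ccont_strip_fun (s b w : C) (x : R) : 0 < fst b -> ccont (strip_fun s b w) x.
Proof.
  intros Hb. assert (C1 := fun x : R => ccont_Clog_abs b x Hb). unfold strip_fun. cc.
Qed.

(** In place of a change of contour, [b] moves continuously to [b + 1]: the derivative in [x] of
    [e^(d x) ray (b + x)] at [y = 1] is [d e^(d x) (b + x)^(-s)]. *)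
Lemma ray_shift1 (d s b : C) : unit_dir d -> 0 < fst b ->
  (ray d (mkpt s b 1) - cexp d * ray d (mkpt s (b + 1) 1) = - d * CInt (strip_fun s b d) 0 1)%C.
Proof.
  intros Hd Hb. assert (Hw := weight_one).
  set (A := fun x : R => (cexp (x * d) * ray d (mkpt s (b + x) 1))%C).
  assert (Hder : forall x, 0 <= x <= 1 -> cder A x (d * strip_fun s b d x)%C).
  { intros x Hx.
    set (b' := (b + x)%C). assert (Hb' : 0 < fst b') by (unfold b'; simpl; lra).
    set (p := mkpt s b' 1).
    assert (HT : cder (fun x : R => ray d (mkpt s (b + x) 1)) x (CInt_inf (fun r => ray_fun weight1 d p r * theta_b d p r))%C).
    { eapply cder_eq.
      apply (fdiff_cder (fun q => ray d (mkpt s (b + pS q)%C 1)) x 0 0).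
      apply (fdiff_comp _ (ray d) (fun _ => s) (fun q => (b + pS q)%C) (fun _ => RtoC 1)).
      - apply fdiff_ray_int; auto. simpl; lra.
      - apply fdiff_const.
      - apply fdiff_plus. apply fdiff_const. apply fdiff_S.
      - apply fdiff_const.
      - unfold ray_int_D, p, b', mkpt, pS, pZ, pC; simpl. ring. }
    (* The fundamental theorem for [- d e^(-r) (b' + d r)^(-s)] on the half line; the sign comes
       from [d * d = -1]. *)
    assert (Key : (d * ray d p + CInt_inf (fun r => ray_fun weight1 d p r * theta_b d p r) = d * cpw (- s) b')%C).
    { assert (I1 := ray_int_is weight1 d Hw Hd p Hb' Rlt_0_1).
      destruct (theta_b_bd d Hd p Hb') as [Kg [_ Bg]].
      destruct (ray_fun_decay_poly weight1 d Hw Hd p (1 / 2) _ Kg Hb' ltac:(simpl; lra) Bg) as [L3 [_ E3]].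
      assert (C0 := fun x : R => ccont_ray_fun weight1 d Hw Hd p x Hb').
      assert (C3 := fun x : R => ccont_theta_b weight1 d Hw Hd p x Hb'). cbv beta in C0, C3.
      assert (I3 : is_CInt_inf (fun r => ray_fun weight1 d p r * theta_b d p r)%C (CInt_inf (fun r => ray_fun weight1 d p r * theta_b d p r)%C)).
      { eapply is_CInt_inf_ex with (a := 1 / 2). lra. exact C3. exact E3. }
      destruct (ray_fun_decay weight1 d Hw Hd p (1 / 2) Hb' ltac:(simpl; lra)) as [L4 [_ E4]].
      set (F := fun r => (- d * ray_fun weight1 d p r)%C).
      set (f := fun r => (d * ray_fun weight1 d p r + ray_fun weight1 d p r * theta_b d p r)%C).
      assert (Cf : forall x : R, ccont f x).
      { intros z; unfold f. apply ccont_plus; [apply ccont_mult; [apply ccont_const|apply C0] | apply C3]. }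
      assert (X : is_CInt_inf f (- F 0)%C).
      { apply is_CInt_inf_FTC with (K := L4) (a := 1 / 2); auto. lra.
        - intros z Hz. eapply cder_eq. apply cder_scal. apply cder_ray_fun; auto.
          assert (W := dir_neq0 d Hd b' z Hb').
          fold p. unfold f, theta_b, p, mkpt, pS, pZ, pC; simpl.
          transitivity (ray_fun weight1 d (s, b', RtoC 1) z * (d + d * d * s / (b' + d * z)))%C. field; auto.
          rewrite (dir_sq d Hd). field. auto.
        - intros r Hr. unfold F. rewrite Cmod_mult, Cmod_opp, dir_mod, Rmult_1_l by auto. apply E4; auto. }
      assert (Y : is_CInt_inf f (d * ray d p + CInt_inf (fun r => ray_fun weight1 d p r * theta_b d p r))%C).
      { unfold f. apply is_CInt_inf_plus; auto.
        intros; apply ccont_mult; [apply ccont_const|apply C0].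
        apply is_CInt_inf_scal; auto. }
      rewrite (is_CInt_inf_unique _ _ _ Y X). unfold F, ray_fun, weight1, cpw, p, mkpt, pS, pZ, pC; simpl.
      replace (b' + d * 0)%C with b' by ring.
      replace (- (1 * 0) - s * Clog b')%C with (- s * Clog b')%C by ring. ring. }
    eapply cder_eq. apply cder_mult. apply cder_exp. apply cder_line. apply HT. cbv beta.
    fold b'. fold p.
    transitivity (cexp (x * d) * (d * ray d p + CInt_inf (fun r => ray_fun weight1 d p r * theta_b d p r)))%C. ring.
    rewrite Key. unfold cpw, strip_fun. rewrite Rabs_right by lra. fold b'.
    replace (d * x - s * Clog b')%C with (x * d + - s * Clog b')%C by ring. rewrite cexp_plus. ring. }
  assert (CU := fun x : R => ccont_strip_fun s b d x Hb).
  assert (E := CInt_FTC A _ 0 1 Rle_0_1 Hder).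
  rewrite CInt_scal in E by (intros; apply CU).
  transitivity (- (d * CInt (strip_fun s b d) 0 1))%C. 2: ring. rewrite E.
  2: { intros x. apply ccont_mult. apply ccont_const. apply CU. }
  unfold A. replace (0 * d)%C with (RtoC 0) by ring. replace (1 * d)%C with d by ring. replace (b + 0)%C with b by ring.
  rewrite cexp_0. ring.
Qed.

(** The right side sees [m] only through [cexp m], so the identity holds on every branch of [log y].
    At [m = 0] it is [ray_shift1]; from there it is propagated along [t m], where multiplying by
    [e^(d b y) y^(1-s)] turns the left side into a difference of two primitives [ray_prim]. *)
Lemma ray_cont_shift (d s b m : C) : unit_dir d -> 0 < fst b ->
  (ray_cont d (mkpt s b m) - cexp (d * cexp m) * ray_cont d (mkpt s (b + 1) m) = - d * CInt (strip_fun s b (d * cexp m)) 0 1)%C.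
Proof.
  intros Hd Hb.
  assert (CL1 := fun x : R => ccont_Clog_abs b x Hb).
  assert (CA := ccont_Rabs).
  (* [W y] is the integrand of the right side times [e^(d b y)], so that [b] enters the exponent in
     the same way as in [ray_prim_fun]. *)
  set (W := fun (y : C) (u : R) => cexp (d * y * (b + RtoC (Rabs u)) - s * Clog (b + RtoC (Rabs u)))%C).
  assert (CW : forall y, forall x : R, ccont (W y) x) by (intros y; unfold W; intros; cc).
  set (Bf := fun t : R => (cexp ((1 - s) * (t * m)) * CInt (W (cexp (t * m))) 0 1)%C).
  assert (Hder : forall t, 0 <= t <= 1 -> cder Bf t
     (cpw (1 - s) (b + 1) * ray_prim_fun d (mkpt s (b + 1)%C m) t - cpw (1 - s) b * ray_prim_fun d (mkpt s b m) t)%C).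
  { intros t Ht. set (y := cexp (t * m)%C).
    assert (HI : cder (fun x : R => CInt (W (cexp (x * m))) 0 1) t
        (CInt (fun u => (W y u * (d * (y * m) * (b + RtoC (Rabs u))))%C) 0 1)).
    { eapply cder_eq.
      apply (fdiff_cder (fun q => CInt (fun u => W (cexp (pS q * m)) u) 0 1) t 0 0).
      apply (ufdiff_CInt (fun u q => W (cexp (pS q * m)) u)).
      - unfold W.
        assert (BA : exists B, forall u, 0 <= u <= 1 -> Cmod (b + RtoC (Rabs u))%C <= B).
        { destruct (ccont_bounded (fun u : R => (b + RtoC (Rabs u))%C) 0 1 Rle_0_1) as [B [_ HB]]. intros; cc. exists B; exact HB. }
        assert (BC : exists B, forall u, 0 <= u <= 1 -> Cmod (- (s * Clog (b + RtoC (Rabs u))))%C <= B).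
        { destruct (ccont_bounded (fun u : R => (- (s * Clog (b + RtoC (Rabs u))))%C) 0 1 Rle_0_1) as [B [_ HB]]. intros; cc. exists B; exact HB. }
        apply (ufdiff_exp _ _ (fun u q => (d * cexp (pS q * m) * (b + RtoC (Rabs u)) + - (s * Clog (b + RtoC (Rabs u))))%C)).
        apply ufdiff_plus.
        + apply ufdiff_mult. apply ufdiff_mult. apply ufdiff_const. exists (Cmod d). intros; lra.
          apply ufdiff_exp. apply ufdiff_mult. apply ufdiff_S. apply ufdiff_const. exists (Cmod m); intros; lra.
          apply ufdiff_const. exact BA.
        + apply ufdiff_const. exact BC.
      - intros; apply CW.
      - intros. cc.
      - cbv beta. apply CInt_ext. intros u _. unfold W, y, mkpt, pS; simpl. unfold Cminus. ring. }
    (* The integrand is the exact [u]-derivative of [e^(d y (b + u)) (b + u)^(1-s)]. Its two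
       boundary values are the integrands of the primitives at [b + 1] and at [b]. *)
    assert (HG : CInt (fun u => (W y u * (d * y * (b + RtoC (Rabs u)) + (1 - s)))%C) 0 1 =
       (cexp (d * y * (b + 1)) * cpw (1 - s) (b + 1) - cexp (d * y * b) * cpw (1 - s) b)%C).
    { assert (CWy := CW y).
      rewrite (CInt_FTC (fun u : R => (cexp (d * y * (b + u) + (1 - s) * Clog (b + u)))%C)).
      - replace (b + 0)%C with b by ring. unfold cpw. rewrite !cexp_plus. reflexivity.
      - lra.
      - intros u Hu. assert (Hp : 0 < fst (b + u)%C) by (simpl; lra).
        assert (Hp0 : (b + u)%C <> 0) by (apply Cmod_neq0, Cmod_pos_fst; auto).
        eapply cder_eq. apply cder_exp. apply cder_plus. apply cder_scal. apply cder_plus. apply cder_const. apply cder_id.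
        apply cder_scal. apply cder_Clog. auto. apply cder_plus. apply cder_const. apply cder_id.
        cbv beta. unfold W. rewrite Rabs_right by lra.
        replace (d * y * (b + u) + (1 - s) * Clog (b + u))%C with ((d * y * (b + u) - s * Clog (b + u)) + Clog (b + u))%C by ring.
        rewrite (cexp_plus _ (Clog _)), cexp_Clog by auto. field. auto.
      - intros; cc. }
    eapply cder_eq. apply cder_mult. apply cder_exp. apply cder_scal. apply cder_line. apply HI. cbv beta.
    fold y.
    assert (CWy := CW y).
    transitivity (m * cexp ((1 - s) * (t * m)) * CInt (fun u => (W y u * (d * y * (b + RtoC (Rabs u)) + (1 - s)))%C) 0 1)%C.
    - rewrite <- !Cmult_assoc. rewrite <- !CInt_scal by (intros; cc). rewrite <- CInt_plus by (intros; cc).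
      apply CInt_ext. intros u _. ring.
    - rewrite HG. unfold ray_prim_fun, mkpt, pS, pZ, pC; simpl. fold y. rewrite !cexp_plus.
      replace (d * y * (b + 1))%C with (d * (b + 1) * y)%C by ring. replace (d * y * b)%C with (d * b * y)%C by ring. ring. }
  assert (CV1 := fun x : R => ccont_ray_prim_fun d (mkpt s (b + 1)%C m) x). assert (CV2 := fun x : R => ccont_ray_prim_fun d (mkpt s b m) x).
  assert (E := CInt_FTC Bf _ 0 1 Rle_0_1 Hder).
  rewrite CInt_minus, !CInt_scal in E by (intros; cc).
  specialize (E ltac:(intros; cc)).
  assert (T1 := ray_shift1 d s b Hd Hb).
  assert (CU := fun w => fun x : R => ccont_strip_fun s b w x Hb).
  assert (B0 : Bf 0 = (cexp (d * b) * CInt (strip_fun s b d) 0 1)%C).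
  { unfold Bf. replace (0 * m)%C with (RtoC 0) by ring. replace ((1 - s) * 0)%C with (RtoC 0) by ring. rewrite cexp_0.
    assert (CU1 := CU d). rewrite <- (CInt_scal _ (strip_fun s b d)) by (intros; cc). rewrite Cmult_1_l. apply CInt_ext. intros u. rewrite Rmin_left, Rmax_right by lra. intros Hu.
    unfold W, strip_fun. rewrite <- cexp_plus. f_equal. rewrite Rabs_right by lra. ring. }
  assert (B1 : Bf 1 = (cexp ((1 - s) * m) * (cexp (d * b * cexp m) * CInt (strip_fun s b (d * cexp m)) 0 1))%C).
  { unfold Bf. replace (1 * m)%C with m by ring. f_equal.
    assert (CU1 := CU (d * cexp m)%C). rewrite <- (CInt_scal _ (strip_fun s b (d * cexp m)%C)) by (intros; cc). apply CInt_ext. intros u. rewrite Rmin_left, Rmax_right by lra. intros Hu.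
    unfold W, strip_fun. rewrite <- cexp_plus. f_equal. rewrite Rabs_right by lra. ring. }
  rewrite B0, B1 in E.
  unfold ray_cont, mkpt, pS, pZ, pC in *; simpl in *. unfold ray_prim.
  set (V1 := CInt (ray_prim_fun d (s, b + 1, m)%C) 0 1) in *. set (V0 := CInt (ray_prim_fun d (s, b, m)) 0 1) in *.
  set (T10 := ray d (s, b, RtoC 1)) in *. set (T11 := ray d (s, (b + 1)%C, RtoC 1)) in *.
  set (U1 := CInt (strip_fun s b (d * cexp m)) 0 1) in *. set (U0 := CInt (strip_fun s b d) 0 1) in *.
  assert (ET : T10 = (cexp d * T11 - d * U0)%C).
  { replace T10 with ((T10 - cexp d * T11) + cexp d * T11)%C by ring. rewrite T1. ring. }
  rewrite ET.
  set (y := cexp m) in *.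
  replace (- (d * (b + 1) * y) + (s - 1) * m)%C with ((- (d * b * y) + (s - 1) * m) - d * y)%C by ring.
  rewrite (cexp_minus _ (d * y)%C).
  replace (d * (b + 1))%C with (d * b + d)%C by ring. rewrite (cexp_plus (d * b) d)%C.
  set (ee := cexp (- (d * b * y) + (s - 1) * m)%C).
  assert (EE : (ee * (cexp ((1 - s) * m) * cexp (d * b * y)) = 1)%C).
  { unfold ee. rewrite <- !cexp_plus. rewrite <- cexp_0. f_equal. ring. }
  assert (N := cexp_neq0 (d * y)%C).
  transitivity (- d * ee * ((cpw (1 - s) (b + 1) * V1 - cpw (1 - s) b * V0) + cexp (d * b) * U0))%C.
  { field. auto. }
  rewrite E.
  transitivity (- d * (ee * (cexp ((1 - s) * m) * cexp (d * b * y))) * U1)%C. ring.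
  rewrite EE. ring.
Qed.

(** * Holomorphy with the derivative left implicit *)

Definition hol (f : pt -> C) (p : pt) := exists D, fdiff f p D.
Lemma hol_const p a : hol (fun _ => a) p. Proof. eexists; apply fdiff_const. Qed.
Lemma hol_S p : hol pS p. Proof. eexists; apply fdiff_S. Qed.
Lemma hol_Z p : hol pZ p. Proof. eexists; apply fdiff_Z. Qed.
Lemma hol_C p : hol pC p. Proof. eexists; apply fdiff_C. Qed.
Lemma hol_plus f g p : hol f p -> hol g p -> hol (fun q => f q + g q)%C p.
Proof. intros [] []; eexists; apply fdiff_plus; eauto. Qed.
Lemma hol_minus f g p : hol f p -> hol g p -> hol (fun q => f q - g q)%C p.
Proof. intros [] []; eexists; apply fdiff_minus; eauto. Qed.
Lemma hol_opp f p : hol f p -> hol (fun q => - f q)%C p.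
Proof. intros []; eexists; apply fdiff_opp; eauto. Qed.
Lemma hol_mult f g p : hol f p -> hol g p -> hol (fun q => f q * g q)%C p.
Proof. intros [] []; eexists; apply fdiff_mult; eauto. Qed.
Lemma hol_exp f p : hol f p -> hol (fun q => cexp (f q)) p.
Proof. intros []; eexists; apply fdiff_exp; eauto. Qed.
Lemma hol_Clog f p : 0 < fst (f p) -> hol f p -> hol (fun q => Clog (f q)) p.
Proof. intros Hp []; eexists; apply fdiff_Clog; eauto. Qed.
Lemma hol_comp f g1 g2 g3 p : hol f (mkpt (g1 p) (g2 p) (g3 p)) -> hol g1 p -> hol g2 p -> hol g3 p ->
  hol (fun q => f (mkpt (g1 q) (g2 q) (g3 q))) p.
Proof. intros [] [] [] []; eexists; apply fdiff_comp; eauto. Qed.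
Lemma hol_local p f g r : 0 < r -> (forall h, nrm h < r -> f (padd p h) = g (padd p h)) -> hol f p -> hol g p.
Proof. intros Hr H [D HD]. exists D. eapply fdiff_local; eauto. Qed.
Lemma hol_pow f n p : hol f p -> hol (fun q => Cpow (f q) n) p.
Proof.
  intros H. induction n. exact (hol_const p (RtoC 1)). apply (hol_mult f (fun q => Cpow (f q) n)); auto.
Qed.

Lemma hol_ray_tail d p : unit_dir d -> 0 < fst (pZ p) -> 0 < fst (pC p) -> hol (ray_tail d) p.
Proof. intros. eexists. apply fdiff_ray_int; auto using weight_tail_weight. Qed.
Lemma hol_ray d p : unit_dir d -> 0 < fst (pZ p) -> 0 < fst (pC p) -> hol (ray d) p.
Proof. intros. eexists. apply fdiff_ray_int; auto using weight_one. Qed.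

Lemma hol_ray_prim d p : hol (ray_prim d) p.
Proof.
  unfold ray_prim.
  assert (BI : exists B, forall t, 0 <= t <= 1 -> Cmod (RtoC t) <= B).
  { exists 1. intros t Ht. rewrite Cmod_R, Rabs_right; lra. }
  eexists. apply (ufdiff_CInt (fun t q => ray_prim_fun d q t)).
  - unfold ray_prim_fun. apply ufdiff_mult. apply ufdiff_C. apply ufdiff_exp. apply ufdiff_plus.
    + apply ufdiff_mult.
      * apply (ufdiff_plus _ _ (fun _ _ => RtoC 1) (fun _ q => - pS q)%C). apply ufdiff_const. exists (Cmod 1); intros; lra.
        apply (ufdiff_ext _ _ (fun _ q => RtoC (-1) * pS q)%C (fun _ q => - pS q)%C (fun _ h => pS p * 0 + RtoC (-1) * pS h)%C (fun _ h => - pS h)%C).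
        intros; ring. intros; ring.
        apply (ufdiff_mult _ _ (fun _ _ => RtoC (-1)) (fun _ => pS) (fun _ _ => RtoC 0) (fun _ => pS)). apply ufdiff_const. exists (Cmod (RtoC (-1))); intros; lra. apply ufdiff_S.
      * apply ufdiff_mult. apply (ufdiff_const _ _ RtoC). exact BI. apply ufdiff_C.
    + apply ufdiff_mult. apply ufdiff_mult. apply ufdiff_const. exists (Cmod d); intros; lra. apply ufdiff_Z.
      apply ufdiff_exp. apply ufdiff_mult. apply (ufdiff_const _ _ RtoC). exact BI. apply ufdiff_C.
  - intros; apply ccont_ray_prim_fun.
  - intros. cc.
Qed.

Lemma hol_ray_cont d p : unit_dir d -> 0 < fst (pZ p) -> hol (ray_cont d) p.
Proof.
  intros Hd Hb. unfold ray_cont. apply hol_mult.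
  - apply hol_exp. apply hol_plus. apply hol_opp. apply hol_mult. apply hol_mult. apply hol_const. apply hol_Z. apply hol_exp, hol_C.
    apply hol_mult. apply hol_minus. apply hol_S. apply hol_const. apply hol_C.
  - apply hol_plus. apply hol_mult. apply hol_exp. apply hol_mult. apply hol_const. apply hol_Z.
    apply (hol_comp (ray d) pS pZ (fun _ => RtoC 1)). apply hol_ray; auto. simpl; lra. apply hol_S. apply hol_Z. apply hol_const.
    apply hol_mult. apply hol_mult. apply hol_const. unfold cpw. apply hol_exp. apply hol_mult. apply hol_minus. apply hol_const. apply hol_S.
    apply hol_Clog; auto. apply hol_Z. apply hol_ray_prim.
Qed.

(** * The reflected sum and its shift identity *)

Definition dir (e : bool) : C := if e then Ci else (- Ci)%C.
Lemma dir_unit e : unit_dir (dir e).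
Proof. destruct e; [left|right]; reflexivity. Qed.

Fixpoint csum (f : nat -> C) (n : nat) : C :=
  match n with O => RtoC 0 | S m => (csum f m + f m)%C end.
Lemma csum_S f n : csum f (S n) = (csum f n + f n)%C.
Proof. reflexivity. Qed.
Lemma csum_ext f g n : (forall m, (m < n)%nat -> f m = g m) -> csum f n = csum g n.
Proof. induction n; intros H; simpl; auto. rewrite IHn, H; auto. Qed.
Lemma csum_le f n K : (forall m, (m < n)%nat -> Cmod (f m) <= K) -> Cmod (csum f n) <= INR n * K.
Proof.
  induction n; intros H. simpl. rewrite Cmod_0; lra.
  change (csum f (S n)) with (csum f n + f n)%C.
  rewrite S_INR. eapply Rle_trans. apply Cmod_triangle. specialize (IHn ltac:(auto)). specialize (H n ltac:(lia)). lra.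
Qed.
Lemma csum_const a n : csum (fun _ => a) n = (RtoC (INR n) * a)%C.
Proof. induction n. simpl; ring. rewrite S_INR, RtoC_plus. change (csum (fun _ => a) (S n)) with (csum (fun _ => a) n + a)%C. rewrite IHn. ring. Qed.

Definition alt_sign (m : nat) : C := Cpow (- (1)) m.
Lemma alt_sign_S m : alt_sign (S m) = (- alt_sign m)%C.
Proof. unfold alt_sign. rewrite Cpow_S. ring. Qed.
Lemma alt_sign_mod m : Cmod (alt_sign m) = 1.
Proof. unfold alt_sign. rewrite Cmod_pow, Cmod_opp, Cmod_1. apply pow1. Qed.

(* The zeros of the [ybr e m] are the logarithms of [-1], hence lie over the puncture [z = 1]. *)
Definition ybr (e : bool) (m : nat) (M : C) : C := (RtoC ((2 * INR m + 1) * PI) - dir e * M)%C.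

(* The [J] leading terms are continued separately, each along its own logarithm [mu m] of [ybr e m M]. *)
Definition dir_sum (e : bool) (J : nat) (s b M : C) (mu : nat -> C) : C :=
  (csum (fun m => alt_sign m * ray_cont (dir e) (mkpt s b (mu m))) J + alt_sign J * ray_tail (dir e) (mkpt s b (ybr e J M)))%C.
(** At [J = 0] the two tails are the halves [r > 0] and [r < 0] of the Lindelof integral, because
    [e^(-PI r) tail_weight r = 1 / (2 cosh (PI r))]. *)
Definition Phi_half (J : nat) (s b M : C) (mu : bool -> nat -> C) : C :=
  (dir_sum true J s b M (mu true) + dir_sum false J s b M (mu false))%C.

(** From [J0] on a continued term coincides with its convergent integral, so that moving it between
    the sum and the tail does not change [Phi_half]. *)
Definition principal_mu (M : C) (mu : bool -> nat -> C) (J0 : nat) :=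
  forall e m, (J0 <= m)%nat -> 0 < fst (ybr e m M) /\ mu e m = Clog (ybr e m M).

Lemma dir_sum_step e J s b M mu : 0 < fst b -> 0 < fst (ybr e J M) -> mu J = Clog (ybr e J M) ->
  dir_sum e (S J) s b M mu = dir_sum e J s b M mu.
Proof.
  intros Hb Hy Hm. unfold dir_sum. simpl csum. rewrite alt_sign_S, Hm.
  rewrite ray_cont_eq by first [apply dir_unit | exact Hb | apply Clog_im]. rewrite cexp_Clog by auto.
  rewrite <- ray_tail_step by first [apply dir_unit | assumption].
  replace (ybr e (S J) M) with (ybr e J M + RtoC (2 * PI))%C. ring.
  unfold ybr. rewrite S_INR. replace ((2 * (INR J + 1) + 1) * PI) with ((2 * INR J + 1) * PI + 2 * PI) by ring.
  rewrite (RtoC_plus (_ * _)). ring.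
Qed.
Lemma Phi_half_indep J0 J s b M mu : 0 < fst b -> principal_mu M mu J0 -> (J0 <= J)%nat -> Phi_half J s b M mu = Phi_half J0 s b M mu.
Proof.
  intros Hb Hp HJ. induction HJ as [|m HJ IHHJ]. reflexivity. rewrite <- IHHJ. unfold Phi_half.
  destruct (Hp true m HJ). destruct (Hp false m HJ). rewrite !dir_sum_step by assumption. reflexivity.
Qed.

(** * Dirichlet and Fejer kernels centred at the midpoint of [0,1] *)

Fixpoint dirichlet (J : nat) (u : R) : R :=
  match J with O => 0 | S m => dirichlet m u + 2 * (-1) ^ m * sin ((2 * INR m + 1) * PI * u) end.

(** After [RInt_ext] the equation is stated in the carrier of a normed module, where [ring] does not
    recognize the real numbers. *)
Ltac eqR := match goal with |- @eq _ ?a ?b => change (@eq R a b) end.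

Fixpoint rsum (f : nat -> R) (n : nat) : R := match n with O => 0 | S m => rsum f m + f m end.
(* Divided by [n] this is a Fejer-type kernel centred at [1/2]. *)
Definition dirichlet_sum (n : nat) (u : R) : R := rsum (fun i => dirichlet (n + i) u) n.

Lemma cos_mPI m a : cos (a + INR m * PI) = (-1) ^ m * cos a.
Proof.
  induction m. simpl. rewrite Rmult_0_l, Rplus_0_r. ring.
  rewrite S_INR. replace (a + (INR m + 1) * PI) with (a + INR m * PI + PI) by ring.
  rewrite neg_cos, IHm. simpl. ring.
Qed.
Lemma m1_sq m : (-1) ^ m * (-1) ^ m = 1.
Proof. rewrite <- Rpow_mult_distr. replace (-1 * -1) with 1 by ring. apply pow1. Qed.
Lemma sin_shift m v : (-1) ^ m * sin ((2 * INR m + 1) * PI * (v + 1 / 2)) = cos ((2 * INR m + 1) * PI * v).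
Proof.
  replace ((2 * INR m + 1) * PI * (v + 1 / 2)) with (PI / 2 + ((2 * INR m + 1) * PI * v + INR m * PI)) by field.
  rewrite <- cos_sin, cos_mPI, <- Rmult_assoc, m1_sq. ring.
Qed.
(** By [sin_shift] the terms are [2 cos ((2m+1) PI v)], with [v] the distance from the midpoint.
    Times [sin (PI v)] each becomes a difference of two sines, and the sum telescopes to the closed
    form of a Dirichlet kernel. *)
Lemma dirichlet_kernel J v : dirichlet J (v + 1 / 2) * sin (PI * v) = sin (2 * INR J * PI * v).
Proof.
  induction J. simpl. rewrite Rmult_0_r, !Rmult_0_l, sin_0. ring.
  simpl dirichlet. rewrite Rmult_plus_distr_r, IHJ.
  replace (2 * (-1) ^ J) with (2 * 1 * (-1) ^ J) by ring. rewrite (Rmult_assoc (2 * 1)), sin_shift, S_INR.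
  replace (2 * INR J * PI * v) with ((2 * INR J + 1) * PI * v - PI * v) by ring.
  replace (2 * (INR J + 1) * PI * v) with ((2 * INR J + 1) * PI * v + PI * v) by ring.
  rewrite sin_minus, sin_plus. ring.
Qed.
Lemma dirichlet_sum_bound1 n v : Rabs (dirichlet_sum n (v + 1 / 2) * sin (PI * v)) <= INR n.
Proof.
  unfold dirichlet_sum. assert (H : forall k, Rabs (rsum (fun i => dirichlet (n + i) (v + 1 / 2)) k * sin (PI * v)) <= INR k).
  { induction k. simpl. rewrite Rmult_0_l, Rabs_R0; lra.
    simpl rsum. rewrite Rmult_plus_distr_r, dirichlet_kernel, S_INR. eapply Rle_trans. apply Rabs_triang.
    assert (Rabs (sin (2 * INR (n + k) * PI * v)) <= 1) by (apply Rabs_le, SIN_bound). lra. }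
  apply H.
Qed.
(** A second factor [sin (PI v)] makes the sum over [J] telescope too, into two cosines. The bound
    does not grow with [n]: this decay off the midpoint is the gain from averaging. *)
Lemma dirichlet_sum_bound2 n v : Rabs (dirichlet_sum n (v + 1 / 2) * sin (PI * v) * sin (PI * v)) <= 1.
Proof.
  unfold dirichlet_sum. assert (H : forall k, 2 * (rsum (fun i => dirichlet (n + i) (v + 1 / 2)) k * sin (PI * v) * sin (PI * v)) =
     cos ((2 * INR n - 1) * PI * v) - cos ((2 * INR (n + k) - 1) * PI * v)).
  { induction k. simpl. rewrite Nat.add_0_r. ring.
    simpl rsum. rewrite 2!Rmult_plus_distr_r, dirichlet_kernel, Rmult_plus_distr_l, IHk.
    rewrite Nat.add_succ_r, S_INR.
    replace ((2 * (INR (n + k) + 1) - 1) * PI * v) with (2 * INR (n + k) * PI * v + PI * v) by ring.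
    replace ((2 * INR (n + k) - 1) * PI * v) with (2 * INR (n + k) * PI * v - PI * v) by ring.
    rewrite cos_plus, cos_minus. ring. }
  specialize (H n). assert (X := COS_bound ((2 * INR n - 1) * PI * v)). assert (Y := COS_bound ((2 * INR (n + n) - 1) * PI * v)).
  apply Rabs_le. lra.
Qed.

(** Jordan's inequality. It converts the factors [sin (PI v)] in the kernel bounds into powers of
    the distance from the midpoint. *)
Lemma sin_lower v : 0 <= v <= 1 / 2 -> 2 * v <= sin (PI * v).
Proof.
  intros Hv. assert (HP := PI_RGT_0).
  destruct (Req_dec v 0) as [Z|Z]. subst. replace (PI * 0) with 0 by ring; rewrite sin_0; lra.
  destruct (Req_dec v (1/2)) as [Z2|Z2]. subst. replace (PI * (1/2)) with (PI / 2) by field. rewrite sin_PI2; lra.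
  (* concavity: the slope on [0, v] is at least the slope on [v, 1/2] *)
  destruct (MVT_cor2 (fun x => sin (PI * x)) (fun x => PI * cos (PI * x)) 0 v) as [c1 [E1 B1]]. lra.
  { intros c _. apply is_derive_Reals. auto_derive; auto. ring. }
  destruct (MVT_cor2 (fun x => sin (PI * x)) (fun x => PI * cos (PI * x)) v (1/2)) as [c2 [E2 B2]]. lra.
  { intros c _. apply is_derive_Reals. auto_derive; auto. ring. }
  rewrite Rmult_0_r, sin_0 in E1. replace (PI * (1/2)) with (PI / 2) in E2 by field. rewrite sin_PI2 in E2.
  assert (cos (PI * c2) <= cos (PI * c1)). { apply cos_decr_1; nra. }
  assert (PI * cos (PI * c2) <= PI * cos (PI * c1)) by (apply Rmult_le_compat_l; lra).
  set (A := PI * cos (PI * c1)) in *. set (B := PI * cos (PI * c2)) in *.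
  assert (B * (1 / 2 - v) <= A * (1 / 2 - v)) by (apply Rmult_le_compat_r; lra).
  assert (2 <= A) by lra. assert (2 * v <= A * v) by (apply Rmult_le_compat_r; lra). lra.
Qed.
Lemma sin_lower_abs v : - (1 / 2) <= v <= 1 / 2 -> 2 * Rabs v <= Rabs (sin (PI * v)).
Proof.
  intros Hv. destruct (Rle_dec 0 v).
  - rewrite (Rabs_right v) by lra. eapply Rle_trans. apply sin_lower; lra. apply Rle_abs.
  - rewrite (Rabs_left v) by lra. assert (X := sin_lower (- v) ltac:(lra)).
    replace (PI * - v) with (- (PI * v)) in X by ring. rewrite sin_neg in X. eapply Rle_trans. apply X. rewrite <- Rabs_Ropp. apply Rle_abs.
Qed.
Lemma dirichlet_sum_bound1' n u : 0 <= u <= 1 -> Rabs (dirichlet_sum n u) * Rabs (u - 1 / 2) <= INR n / 2.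
Proof.
  intros Hu. assert (X := dirichlet_sum_bound1 n (u - 1 / 2)). replace (u - 1 / 2 + 1 / 2) with u in X by ring.
  assert (Y := sin_lower_abs (u - 1 / 2) ltac:(lra)). rewrite Rabs_mult in X.
  assert (Z := Rabs_pos (dirichlet_sum n u)). nra.
Qed.
Lemma dirichlet_sum_bound2' n u : 0 <= u <= 1 -> Rabs (dirichlet_sum n u) * (Rabs (u - 1 / 2) * Rabs (u - 1 / 2)) <= / 4.
Proof.
  intros Hu. assert (X := dirichlet_sum_bound2 n (u - 1 / 2)). replace (u - 1 / 2 + 1 / 2) with u in X by ring.
  assert (Y := sin_lower_abs (u - 1 / 2) ltac:(lra)). rewrite !Rabs_mult in X.
  assert (Z := Rabs_pos (dirichlet_sum n u)). assert (Z2 := Rabs_pos (u - 1 / 2)).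
  assert (4 * (Rabs (u - 1 / 2) * Rabs (u - 1 / 2)) <= Rabs (sin (PI * (u - 1 / 2))) * Rabs (sin (PI * (u - 1 / 2)))) by nra.
  nra.
Qed.

Lemma dirichlet_cont J x : continuous (dirichlet J) x.
Proof.
  induction J. apply continuous_const.
  apply (cont_plus_R (dirichlet J) (fun u => 2 * (-1) ^ J * sin ((2 * INR J + 1) * PI * u))); auto.
  apply (ex_derive_continuous (fun u => 2 * (-1) ^ J * sin ((2 * INR J + 1) * PI * u))). auto_derive; auto.
Qed.
Lemma dirichlet_sum_cont n x : continuous (dirichlet_sum n) x.
Proof.
  unfold dirichlet_sum. generalize n at 2. intros k. induction k. apply continuous_const.
  apply (cont_plus_R (fun u => rsum (fun i => dirichlet (n + i) u) k) (dirichlet (n + k))); auto. apply dirichlet_cont.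
Qed.
Lemma ccont_dirichlet J (x : R) : ccont (fun u : R => RtoC (dirichlet J u)) x.
Proof. apply (ccont_RtoC (dirichlet J)). apply dirichlet_cont. Qed.
Lemma ccont_dirichlet_sum n (x : R) : ccont (fun u : R => RtoC (dirichlet_sum n u)) x.
Proof. apply (ccont_RtoC (dirichlet_sum n)). apply dirichlet_sum_cont. Qed.

Lemma RInt_cos_per m : (0 < m)%nat -> RInt (fun u => cos (2 * INR m * PI * u)) 0 1 = 0.
Proof.
  intros Hm. assert (HP := PI_RGT_0). apply lt_0_INR in Hm.
  apply is_RInt_unique.
  assert (E : 0 = minus (sin (2 * INR m * PI * 1) / (2 * INR m * PI)) (sin (2 * INR m * PI * 0) / (2 * INR m * PI))).
  { unfold minus, plus, opp; simpl. rewrite Rmult_0_r, sin_0, Rmult_1_r.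
    replace (2 * INR m * PI) with (0 + 2 * INR m * PI) at 1 by ring. rewrite sin_period, sin_0. field. nra. }
  rewrite E at 2.
  apply (is_RInt_derive (fun u => sin (2 * INR m * PI * u) / (2 * INR m * PI)) (fun u => cos (2 * INR m * PI * u)) 0 1).
  - intros x _. auto_derive; auto. field. nra.
  - intros x _. apply (ex_derive_continuous (fun u => cos (2 * INR m * PI * u))). auto_derive; auto.
Qed.
Lemma cont_ex_RInt (f : R -> R) a b : (forall x, continuous f x) -> ex_RInt f a b.
Proof. intros H. apply (ex_RInt_continuous (V := R_CompleteNormedModule)). intros z _; exact (H z). Qed.

(** In the product-to-sum expansion only the constant 1 from the first term survives integration
    over a period. The function [sin (PI u)], equal to 1 at the midpoint, thus normalizes the kernel
    exactly. *)
Lemma dirichlet_sin_int J : (1 <= J)%nat -> RInt (fun u => dirichlet J u * sin (PI * u)) 0 1 = 1.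
Proof.
  assert (HP := PI_RGT_0).
  assert (Cs : forall a x, continuous (fun u => cos (a * u)) x).
  { intros a x. apply (ex_derive_continuous (fun u => cos (a * u))). auto_derive; auto. }
  assert (Cn : forall x, continuous (fun u => sin (PI * u)) x).
  { intros x. apply (ex_derive_continuous (fun u => sin (PI * u))). auto_derive; auto. }
  assert (H : forall J, RInt (fun u => dirichlet (S J) u * sin (PI * u)) 0 1 = 1).
  { induction J0 as [|j IH].
    - rewrite (RInt_ext _ (fun u => 1 - cos (2 * INR 1 * PI * u))).
      + rewrite RInt_minus_R, RInt_cos_per, RInt_const by (try lia; apply cont_ex_RInt; auto using continuous_const).
        unfold scal; simpl; unfold mult; simpl. ring.
      + intros x _. simpl. replace (2 * 1 * PI * x) with (2 * (PI * x)) by ring. rewrite cos_2a_sin.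
        replace ((2 * 0 + 1) * PI * x) with (PI * x) by ring. ring.
    - transitivity (RInt (fun u => dirichlet (S j) u * sin (PI * u) + (-1) ^ (S j) * (cos (2 * INR (S j) * PI * u) - cos (2 * INR (S (S j)) * PI * u))) 0 1).
      { apply RInt_ext. intros x _. eqR. change (dirichlet (S (S j)) x) with (dirichlet (S j) x + 2 * (-1) ^ (S j) * sin ((2 * INR (S j) + 1) * PI * x)).
        rewrite (S_INR (S j)).
        replace (2 * INR (S j) * PI * x) with ((2 * INR (S j) + 1) * PI * x - PI * x) by ring.
        replace (2 * (INR (S j) + 1) * PI * x) with ((2 * INR (S j) + 1) * PI * x + PI * x) by ring.
        rewrite cos_minus, cos_plus. ring. }
      assert (E1 : forall m, ex_RInt (fun u => cos (2 * INR m * PI * u)) 0 1) by (intros; apply cont_ex_RInt; intros; apply Cs).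
      assert (E2 : ex_RInt (fun u => cos (2 * INR (S j) * PI * u) - cos (2 * INR (S (S j)) * PI * u)) 0 1).
      { apply cont_ex_RInt. intros x. apply (cont_minus_R (fun u => cos (2 * INR (S j) * PI * u)) (fun u => cos (2 * INR (S (S j)) * PI * u))); apply Cs. }
      assert (E3 : ex_RInt (fun u => dirichlet (S j) u * sin (PI * u)) 0 1).
      { apply cont_ex_RInt. intros x. apply (cont_mult_R (dirichlet (S j)) (fun u => sin (PI * u))); [apply dirichlet_cont|apply Cn]. }
      rewrite (RInt_plus_R _ _ 0 1 E3 (ex_RInt_scal_R _ 0 1 _ E2)), IH, (RInt_scal_R _ 0 1 _ E2), (RInt_minus_R _ _ 0 1 (E1 _) (E1 _)).
      rewrite !RInt_cos_per by lia. rewrite Rminus_0_r, Rmult_0_r, Rplus_0_r. reflexivity. }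
  intros HJ. destruct J. lia. apply H.
Qed.

Lemma dirichlet_sum_sin_int n : (1 <= n)%nat -> CInt (fun u => RtoC (dirichlet_sum n u * sin (PI * u))) 0 1 = RtoC (INR n).
Proof.
  intros Hn.
  assert (Cn : forall x, continuous (fun u => sin (PI * u)) x).
  { intros x. apply (ex_derive_continuous (fun u => sin (PI * u))). auto_derive; auto. }
  apply C_eq; unfold CInt; simpl.
  2: { rewrite RInt_const. unfold scal; simpl; unfold mult; simpl. ring. }
  unfold dirichlet_sum. assert (H : forall k, (forall x, continuous (fun u => rsum (fun i => dirichlet (n + i) u) k) x) /\
    RInt (fun x => rsum (fun i => dirichlet (n + i) x) k * sin (PI * x)) 0 1 = INR k).
  { induction k as [|k [IHc IH]].
    - split. intros; apply continuous_const. simpl rsum. rewrite (RInt_ext _ (fun _ => 0)). rewrite RInt_const. unfold scal; simpl; unfold mult; simpl. ring.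
      intros; eqR; ring.
    - split. intros x. apply (cont_plus_R (fun u => rsum (fun i => dirichlet (n + i) u) k) (dirichlet (n + k))); auto. apply dirichlet_cont.
      assert (E1 : ex_RInt (fun x => rsum (fun i => dirichlet (n + i) x) k * sin (PI * x)) 0 1).
      { apply cont_ex_RInt. intros. apply (cont_mult_R (fun u => rsum (fun i => dirichlet (n + i) u) k)); auto. }
      assert (E2 : ex_RInt (fun x => dirichlet (n + k) x * sin (PI * x)) 0 1).
      { apply cont_ex_RInt. intros. apply (cont_mult_R (dirichlet (n + k))); auto using dirichlet_cont. }
      transitivity (RInt (fun x => rsum (fun i => dirichlet (n + i) x) k * sin (PI * x) + dirichlet (n + k) x * sin (PI * x)) 0 1).
      { apply RInt_ext. intros x _. eqR. simpl. ring. }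
      rewrite (RInt_plus_R _ _ 0 1 E1 E2), IH, dirichlet_sin_int, S_INR by lia. reflexivity. }
  apply H.
Qed.

(** Subtracting [k (1/2) sin (PI u)] leaves a function bounded by [B |u - 1/2|]. Within [eps] of the
    midpoint the first kernel bound gives an integrand of order [n], outside the second gives order
    [/ eps]. [k2] stands beside [k] because [strip_fun] contains [Rabs u]: it is continuous on the
    line but need not be differentiable at 0, while the derivative is taken on the closed
    interval. *)
Lemma fejer (k k2 dk : R -> C) : (forall x : R, ccont k x) -> (forall x : R, ccont dk x) ->
  (forall u, 0 <= u <= 1 -> k2 u = k u) -> (forall u, 0 <= u <= 1 -> cder k2 u (dk u)) ->
  exists C0, 0 <= C0 /\ forall n eps, (1 <= n)%nat -> 0 < eps < 1 / 2 ->
   Cmod (CInt (fun u => RtoC (dirichlet_sum n u) * k u)%C 0 1 - RtoC (INR n) * k (1/2)%R)%C <= C0 * (INR n * eps + / eps).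
Proof.
  intros Ck Cdk Hk2 Hk.
  set (p := fun u => (k u - k (1/2)%R * RtoC (sin (PI * u)))%C).
  set (p2 := fun u => (k2 u - k (1/2)%R * RtoC (sin (PI * u)))%C).
  assert (Ep : forall u, 0 <= u <= 1 -> p2 u = p u) by (intros; unfold p, p2; rewrite Hk2; auto).
  set (dp := fun u => (dk u - k (1/2)%R * RtoC (PI * cos (PI * u)))%C).
  assert (Cn : forall x : R, ccont (fun u : R => RtoC (sin (PI * u))) x).
  { intros x. apply (ccont_RtoC (fun u => sin (PI * u))). apply (ex_derive_continuous (fun u => sin (PI * u))). auto_derive; auto. }
  assert (Cc : forall x : R, ccont (fun u : R => RtoC (PI * cos (PI * u))) x).
  { intros x. apply (ccont_RtoC (fun u => PI * cos (PI * u))). apply (ex_derive_continuous (fun u => PI * cos (PI * u))). auto_derive; auto. }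
  assert (Cp : forall x : R, ccont p x) by (unfold p; intros; cc).
  assert (Cdp : forall x : R, ccont dp x) by (unfold dp; intros; cc).
  assert (Hp : forall u, 0 <= u <= 1 -> cder p2 u (dp u)).
  { intros u Hu. apply cder_minus. apply Hk; auto. apply cder_scal.
    split; simpl. auto_derive; auto. ring. apply is_derive_const_R. }
  destruct (ccont_bounded dp 0 1 Rle_0_1 Cdp) as [B [HB0 HB]].
  assert (p12 : p (1/2) = 0).
  { unfold p. replace (PI * (1/2)) with (PI/2) by field. rewrite sin_PI2. ring. }
  assert (Lp : forall u, 0 <= u <= 1 -> Cmod (p u) <= B * Rabs (u - 1/2)).
  { intros u Hu. destruct (Rle_dec (1/2) u).
    - assert (X := cmvt p2 dp B (1/2) u r ltac:(intros; apply Hp; lra) ltac:(intros; apply HB; lra)).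
      rewrite !Ep, p12 in X by lra. rewrite Rabs_right by lra. replace (p u - 0)%C with (p u) in X by ring. lra.
    - assert (X := cmvt p2 dp B u (1/2) ltac:(lra) ltac:(intros; apply Hp; lra) ltac:(intros; apply HB; lra)).
      rewrite !Ep, p12 in X by lra. rewrite Rabs_left by lra. replace (0 - p u)%C with (- p u)%C in X by ring. rewrite Cmod_opp in X. lra. }
  exists B. split; auto. intros n eps Hn He.
  assert (CA := ccont_dirichlet_sum n).
  replace (CInt (fun u => RtoC (dirichlet_sum n u) * k u)%C 0 1 - RtoC (INR n) * k (1/2)%R)%C with (CInt (fun u => RtoC (dirichlet_sum n u) * p u)%C 0 1).
  2: { rewrite <- (dirichlet_sum_sin_int n Hn).
       replace (CInt (fun u => RtoC (dirichlet_sum n u * sin (PI * u))) 0 1) with (CInt (fun u => RtoC (dirichlet_sum n u) * RtoC (sin (PI * u)))%C 0 1).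
       2: { apply CInt_ext. intros; rewrite RtoC_mult; auto. }
       rewrite (Cmult_comm (CInt _ _ _) (k (1/2)%R)). rewrite <- CInt_scal by (intros; cc).
       rewrite <- CInt_minus by (intros; cc). apply CInt_ext. intros u _. unfold p. ring. }
  set (g := fun u => (RtoC (dirichlet_sum n u) * p u)%C).
  assert (Cg : forall x : R, ccont g x) by (unfold g; intros; cc).
  rewrite <- (CInt_Chasles g 0 (1/2 - eps) 1 Cg). rewrite <- (CInt_Chasles g (1/2 - eps) (1/2 + eps) 1 Cg).
  assert (Hin : forall u, 0 <= u <= 1 -> Cmod (g u) <= B * (INR n / 2)).
  { intros u Hu. unfold g. rewrite Cmod_mult, Cmod_R. specialize (Lp u Hu). assert (X := dirichlet_sum_bound1' n u Hu).
    assert (Z := Rabs_pos (dirichlet_sum n u)).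
    apply Rle_trans with (Rabs (dirichlet_sum n u) * (B * Rabs (u - 1/2))). apply Rmult_le_compat_l; auto.
    replace (Rabs (dirichlet_sum n u) * (B * Rabs (u - 1/2))) with (B * (Rabs (dirichlet_sum n u) * Rabs (u - 1/2))) by ring. apply Rmult_le_compat_l; auto. }
  assert (Hout : forall u, 0 <= u <= 1 -> eps <= Rabs (u - 1/2) -> Cmod (g u) <= B * (/ 4 * / eps)).
  { intros u Hu Hv. unfold g. rewrite Cmod_mult, Cmod_R. specialize (Lp u Hu). assert (X := dirichlet_sum_bound2' n u Hu).
    assert (Z := Rabs_pos (dirichlet_sum n u)). set (v := Rabs (u - 1/2)) in *.
    apply Rle_trans with (Rabs (dirichlet_sum n u) * (B * v)). apply Rmult_le_compat_l; auto.
    replace (Rabs (dirichlet_sum n u) * (B * v)) with (B * (Rabs (dirichlet_sum n u) * (v * v) * / v)) by (field; lra). apply Rmult_le_compat_l; auto.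
    apply Rmult_le_compat; auto. apply Rmult_le_pos; auto; nra. left; apply Rinv_0_lt_compat; lra. apply Rinv_le_contravar; lra. }
  assert (I1 := CInt_norm_const g _ 0 (1/2 - eps) ltac:(lra) Cg ltac:(intros; apply Hout; [lra|rewrite Rabs_left; lra])).
  assert (I2 := CInt_norm_const g _ (1/2 - eps) (1/2 + eps) ltac:(lra) Cg ltac:(intros; apply Hin; lra)).
  assert (I3 := CInt_norm_const g _ (1/2 + eps) 1 ltac:(lra) Cg ltac:(intros; apply Hout; [lra|rewrite Rabs_right; lra])).
  eapply Rle_trans. apply Cmod_triangle. eapply Rle_trans. apply Rplus_le_compat_l. apply Cmod_triangle.
  assert (P : 0 < / eps) by (apply Rinv_0_lt_compat; lra).
  assert (B * (/ 4 * / eps) * (1/2 - eps) <= B * (/ 4 * / eps) * 1). { apply Rmult_le_compat_l. apply Rmult_le_pos; lra. lra. }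
  assert (0 <= B * / eps) by (apply Rmult_le_pos; lra).
  lra.
Qed.

(** * The shift identity in [b] for the reflected sum *)

Lemma ray_tail_bound d s b : unit_dir d -> 0 < fst b -> exists K, 0 <= K /\ forall y : C, 1 <= fst y ->
  Cmod (ray_tail d (mkpt s b y)) <= K / (fst y - 1 / 2).
Proof.
  intros Hd Hb. assert (Hw := weight_tail_weight).
  (* Every [y] is compared with [y = 1], where the integrand decays at rate [1/2]; the extra factor
     [e^(-(y-1) r)] raises the rate to [Re y - 1/2] with the same constant. *)
  destruct (ray_fun_decay tail_weight d Hw Hd (mkpt s b 1) (1/2) Hb ltac:(simpl; lra)) as [K [HK0 HK]].
  exists K. split; auto. intros y Hy.
  apply CInt_inf_bound. lra. intros; apply ccont_ray_fun; auto.
  intros r Hr. specialize (HK r Hr).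
  replace (ray_fun tail_weight d (mkpt s b y) r) with (ray_fun tail_weight d (mkpt s b 1) r * cexp (- ((y - 1) * r)))%C.
  2: { unfold ray_fun, mkpt, pS, pZ, pC; simpl. rewrite <- Cmult_assoc, <- cexp_plus. f_equal. f_equal. ring. }
  rewrite Cmod_mult, Cmod_cexp.
  replace (- (fst y - 1/2) * r) with (- (1/2) * r + fst (- ((y - 1) * r))%C) by (simpl; field).
  rewrite exp_plus, <- Rmult_assoc. apply Rmult_le_compat_r; auto. left; apply exp_pos.
Qed.

Lemma cexp_dir_odd e m : cexp (dir e * RtoC ((2 * INR m + 1) * PI))%C = (- (1))%C.
Proof.
  assert (Hc : cos ((2 * INR m + 1) * PI) = -1).
  { replace ((2 * INR m + 1) * PI) with (PI + 2 * INR m * PI) by ring. rewrite cos_period. apply cos_PI. }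
  assert (Hs : sin ((2 * INR m + 1) * PI) = 0).
  { replace ((2 * INR m + 1) * PI) with (PI + 2 * INR m * PI) by ring. rewrite sin_period. apply sin_PI. }
  set (a := (2 * INR m + 1) * PI) in *.
  destruct e; apply C_eq; unfold cexp, dir; simpl.
  - replace (0 * a - 1 * 0) with 0 by ring. replace (0 * 0 + 1 * a) with a by ring. rewrite exp_0, Hc. ring.
  - replace (0 * a - 1 * 0) with 0 by ring. replace (0 * 0 + 1 * a) with a by ring. rewrite exp_0, Hs. ring.
  - replace (- 0 * a - - (1) * 0) with 0 by ring. replace (- 0 * 0 + - (1) * a) with (- a) by ring. rewrite exp_0, cos_neg, Hc. ring.
  - replace (- 0 * a - - (1) * 0) with 0 by ring. replace (- 0 * 0 + - (1) * a) with (- a) by ring. rewrite exp_0, sin_neg, Hs. ring.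
Qed.

Lemma cexp_Ci_sin (x : R) : (- Ci * cexp (Ci * x) + Ci * cexp (- Ci * x) = RtoC (2 * sin x))%C.
Proof.
  apply C_eq; unfold cexp; simpl.
  - replace (0 * x - 1 * 0) with 0 by ring. replace (0 * 0 + 1 * x) with x by ring.
    replace (- 0 * x - - (1) * 0) with 0 by ring. replace (- 0 * 0 + - (1) * x) with (- x) by ring. rewrite exp_0, sin_neg, cos_neg. ring.
  - replace (0 * x - 1 * 0) with 0 by ring. replace (0 * 0 + 1 * x) with x by ring.
    replace (- 0 * x - - (1) * 0) with 0 by ring. replace (- 0 * 0 + - (1) * x) with (- x) by ring. rewrite exp_0, sin_neg, cos_neg. ring.
Qed.

Lemma dir_ybr e m M : (dir e * ybr e m M = dir e * RtoC ((2 * INR m + 1) * PI) + M)%C.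
Proof.
  unfold ybr. transitivity (dir e * RtoC ((2 * INR m + 1) * PI) - dir e * dir e * M)%C. ring.
  rewrite (dir_sq (dir e) (dir_unit e)). ring.
Qed.

(** By [dir_ybr], [e^(d y) = e^(d (2m+1) PI) e^M = - e^M]: the factor in front of the shifted term
    is the same for all [m] and both directions, which allows the terms to be summed. *)
Lemma ray_cont_shift_term e m s b M mu : 0 < fst b -> cexp mu = ybr e m M ->
  (ray_cont (dir e) (mkpt s b mu) + cexp M * ray_cont (dir e) (mkpt s (b + 1) mu) =
   - dir e * CInt (fun u => cexp (dir e * RtoC ((2 * INR m + 1) * PI * u)) * strip_fun s b M u) 0 1)%C.
Proof.
  intros Hb Hm.
  assert (X := ray_cont_shift (dir e) s b mu (dir_unit e) Hb). rewrite Hm, dir_ybr, cexp_plus, cexp_dir_odd in X.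
  transitivity (ray_cont (dir e) (mkpt s b mu) - - (1) * cexp M * ray_cont (dir e) (mkpt s (b + 1) mu))%C. ring.
  rewrite X. f_equal. apply CInt_ext. intros u _. unfold strip_fun. rewrite <- cexp_plus. f_equal.
  rewrite (RtoC_mult _ u). ring.
Qed.

Definition shift_sum J s b M mu := (Phi_half J s b M mu + cexp M * Phi_half J s (b + 1) M mu)%C.
Definition shift_tail J s b M :=
  ((ray_tail (dir true) (mkpt s b (ybr true J M)) + ray_tail (dir false) (mkpt s b (ybr false J M))) +
   cexp M * (ray_tail (dir true) (mkpt s (b + 1) (ybr true J M)) + ray_tail (dir false) (mkpt s (b + 1) (ybr false J M))))%C.

(** The two directions combine to [- i e^(i x) + i e^(-i x) = 2 sin x], and with the alternating
    signs the first [J] terms add up to the Dirichlet kernel. *)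
Lemma shift_sum_kernel (J : nat) (s b M : C) mu : 0 < fst b -> (forall e m, cexp (mu e m) = ybr e m M) ->
  shift_sum J s b M mu = (CInt (fun u => RtoC (dirichlet J u) * strip_fun s b M u) 0 1 + alt_sign J * shift_tail J s b M)%C.
Proof.
  intros Hb Hmu.
  assert (CU := fun x : R => ccont_strip_fun s b M x Hb).
  assert (K : forall n,
    (csum (fun m => alt_sign m * ray_cont (dir true) (mkpt s b (mu true m))) n + csum (fun m => alt_sign m * ray_cont (dir false) (mkpt s b (mu false m))) n +
     cexp M * (csum (fun m => alt_sign m * ray_cont (dir true) (mkpt s (b + 1) (mu true m))) n + csum (fun m => alt_sign m * ray_cont (dir false) (mkpt s (b + 1) (mu false m))) n)
     = CInt (fun u => RtoC (dirichlet n u) * strip_fun s b M u) 0 1)%C).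
  { induction n.
    - simpl. transitivity (RtoC 0). ring. rewrite (CInt_ext _ (fun _ => 0 * 0)%C).
      rewrite CInt_scal by (intros; apply ccont_const). ring. intros; ring.
    - rewrite !csum_S. cbv beta.
      match goal with |- ?l = _ => match type of IHn with ?l0 = _ =>
        transitivity (l0 + alt_sign n * ((ray_cont (dir true) (mkpt s b (mu true n)) + cexp M * ray_cont (dir true) (mkpt s (b + 1)%C (mu true n))) +
         (ray_cont (dir false) (mkpt s b (mu false n)) + cexp M * ray_cont (dir false) (mkpt s (b + 1) (mu false n)))))%C; [ring|] end end.
      rewrite IHn, (ray_cont_shift_term true n s b M) , (ray_cont_shift_term false n s b M) by auto.
      assert (CK := ccont_dirichlet n).
      assert (CLn : forall x : R, ccont (fun u : R => RtoC ((2 * INR n + 1) * PI * u)) x).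
      { intros x. apply (ccont_RtoC (fun u => (2 * INR n + 1) * PI * u)). apply (ex_derive_continuous (fun u => (2 * INR n + 1) * PI * u)). auto_derive; auto. }
      rewrite <- !CInt_scal by (intros; cc).
      rewrite <- CInt_plus by (intros; cc). rewrite <- CInt_scal by (intros; cc). rewrite <- CInt_plus by (intros; cc).
      apply CInt_ext. intros u _. simpl dirichlet. rewrite RtoC_plus.
      replace (2 * (-1) ^ n * sin ((2 * INR n + 1) * PI * u)) with ((-1) ^ n * (2 * sin ((2 * INR n + 1) * PI * u))) by ring.
      rewrite (RtoC_mult ((-1) ^ n)), <- cexp_Ci_sin. unfold dir.
      replace (RtoC ((-1) ^ n)) with (alt_sign n). ring. unfold alt_sign. rewrite RtoC_pow. f_equal. apply C_eq; simpl; ring. }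
  unfold shift_sum, Phi_half, dir_sum. rewrite <- K. unfold shift_tail. ring.
Qed.

(** The rate [1 / J] is just enough: the [n] tails with [n <= J < 2 n] together contribute at most
    [K], which disappears after division by [n]. *)
Lemma shift_tail_bound (s b M : C) : 0 < fst b -> exists K J0, 0 <= K /\ forall J, (J0 <= J)%nat -> (1 <= J)%nat /\ Cmod (shift_tail J s b M) <= K / INR J.
Proof.
  intros Hb. assert (Hb1 : 0 < fst (b + 1)%C) by (simpl; lra).
  destruct (ray_tail_bound (dir true) s b (dir_unit _) Hb) as [K1 [P1 B1]].
  destruct (ray_tail_bound (dir false) s b (dir_unit _) Hb) as [K2 [P2 B2]].
  destruct (ray_tail_bound (dir true) s (b + 1)%C (dir_unit _) Hb1) as [K3 [P3 B3]].
  destruct (ray_tail_bound (dir false) s (b + 1)%C (dir_unit _) Hb1) as [K4 [P4 B4]].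
  destruct (nfloor_ex (Cmod M) (Cmod_ge_0 M)) as [N HN].
  exists (K1 + K2 + Cmod (cexp M) * (K3 + K4)), (S N).
  assert (HM := Cmod_ge_0 (cexp M)).
  split. { assert (0 <= Cmod (cexp M) * (K3 + K4)) by (apply Rmult_le_pos; lra). lra. }
  intros J HJ. split. lia.
  assert (HJ1 : 1 <= INR J). { replace 1 with (INR 1) by reflexivity. apply le_INR; lia. }
  assert (HJM : Cmod M <= INR J). { apply le_INR in HJ. rewrite S_INR in HJ. lra. }
  assert (Y : forall e, INR J + 1 <= fst (ybr e J M)).
  { intros e. unfold ybr. change (fst (RtoC ((2 * INR J + 1) * PI) - dir e * M)%C) with ((2 * INR J + 1) * PI - fst (dir e * M)%C).
    assert (fst (dir e * M)%C <= Cmod M). { eapply Rle_trans. apply Rle_abs. eapply Rle_trans. apply Cmod_fst. rewrite Cmod_mult, dir_mod by apply dir_unit. lra. }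
    assert (X := PI2_3_2). assert (PI >= 3) by lra. nra. }
  assert (G : forall K e, 0 <= K -> K / (fst (ybr e J M) - 1 / 2) <= K / INR J).
  { intros K e HK. specialize (Y e). apply Rmult_le_compat_l; auto. apply Rinv_le_contravar; lra. }
  assert (Q : forall e, 1 <= fst (ybr e J M)) by (intros e; specialize (Y e); lra).
  unfold shift_tail. eapply Rle_trans. apply Cmod_triangle. rewrite Cmod_mult.
  assert (T1 := Cmod_triangle (ray_tail (dir true) (mkpt s b (ybr true J M))) (ray_tail (dir false) (mkpt s b (ybr false J M)))).
  assert (T2 := Cmod_triangle (ray_tail (dir true) (mkpt s (b + 1)%C (ybr true J M))) (ray_tail (dir false) (mkpt s (b + 1)%C (ybr false J M)))).
  specialize (B1 _ (Q true)). specialize (B2 _ (Q false)). specialize (B3 _ (Q true)). specialize (B4 _ (Q false)).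
  assert (G1 := G K1 true P1). assert (G2 := G K2 false P2). assert (G3 := G K3 true P3). assert (G4 := G K4 false P4).
  replace ((K1 + K2 + Cmod (cexp M) * (K3 + K4)) / INR J) with (K1 / INR J + K2 / INR J + Cmod (cexp M) * (K3 / INR J + K4 / INR J)) by (field; lra).
  apply Rplus_le_compat. lra. apply Rmult_le_compat_l; lra.
Qed.

(* The value does not depend on [J]; averaging over [n <= J < 2 n] and letting [n] grow isolates the midpoint. *)
Lemma Phi_half_shift J0 J (s b M : C) mu : 0 < fst b -> (forall e m, cexp (mu e m) = ybr e m M) -> principal_mu M mu J0 -> (J0 <= J)%nat ->
  (Phi_half J s b M mu + cexp M * Phi_half J s (b + 1) M mu = cexp (M / 2 - s * Clog (b + 1 / 2)))%C.
Proof.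
  intros Hb Hmu Hp HJ.
  assert (CU := fun x : R => ccont_strip_fun s b M x Hb).
  assert (CCL := fun x : R => ccont_Clog_abs b x Hb). assert (CA := ccont_Rabs).
  set (X := shift_sum J0 s b M mu).
  assert (HX : forall j, (J0 <= j)%nat -> shift_sum j s b M mu = X).
  { intros j Hj. unfold X, shift_sum. rewrite (Phi_half_indep J0 j s b M mu Hb Hp Hj).
    rewrite (Phi_half_indep J0 j s (b + 1)%C M mu) by (auto; simpl; lra). reflexivity. }
  change (shift_sum J s b M mu = cexp (M / 2 - s * Clog (b + 1 / 2))%C). rewrite HX by auto.
  replace (cexp (M / 2 - s * Clog (b + 1 / 2))%C) with (strip_fun s b M (1/2)).
  2: { unfold strip_fun. rewrite Rabs_right by lra. replace (RtoC (1/2)%R) with (1/2)%C by (rewrite RtoC_div by lra; reflexivity). f_equal. field. }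
  set (dk := fun u : R => (strip_fun s b M u * (M - s / (b + RtoC (Rabs u))))%C).
  destruct (fejer (strip_fun s b M) (fun u => cexp (M * u - s * Clog (b + u))%C) dk) as [C0 [HC0 Hf]]; auto.
  - intros x. unfold dk. cc. unfold Cdiv. apply ccont_mult. apply ccont_const. apply ccont_inv. cc.
    apply Cmod_neq0. apply Cmod_pos_fst. simpl. assert (Z := Rabs_pos x). lra.
  - intros u Hu. unfold strip_fun. rewrite Rabs_right by lra. reflexivity.
  - intros u Hu. assert (Hpu : 0 < fst (b + u)%C) by (simpl; lra).
    eapply cder_eq. apply cder_exp. apply cder_minus. apply cder_scal. apply cder_id. apply cder_scal. apply cder_Clog. auto.
    apply cder_plus. apply cder_const. apply cder_id. cbv beta. unfold dk, strip_fun. rewrite Rabs_right by lra. field.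
    apply Cmod_neq0, Cmod_pos_fst; auto.
  - destruct (shift_tail_bound s b M Hb) as [K [J1 [HK HR]]].
    (* After division by [n] the error is [C0 eps + (C0 / eps + K) / n]: first [eps] is made small,
       then [n] large. *)
    assert (Main : forall n eps, (J0 <= n)%nat -> (J1 <= n)%nat -> 0 < eps < 1/2 ->
      Cmod (X - strip_fun s b M (1/2))%C * INR n <= C0 * (INR n * eps + / eps) + K).
    { intros n eps H0 H1 He. destruct (HR n H1) as [Hn1 _].
      assert (Hn : 1 <= INR n). { replace 1 with (INR 1) by reflexivity. apply le_INR; auto. }
      assert (E : (RtoC (INR n) * X = CInt (fun u => RtoC (dirichlet_sum n u) * strip_fun s b M u) 0 1 + csum (fun i => alt_sign (n + i) * shift_tail (n + i) s b M) n)%C).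
      { rewrite <- csum_const.
        assert (G : forall k, csum (fun _ => X) k = (CInt (fun u => RtoC (rsum (fun i => dirichlet (n + i) u) k) * strip_fun s b M u) 0 1 + csum (fun i => alt_sign (n + i) * shift_tail (n + i) s b M) k)%C /\
           (forall x : R, ccont (fun u => RtoC (rsum (fun i => dirichlet (n + i) u) k)) x)).
        { induction k as [|k [IH IC]].
          - split. simpl. transitivity (RtoC 0 + 0)%C. ring. f_equal. rewrite (CInt_ext _ (fun _ => 0 * 0)%C).
            rewrite CInt_scal by (intros; apply ccont_const). ring. intros; ring. intros; apply ccont_const.
          - assert (CK := ccont_dirichlet (n + k)). split.
            + simpl. rewrite IH. rewrite <- (HX (n + k)%nat) by lia. rewrite shift_sum_kernel by auto.
              transitivity ((CInt (fun u => RtoC (rsum (fun i => dirichlet (n + i) u) k) * strip_fun s b M u) 0 1 + CInt (fun u => RtoC (dirichlet (n + k) u) * strip_fun s b M u) 0 1) +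
                (csum (fun i => alt_sign (n + i) * shift_tail (n + i) s b M) k + alt_sign (n + k) * shift_tail (n + k) s b M))%C. ring.
              f_equal. rewrite <- CInt_plus by (intros; cc). apply CInt_ext. intros u _. rewrite RtoC_plus. ring.
            + intros x. simpl. apply ccont_ext with (f := fun u => (RtoC (rsum (fun i => dirichlet (n + i) u) k) + RtoC (dirichlet (n + k) u))%C).
              intros; rewrite RtoC_plus; auto. cc. }
        apply G. }
      specialize (Hf n eps Hn1 He).
      assert (ER : Cmod (csum (fun i => alt_sign (n + i) * shift_tail (n + i) s b M)%C n) <= K).
      { replace K with (INR n * (K / INR n)) by (field; lra). apply csum_le. intros m Hm. rewrite Cmod_mult, alt_sign_mod, Rmult_1_l.
        destruct (HR (n + m)%nat ltac:(lia)) as [_ R1]. eapply Rle_trans. apply R1. apply Rmult_le_compat_l; auto.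
        apply Rinv_le_contravar. lra. apply le_INR; lia. }
      rewrite <- (Rabs_right (INR n)) at 1 by lra. rewrite <- Cmod_R, <- Cmod_mult.
      replace ((X - strip_fun s b M (1/2)%R) * RtoC (INR n))%C with ((CInt (fun u => RtoC (dirichlet_sum n u) * strip_fun s b M u) 0 1 - RtoC (INR n) * strip_fun s b M (1/2)%R) + csum (fun i => alt_sign (n + i) * shift_tail (n + i) s b M) n)%C.
      2: { rewrite (Cmult_comm (X - _)). transitivity (RtoC (INR n) * X - RtoC (INR n) * strip_fun s b M (1/2)%R)%C. rewrite E; ring. ring. }
      eapply Rle_trans. apply Cmod_triangle. lra. }
    apply C_eq_eps. intros eps0 He0.
    set (eps := Rmin (1/4) (eps0 / 2 / (C0 + 1))).
    assert (He : 0 < eps < 1/2). { unfold eps. assert (0 < eps0 / 2 / (C0 + 1)) by (apply Rdiv_lt_0_compat; lra). split. apply Rmin_pos; lra. assert (Z := Rmin_l (1/4) (eps0 / 2 / (C0 + 1))). lra. }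
    assert (He2 : C0 * eps <= eps0 / 2).
    { assert (Z := Rmin_r (1/4) (eps0 / 2 / (C0 + 1))). fold eps in Z. apply Rle_div_r in Z; [|lra]. nra. }
    destruct (nfloor_ex ((C0 * / eps + K) / (eps0 / 2))) as [N HN].
    { apply Rle_div_r. lra. rewrite Rmult_0_l. assert (0 < / eps) by (apply Rinv_0_lt_compat; lra). assert (0 <= C0 * / eps) by (apply Rmult_le_pos; lra). lra. }
    set (n := (S N + J0 + J1)%nat). specialize (Main n eps ltac:(unfold n; lia) ltac:(unfold n; lia) He).
    assert (Hn : INR N + 1 <= INR n). { rewrite <- S_INR. apply le_INR. unfold n; lia. }
    assert (HN0 := pos_INR N).
    assert (HN2 : C0 * / eps + K <= INR n * (eps0 / 2)). { apply Rle_div_l. lra. lra. }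
    apply Rmult_le_reg_r with (INR n). lra.
    assert (C0 * eps * INR n <= eps0 / 2 * INR n) by (apply Rmult_le_compat_r; lra). lra.
Qed.

(** * Continuous logarithms along curves *)

(** Paths are constrained on [0,1] only. Precomposition with [clamp] yields functions continuous on
    the whole line, as the calculus of [ccont] requires. *)
Definition clamp (t : R) : R := Rmax 0 (Rmin 1 t).
Lemma clamp_I t : I01 (clamp t).
Proof. unfold clamp, I01, Rmax, Rmin. repeat destruct Rle_dec; lra. Qed.
Lemma clamp_id t : I01 t -> clamp t = t.
Proof. unfold clamp, I01, Rmax, Rmin. intros. repeat destruct Rle_dec; lra. Qed.
Lemma clamp_lip t t' : Rabs (clamp t - clamp t') <= Rabs (t - t').
Proof. unfold clamp, Rmax, Rmin, Rabs. repeat destruct Rle_dec; repeat destruct Rcase_abs; lra. Qed.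

Lemma I01_0 : I01 0. Proof. unfold I01; lra. Qed.
Lemma I01_1 : I01 1. Proof. unfold I01; lra. Qed.

Lemma ccont_eps1 (f : R -> C) (x : R) :
  (forall eps, 0 < eps -> exists d, 0 < d /\ forall y, Rabs (y - x) < d -> Cmod (f y - f x)%C < eps) -> ccont f x.
Proof.
  intros H. split; apply continuity_pt_filterlim; intros eps He; destruct (H eps He) as [d [Hd0 Hd1]];
  exists d; split; auto; intros y [_ Hy]; simpl in *; unfold R_dist in *; specialize (Hd1 y Hy);
  (eapply Rle_lt_trans; [|apply Hd1]).
  apply (Cmod_fst (f y - f x)%C). apply (Cmod_snd (f y - f x)%C).
Qed.
Lemma ccont_to_eps1 (f : R -> C) (x : R) : ccont f x ->
  forall eps, 0 < eps -> exists d, 0 < d /\ forall y, Rabs (y - x) < d -> Cmod (f y - f x)%C < eps.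
Proof.
  intros [H1 H2] eps He.
  destruct (proj1 (filterlim_locally _ _) H1 (mkposreal (eps/2) ltac:(lra))) as [d1 X1].
  destruct (proj1 (filterlim_locally _ _) H2 (mkposreal (eps/2) ltac:(lra))) as [d2 X2].
  exists (Rmin d1 d2). split. apply Rmin_pos; apply cond_pos. intros y Hy.
  assert (Y1 := Rmin_l d1 d2). assert (Y2 := Rmin_r d1 d2).
  specialize (X1 y ltac:(simpl; unfold ball; simpl; unfold AbsRing_ball, abs, minus, plus, opp; simpl; unfold Rminus in Hy; lra)).
  specialize (X2 y ltac:(simpl; unfold ball; simpl; unfold AbsRing_ball, abs, minus, plus, opp; simpl; unfold Rminus in Hy; lra)).
  simpl in X1, X2. unfold ball in X1, X2; simpl in X1, X2. unfold AbsRing_ball, abs, minus, plus, opp in X1, X2; simpl in X1, X2.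
  eapply Rle_lt_trans. apply Cmod_le_sum. simpl. lra.
Qed.
Lemma ccont_eps2 (f : R * R -> C) (x y : R) :
  (forall eps, 0 < eps -> exists d, 0 < d /\ forall x' y', Rabs (x' - x) < d -> Rabs (y' - y) < d -> Cmod (f (x', y') - f (x, y))%C < eps) -> ccont f (x, y).
Proof.
  intros H. split; apply filterlim_locally; intros eps; destruct (H eps (cond_pos eps)) as [d [Hd0 Hd1]];
  exists (mkposreal d Hd0); intros [x' y'] [B1 B2]; specialize (Hd1 x' y' B1 B2);
  (eapply Rle_lt_trans; [|apply Hd1]).
  apply (Cmod_fst (f (x', y') - f (x, y))%C). apply (Cmod_snd (f (x', y') - f (x, y))%C).
Qed.

Lemma cont_clamp x : continuous clamp x.
Proof.
  apply continuity_pt_filterlim. intros eps He. exists eps. split; auto. intros y [_ Hy]. simpl in *. unfold R_dist in *.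
  eapply Rle_lt_trans. apply clamp_lip. auto.
Qed.

Lemma cont_pair {U : UniformSpace} (f g : U -> R) x : continuous f x -> continuous g x -> continuous (fun y => (f y, g y)) x.
Proof.
  intros Hf Hg. apply filterlim_locally. intros eps.
  assert (A := proj1 (filterlim_locally _ _) Hf eps). assert (B := proj1 (filterlim_locally _ _) Hg eps).
  generalize (filter_and _ _ A B). apply filter_imp. intros y [a b]; split; auto.
Qed.

Definition rcont (f : R -> C) := forall t, I01 t -> forall eps, 0 < eps -> exists d, 0 < d /\
  forall t', I01 t' -> Rabs (t' - t) < d -> Cmod (f t' - f t)%C < eps.
Definition rcont2 (H : R -> R -> C) := forall u t, I01 u -> I01 t -> forall eps, 0 < eps -> exists d, 0 < d /\
  forall u' t', I01 u' -> I01 t' -> Rabs (u' - u) < d -> Rabs (t' - t) < d -> Cmod (H u' t' - H u t)%C < eps.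

Lemma rcont_clamp f : rcont f -> forall x : R, ccont (fun t => f (clamp t)) x.
Proof.
  intros H x. apply ccont_eps1. intros eps He. destruct (H (clamp x) (clamp_I x) eps He) as [d [H0 H1]].
  exists d. split; auto. intros y Hy. apply H1. apply clamp_I. eapply Rle_lt_trans. apply clamp_lip. auto.
Qed.
Lemma rcont2_clamp H : rcont2 H -> forall p : R * R, ccont (fun p => H (clamp (fst p)) (clamp (snd p))) p.
Proof.
  intros HH [x y]. apply ccont_eps2. intros eps He. destruct (HH (clamp x) (clamp y) (clamp_I x) (clamp_I y) eps He) as [d [H0 H1]].
  exists d. split; auto. intros x' y' Hx Hy. simpl. apply H1; try apply clamp_I.
  eapply Rle_lt_trans. apply clamp_lip. auto. eapply Rle_lt_trans. apply clamp_lip. auto.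
Qed.

Definition lift (f l : R -> C) := (forall x : R, ccont l x) /\ forall t, I01 t -> cexp (l t) = f t.

(** Compactness of the square gives one mesh for all [u] on which neighbouring values have their
    ratio in the right half-plane, where [Clog] is a continuous logarithm. *)
Lemma unif_ratio (H : R -> R -> C) : rcont2 H -> (forall u t, I01 u -> I01 t -> H u t <> 0) ->
  exists n, (1 <= n)%nat /\ forall u t t', I01 u -> I01 t -> I01 t' -> Rabs (t' - t) <= / INR n -> 0 < fst (H u t' / H u t)%C.
Proof.
  intros Hc Hn.
  (* The allowance in [t] is doubled: the covering places [t] within [delta] of the centre, and [t']
     is up to one mesh further away. *)
  assert (L : forall x y, exists d : posreal, I01 x -> I01 y -> forall u t t', I01 u -> I01 t -> I01 t' ->
     Rabs (u - x) < d -> Rabs (t - y) < 2 * d -> Rabs (t' - y) < 2 * d -> 0 < fst (H u t' / H u t)%C).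
  { intros x y. destruct (classic (I01 x /\ I01 y)) as [[Hx Hy]|N].
    2: { exists (mkposreal 1 Rlt_0_1). intros; tauto. }
    assert (Hm : 0 < Cmod (H x y)) by (apply Cmod_gt_0; auto).
    (* With a third, [|a' - a| < 2/3 |w| < |a|], so that [a' / a] lies in the open unit disc around
       1. *)
    destruct (Hc x y Hx Hy (Cmod (H x y) / 3) ltac:(lra)) as [d [Hd0 Hd1]].
    exists (mkposreal (d / 2) ltac:(lra)). cbn [pos]. intros _ _ u t t' Iu It It' Hu Ht Ht'.
    assert (A1 := Hd1 u t Iu It ltac:(lra) ltac:(lra)). assert (A2 := Hd1 u t' Iu It' ltac:(lra) ltac:(lra)).
    set (w := H x y) in *. set (a := H u t) in *. set (a' := H u t') in *.
    assert (B1 : Cmod (a' - a)%C < 2 / 3 * Cmod w).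
    { replace (a' - a)%C with ((a' - w) - (a - w))%C by ring. eapply Rle_lt_trans. apply Cmod_minus_le. lra. }
    assert (B2 : 2 / 3 * Cmod w < Cmod a).
    { assert (X := Cmod_tri_sub w a). rewrite Cmod_minus_sym in X. lra. }
    assert (Ha : a <> 0) by (apply Cmod_neq0; lra).
    replace (a' / a)%C with (1 + (a' - a) / a)%C by (field; auto).
    assert (X : Cmod ((a' - a) / a)%C < 1). { rewrite Cmod_div by auto. apply Rlt_div_l; lra. }
    set (q := ((a' - a) / a)%C) in *. change (0 < 1 + fst q).
    assert (Y := Cmod_fst q). assert (Z : Rabs (fst q) < 1) by lra. apply Rabs_def2 in Z. lra. }
  set (delta := fun x y => proj1_sig (constructive_indefinite_description _ (L x y))).
  assert (HD : forall x y, I01 x -> I01 y -> forall u t t', I01 u -> I01 t -> I01 t' ->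
     Rabs (u - x) < delta x y -> Rabs (t - y) < 2 * delta x y -> Rabs (t' - y) < 2 * delta x y -> 0 < fst (H u t' / H u t)%C).
  { intros x y. unfold delta. destruct (constructive_indefinite_description _ (L x y)); auto. }
  destruct (compactness_value_2d 0 1 0 1 delta) as [d Hd].
  destruct (nfloor_ex (/ d)) as [N HN]. left; apply Rinv_0_lt_compat, cond_pos.
  exists (S N). split. lia. intros u t t' Iu It It' Ht.
  assert (Ed : / INR (S N) < d).
  { rewrite S_INR. rewrite <- (Rinv_inv d). apply Rinv_lt_contravar. 2: tauto.
    apply Rmult_lt_0_compat. apply Rinv_0_lt_compat, cond_pos. assert (X := pos_INR N). lra. }
  assert (X := NNPP _ (Hd u t Iu It)). destruct X as (x & y & Ix & Iy & Hx & Hy & Hdd).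
  apply (HD x y Ix Iy); auto. assert (Z := cond_pos (delta x y)). lra.
  replace (t' - y) with ((t' - t) + (t - y)) by ring. eapply Rle_lt_trans. apply Rabs_triang. lra.
Qed.

(** The logarithm is written down at once, as [l0] plus the principal logarithms of the ratios
    [H u ((k+1) t / n) / H u (k t / n)]. A finite sum of jointly continuous functions is jointly
    continuous, so no gluing over subintervals is needed. *)
Lemma lift2 (H : R -> R -> C) l0 : rcont2 H -> (forall u t, I01 u -> I01 t -> H u t <> 0) ->
  (forall u, I01 u -> cexp l0 = H u 0) ->
  exists l : R -> R -> C, (forall p : R * R, ccont (fun p => l (fst p) (snd p)) p) /\
    (forall u t, I01 u -> I01 t -> cexp (l u t) = H u t) /\ (forall u, I01 u -> l u 0 = l0).
Proof.
  intros Hc Hn Hl0. destruct (unif_ratio H Hc Hn) as [n [Hn1 HR]].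
  assert (Hn0 : 1 <= INR n) by (replace 1 with (INR 1) by reflexivity; apply le_INR; auto).
  set (pt_ := fun (k : nat) (t : R) => INR k / INR n * clamp t).
  assert (Ipt : forall k t, (k <= n)%nat -> I01 (pt_ k t)).
  { intros k t Hk. unfold pt_. destruct (clamp_I t). apply le_INR in Hk. assert (Hk0 := pos_INR k).
    assert (0 <= INR k / INR n <= 1). { split. apply Rle_div_r; lra. apply Rle_div_l; lra. }
    split. apply Rmult_le_pos; lra. rewrite <- (Rmult_1_r 1). apply Rmult_le_compat; lra. }
  assert (Step : forall m t, Rabs (pt_ (S m) t - pt_ m t) <= / INR n).
  { intros m t. unfold pt_. rewrite S_INR.
    replace ((INR m + 1) / INR n * clamp t - INR m / INR n * clamp t) with (clamp t / INR n) by (field; lra).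
    destruct (clamp_I t). rewrite Rabs_right by (apply Rle_ge, Rmult_le_pos; [lra | left; apply Rinv_0_lt_compat; lra]).
    unfold Rdiv. rewrite <- (Rmult_1_l (/ INR n)) at 2. apply Rmult_le_compat_r; auto. left; apply Rinv_0_lt_compat; lra. }
  set (tm := fun k u t => Clog (H (clamp u) (pt_ (S k) t) / H (clamp u) (pt_ k t))%C).
  exists (fun u t => l0 + csum (fun k => tm k u t) n)%C. split; [|split].
  - assert (Cpt : forall k p, (k <= n)%nat -> ccont (fun p : R * R => H (clamp (fst p)) (pt_ k (snd p))) p).
    { intros k p Hk.
      apply ccont_ext with (f := fun p => H (clamp (fst p)) (clamp (pt_ k (snd p)))).
      { intros y; cbv beta; f_equal; apply clamp_id; apply Ipt; exact Hk. }
      destruct p as [x y].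
      apply (ccont_comp (fun p : R * R => (fst p, pt_ k (snd p))) (fun p : R * R => H (clamp (fst p)) (clamp (snd p)))).
      2: apply rcont2_clamp; auto.
      apply (cont_pair fst (fun p : R * R => pt_ k (snd p))). apply continuous_fst.
      apply (continuous_comp snd (pt_ k)). apply continuous_snd.
      apply (cont_mult_R (fun _ => INR k / INR n) clamp). apply continuous_const. apply cont_clamp. }
    assert (Cl : forall m p, (m <= n)%nat -> ccont (fun p : R * R => csum (fun k => tm k (fst p) (snd p)) m) p).
    { induction m; intros p Hm. apply ccont_const. simpl.
      apply (ccont_plus (fun p : R * R => csum (fun k => tm k (fst p) (snd p)) m)). apply IHm; lia.
      unfold tm. apply ccont_Clog. apply ccont_div; try apply Cpt; try lia. apply Hn. apply clamp_I. apply Ipt; lia.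
      apply HR; try apply clamp_I; try (apply Ipt; lia). apply Step. }
    intros p. apply (ccont_plus (fun _ => l0)). apply ccont_const. apply Cl; auto.
  - intros u t Iu It.
    assert (G : forall m, (m <= n)%nat -> cexp (l0 + csum (fun k => tm k u t) m)%C = H u (pt_ m t)).
    { induction m; intros Hm.
      - simpl. rewrite Cplus_0_r. unfold pt_. simpl. replace (0 / INR n * clamp t) with 0 by (field; lra). auto.
      - simpl. rewrite Cplus_assoc, cexp_plus, IHm by lia. unfold tm. rewrite (clamp_id u Iu). rewrite cexp_Clog.
        field. apply Hn; auto. apply Ipt; lia.
        apply HR; auto; try (apply Ipt; lia). }
    rewrite G by auto. f_equal. unfold pt_. rewrite clamp_id by auto. field. lra.
  - intros u Iu.
    assert (G : forall m, (m <= n)%nat -> csum (fun k => tm k u 0) m = 0).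
    { induction m; intros Hm; simpl; auto. rewrite IHm by lia. unfold tm, pt_. rewrite (clamp_id 0 I01_0), !Rmult_0_r.
      rewrite (clamp_id u Iu). replace (H u 0 / H u 0)%C with (RtoC 1). rewrite Clog_1. ring. field. apply Hn; auto using I01_0. }
    rewrite G by auto. ring.
Qed.

Lemma lift_ex (f : R -> C) l0 : rcont f -> (forall t, I01 t -> f t <> 0) -> cexp l0 = f 0 -> exists l, lift f l /\ l 0 = l0.
Proof.
  intros Hc Hn H0.
  destruct (lift2 (fun _ t => f t) l0) as [l [L1 [L2 L3]]]; auto.
  - intros u t Iu It eps He. destruct (Hc t It eps He) as [d [D0 D1]]. exists d; split; auto.
  - exists (l 0). split. split.
    + intros x. apply (ccont_comp (fun t : R => (0, t)) (fun p : R * R => l (fst p) (snd p))); auto.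
      apply (cont_pair (fun _ : R => 0) (fun t => t)). apply continuous_const. apply continuous_id.
    + intros; apply L2; auto using I01_0.
    + apply L3. apply I01_0.
Qed.

(** The difference of the lifts starts at 0 and has exponential 1. If it did not vanish, its
    imaginary part would reach modulus [2 PI] and hence pass through [PI] or [- PI], where the
    exponential is negative. *)
Lemma lift_unique f l l' : lift f l -> lift f l' -> l 0 = l' 0 -> forall t, I01 t -> l t = l' t.
Proof.
  intros [C1 E1] [C2 E2] H0 t It.
  assert (HP := PI_RGT_0).
  set (d := fun x => (l x - l' x)%C).
  assert (Ed : forall x, I01 x -> cexp (d x) = 1).
  { intros x Ix. unfold d. rewrite cexp_minus, E1, E2 by auto. field. rewrite <- E2 by auto. apply cexp_neq0. }
  assert (Cd : forall x : R, ccont d x) by (intros x; unfold d; apply ccont_minus; auto).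
  assert (d t = 0).
  { apply cexp_1_small. auto.
    apply Rnot_le_lt. intros Hge.
    set (g := fun x => snd (d x)).
    assert (Cg : continuity g). { intros x. apply continuity_pt_filterlim. apply Cd. }
    assert (g0 : g 0 = 0). { unfold g, d. rewrite H0. simpl. ring. }
    assert (Bad : forall x, I01 x -> Rabs (g x) <> PI).
    { intros x Ix HA. assert (W := Ed x Ix). assert (cos (g x) = -1).
      { destruct (Rcase_abs (g x)). rewrite Rabs_left in HA by auto. replace (g x) with (- PI) by lra. rewrite cos_neg. apply cos_PI.
        rewrite Rabs_right in HA by auto. rewrite HA. apply cos_PI. }
      assert (W1 : exp (fst (d x)) * cos (g x) = 1) by exact (f_equal fst W). rewrite H in W1. assert (X := exp_pos (fst (d x))). lra. }
    assert (Hgt : Rabs (g t) >= 2 * PI) by (apply Rle_ge; exact Hge).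
    destruct It as [It0 It1].
    destruct (Rcase_abs (g t)) as [N|P].
    - rewrite Rabs_left in Hgt by auto.
      destruct (IVT_gen g 0 t (- PI) Cg) as [x [Hx Ex]].
      { rewrite g0. rewrite Rmin_right, Rmax_left by lra. lra. }
      rewrite Rmin_left, Rmax_right in Hx by lra. apply (Bad x). unfold I01; lra. rewrite Ex, Rabs_Ropp, Rabs_right; lra.
    - rewrite Rabs_right in Hgt by auto.
      destruct (IVT_gen g 0 t PI Cg) as [x [Hx Ex]].
      { rewrite g0. rewrite Rmin_left, Rmax_right by lra. lra. }
      rewrite Rmin_left, Rmax_right in Hx by lra. apply (Bad x). unfold I01; lra. rewrite Ex, Rabs_right; lra. }
  unfold d in H. apply Ceq_minus. auto.
Qed.

(** * Concatenation and reversal of lifts *)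

Definition catC {X : Type} (f g : R -> X) : R -> X := fun t => if Rle_dec t (1/2) then f (2 * t) else g (2 * t - 1).

(** One gluing lemma for two uses: paths with [dist3] on [0,1], and lifts with the modulus on the
    whole line. [concat] is convertible to [catC]. *)
Definition dcont {X : Type} (d : X -> X -> R) (dom : R -> Prop) (f : R -> X) := forall t, dom t -> forall eps, 0 < eps ->
  exists e, 0 < e /\ forall t', dom t' -> Rabs (t' - t) < e -> d (f t') (f t) < eps.

Lemma dcont_cat {X : Type} (d : X -> X -> R) (dom : R -> Prop) f g :
  (forall t, dom t -> t <= 1 / 2 -> dom (2 * t)) -> (forall t, dom t -> 1 / 2 <= t -> dom (2 * t - 1)) ->
  f 1 = g 0 -> dcont d dom f -> dcont d dom g -> dcont d dom (catC f g).
Proof.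
  intros Df Dg E Cf Cg t It eps He.
  assert (Sf : forall a y, dom y -> y <= 1/2 -> Rabs (y - t) < a / 2 -> Rabs (2 * y - 2 * t) < a).
  { intros. replace (2 * y - 2 * t) with (2 * (y - t)) by ring. rewrite Rabs_mult, Rabs_right by lra. lra. }
  assert (Sg : forall a y, dom y -> 1/2 <= y -> Rabs (y - t) < a / 2 -> Rabs (2 * y - 1 - (2 * t - 1)) < a).
  { intros. replace (2 * y - 1 - (2 * t - 1)) with (2 * (y - t)) by ring. rewrite Rabs_mult, Rabs_right by lra. lra. }
  destruct (Rtotal_order t (1/2)) as [L|[M|G]].
  - destruct (Cf (2 * t) ltac:(apply Df; auto; lra) eps He) as [a [A0 A1]].
    exists (Rmin (a / 2) (1/2 - t)). split. apply Rmin_pos; lra. intros y Iy Hy.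
    apply Rmin_Rgt_l in Hy. destruct Hy as [Hy1 Hy2]. apply Rabs_def2 in Hy2.
    unfold catC. destruct (Rle_dec y (1/2)); [|lra]. destruct (Rle_dec t (1/2)); [|lra]. auto.
  - destruct (Cf (2 * t) ltac:(apply Df; auto; lra) eps He) as [a [A0 A1]].
    destruct (Cg (2 * t - 1) ltac:(apply Dg; auto; lra) eps He) as [b [B0 B1]].
    exists (Rmin (a / 2) (b / 2)). split. apply Rmin_pos; lra. intros y Iy Hy.
    apply Rmin_Rgt_l in Hy. destruct Hy as [Hy1 Hy2].
    unfold catC. destruct (Rle_dec t (1/2)); [|lra]. destruct (Rle_dec y (1/2)). auto.
    replace (f (2 * t)) with (g (2 * t - 1)). apply B1; [apply Dg|apply Sg]; auto; lra.
    rewrite M. replace (2 * (1/2) - 1) with 0 by field. replace (2 * (1/2)) with 1 by field. auto.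
  - destruct (Cg (2 * t - 1) ltac:(apply Dg; auto; lra) eps He) as [b [B0 B1]].
    exists (Rmin (b / 2) (t - 1/2)). split. apply Rmin_pos; lra. intros y Iy Hy.
    apply Rmin_Rgt_l in Hy. destruct Hy as [Hy1 Hy2]. apply Rabs_def2 in Hy2.
    unfold catC. destruct (Rle_dec y (1/2)); [lra|]. destruct (Rle_dec t (1/2)); [lra|]. apply B1; [apply Dg|apply Sg]; auto; lra.
Qed.

Lemma ccont_cat l1 l2 : (forall x : R, ccont l1 x) -> (forall x : R, ccont l2 x) -> l1 1 = l2 0 -> forall x : R, ccont (catC l1 l2) x.
Proof.
  intros C1 C2 E x. apply ccont_eps1. intros eps He.
  assert (K : forall l : R -> C, (forall x : R, ccont l x) -> dcont (fun a b => Cmod (a - b)%C) (fun _ => True) l).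
  { intros l Cl t _ e H. destruct (ccont_to_eps1 l t (Cl t) e H) as [d [D0 D1]]. exists d. split; auto. }
  destruct (dcont_cat _ (fun _ => True) l1 l2 ltac:(auto) ltac:(auto) E (K _ C1) (K _ C2) x Logic.I eps He) as [d [D0 D1]].
  exists d. split; auto.
Qed.
Lemma catC_0 {X} (f g : R -> X) : catC f g 0 = f 0.
Proof. unfold catC. destruct Rle_dec; [|lra]. f_equal; ring. Qed.
Lemma catC_1 {X} (f g : R -> X) : catC f g 1 = g 1.
Proof. unfold catC. destruct Rle_dec; [lra|]. f_equal; ring. Qed.
Lemma catC_map {X Y} (h : X -> Y) f g t : h (catC f g t) = catC (fun t => h (f t)) (fun t => h (g t)) t.
Proof. unfold catC. destruct Rle_dec; auto. Qed.

Lemma lift_ext f g l : (forall t, I01 t -> f t = g t) -> lift f l -> lift g l.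
Proof. intros H [A B]. split; auto. intros; rewrite <- H; auto. Qed.
Lemma lift_cat f g l1 l2 : lift f l1 -> lift g l2 -> l1 1 = l2 0 -> lift (catC f g) (catC l1 l2).
Proof.
  intros [A1 B1] [A2 B2] E. split. apply ccont_cat; auto.
  intros t It. unfold catC, I01 in *. destruct Rle_dec; [apply B1 | apply B2]; unfold I01; lra.
Qed.
Lemma lift_rev f l : lift f l -> lift (fun t => f (1 - t)) (fun t => l (1 - t)).
Proof.
  intros [A B]. split.
  - intros x. apply (ccont_comp (fun t : R => 1 - t) l); auto.
    apply (cont_minus_R (fun _ => 1) (fun t => t)). apply continuous_const. apply continuous_id.
  - intros t It. apply B. unfold I01 in *; lra.
Qed.

Definition log_lift (f : R -> C) (a b : C) := exists l, lift f l /\ l 0 = a /\ l 1 = b.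

Lemma log_lift_fun f a b b' : log_lift f a b -> log_lift f a b' -> b = b'.
Proof.
  intros (l & L & L0 & L1) (l' & L' & L0' & L1'). rewrite <- L1, <- L1'. apply (lift_unique f); auto using I01_1. congruence.
Qed.
Lemma log_lift_ext f g a b : (forall t, I01 t -> f t = g t) -> log_lift f a b -> log_lift g a b.
Proof. intros H (l & L & E). exists l. split; auto. eapply lift_ext; eauto. Qed.
Lemma log_lift_ex f a : rcont f -> (forall t, I01 t -> f t <> 0) -> cexp a = f 0 -> exists b, log_lift f a b.
Proof. intros Hc Hn H0. destruct (lift_ex f a Hc Hn H0) as (l & L & E). exists (l 1), l. auto. Qed.
Lemma log_lift_shift f a b a' : log_lift f a b -> cexp a' = cexp a -> log_lift f a' (b + (a' - a))%C.
Proof.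
  intros (l & [A B] & L0 & L1) E. exists (fun t => l t + (a' - a))%C. split; [split|split].
  - intros x. apply ccont_plus; auto. apply ccont_const.
  - intros t It. rewrite cexp_plus, cexp_minus, E, B by auto. field. apply cexp_neq0.
  - rewrite L0. ring.
  - rewrite L1. ring.
Qed.
Lemma log_lift_cat f g a b c : log_lift f a b -> log_lift g b c -> log_lift (catC f g) a c.
Proof.
  intros (l & L & L0 & L1) (l' & L' & L0' & L1'). exists (catC l l'). split. apply lift_cat; auto. congruence.
  rewrite catC_0, catC_1. auto.
Qed.
Lemma log_lift_rev f a b : log_lift f a b -> log_lift (fun t => f (1 - t)) b a.
Proof.
  intros (l & L & L0 & L1). exists (fun t => l (1 - t)). split. apply lift_rev; auto.
  rewrite Rminus_0_r, Rminus_diag. auto.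
Qed.
Lemma log_lift_const a f : (forall t, I01 t -> f t = cexp a) -> log_lift f a a.
Proof.
  intros H. exists (fun _ => a). split; auto. split. intros; apply ccont_const. intros; rewrite H; auto.
Qed.
Lemma log_lift_Clog f : rcont f -> (forall t, I01 t -> 0 < fst (f t)) -> log_lift f (Clog (f 0)) (Clog (f 1)).
Proof.
  intros Hc Hp. exists (fun t => Clog (f (clamp t))). rewrite !clamp_id by auto using I01_0, I01_1. split; auto. split.
  - intros x. apply ccont_Clog. apply rcont_clamp; auto. apply Hp. apply clamp_I.
  - intros t It. rewrite clamp_id by auto. apply cexp_Clog; auto.
Qed.
Lemma log_lift_end f a b : log_lift f a b -> cexp a = f 0 /\ cexp b = f 1.
Proof. intros (l & [A B] & L0 & L1). rewrite <- L0, <- L1. auto using I01_0, I01_1. Qed.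

(** As a function of [u] the end value is a continuous logarithm of a constant, so by uniqueness of
    lifts it is constant. *)
Lemma end_const (l : R -> R -> C) (c : C) : (forall p : R * R, ccont (fun p => l (fst p) (snd p)) p) ->
  (forall u, I01 u -> cexp (l u 1) = c) -> forall u, I01 u -> l u 1 = l 0 1.
Proof.
  intros Hc He u Iu.
  apply (lift_unique (fun _ => c) (fun u => l u 1) (fun _ => l 0 1)); auto.
  - split; auto. intros x. apply (ccont_comp (fun u : R => (u, 1)) (fun p : R * R => l (fst p) (snd p))); auto.
    apply (cont_pair (fun t : R => t) (fun _ => 1)). apply continuous_id. apply continuous_const.
  - split. intros; apply ccont_const. intros; apply He. apply I01_0.
Qed.
Lemma slice_ccont (l : R -> R -> C) : (forall p : R * R, ccont (fun p => l (fst p) (snd p)) p) -> forall u, forall x : R, ccont (l u) x.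
Proof.
  intros Hc u x. apply (ccont_comp (fun t : R => (u, t)) (fun p : R * R => l (fst p) (snd p))); auto.
  apply (cont_pair (fun _ : R => u) (fun t => t)). apply continuous_const. apply continuous_id.
Qed.

Lemma log_lift_hom (H : R -> R -> C) a b : rcont2 H -> (forall u t, I01 u -> I01 t -> H u t <> 0) ->
  (forall u, I01 u -> H u 0 = H 0 0) -> (forall u, I01 u -> H u 1 = H 0 1) -> log_lift (H 0) a b -> log_lift (H 1) a b.
Proof.
  intros Hc Hn H0 H1 HL. destruct (log_lift_end _ _ _ HL) as [Ea Eb].
  destruct (lift2 H a Hc Hn) as (l & L1 & L2 & L3). { intros u Iu. rewrite H0; auto. }
  assert (E := end_const l (H 0 1) L1).
  assert (X0 : log_lift (H 0) a (l 0 1)).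
  { exists (l 0). split; [split|split]. apply slice_ccont; auto. intros; apply L2; auto using I01_0. apply L3, I01_0. reflexivity. }
  rewrite (log_lift_fun _ _ _ _ HL X0). rewrite <- (E ltac:(intros; rewrite L2; auto using I01_1) 1 I01_1).
  exists (l 1). split; [split|split]. apply slice_ccont; auto. intros; apply L2; auto using I01_1. apply L3, I01_1. reflexivity.
Qed.

(** * Transport of logarithms along paths *)

Lemma ccont_to_eps2 (f : R * R -> C) (x y : R) : ccont f (x, y) ->
  forall eps, 0 < eps -> exists d, 0 < d /\ forall x' y', Rabs (x' - x) < d -> Rabs (y' - y) < d -> Cmod (f (x', y') - f (x, y))%C < eps.
Proof.
  intros [H1 H2] eps He.
  destruct (proj1 (filterlim_locally _ _) H1 (mkposreal (eps/2) ltac:(lra))) as [d1 X1].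
  destruct (proj1 (filterlim_locally _ _) H2 (mkposreal (eps/2) ltac:(lra))) as [d2 X2].
  exists (Rmin d1 d2). split. apply Rmin_pos; apply cond_pos. intros x' y' Hx Hy.
  assert (Y1 := Rmin_l d1 d2). assert (Y2 := Rmin_r d1 d2).
  assert (Z1 : Rabs (fst (f (x', y')) - fst (f (x, y))) < eps / 2).
  { apply (X1 (x', y')). split; [change (Rabs (x' - x) < d1)|change (Rabs (y' - y) < d1)]; lra. }
  assert (Z2 : Rabs (snd (f (x', y')) - snd (f (x, y))) < eps / 2).
  { apply (X2 (x', y')). split; [change (Rabs (x' - x) < d2)|change (Rabs (y' - y) < d2)]; lra. }
  eapply Rle_lt_trans. apply Cmod_le_sum. simpl. unfold Rminus in *. lra.
Qed.
Lemma rcont_of_ccont f : (forall x : R, ccont f x) -> rcont f.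
Proof. intros H t _ eps He. destruct (ccont_to_eps1 f t (H t) eps He) as [d [D0 D1]]. exists d; split; auto. Qed.
Lemma rcont2_of_ccont (l : R -> R -> C) : (forall p : R * R, ccont (fun p => l (fst p) (snd p)) p) -> rcont2 l.
Proof. intros H u t _ _ eps He. destruct (ccont_to_eps2 _ u t (H (u, t)) eps He) as [d [D0 D1]]. exists d; split; [exact D0|]. intros u2 t2 _ _. apply D1. Qed.

(** The sign makes the lifted function equal to 1 at the base point, so that [M] starts at 0. *)
Definition neg_z (g : path) : R -> C := fun t => (- pZ (g t))%C.
Definition c_plus (n : nat) (g : path) : R -> C := fun t => (pC (g t) + RtoC (INR n))%C.

Lemma dist3_Z p q : Cmod (pZ p - pZ q)%C <= dist3 p q.
Proof. unfold dist3. eapply Rle_trans. 2: apply Rmax_r. apply Rmax_l. Qed.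
Lemma dist3_C p q : Cmod (pC p - pC q)%C <= dist3 p q.
Proof. unfold dist3. eapply Rle_trans. 2: apply Rmax_r. apply Rmax_r. Qed.
Lemma dist3_S p q : Cmod (pS p - pS q)%C <= dist3 p q.
Proof. unfold dist3. apply Rmax_l. Qed.

Lemma neg_z_rcont g : path_in_N g -> rcont (neg_z g).
Proof.
  intros [_ H] t It eps He. destruct (H t It eps He) as [d [D0 D1]]. exists d; split; auto. intros t' It' Ht.
  eapply Rle_lt_trans. 2: apply (D1 t' It' Ht). eapply Rle_trans. 2: apply dist3_Z.
  unfold neg_z. replace (- pZ (g t') - - pZ (g t))%C with (- (pZ (g t') - pZ (g t)))%C by ring. rewrite Cmod_opp. lra.
Qed.
Lemma c_plus_rcont n g : path_in_N g -> rcont (c_plus n g).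
Proof.
  intros [_ H] t It eps He. destruct (H t It eps He) as [d [D0 D1]]. exists d; split; auto. intros t' It' Ht.
  eapply Rle_lt_trans. 2: apply (D1 t' It' Ht). eapply Rle_trans. 2: apply dist3_C.
  unfold c_plus. right. f_equal. ring.
Qed.
Lemma Copp_neq0 (a : C) : a <> 0 -> (- a)%C <> 0.
Proof. intros H E. apply H. replace a with (- - a)%C by ring. rewrite E. ring. Qed.
Lemma N_neg_z p : Nsharp p -> (- pZ p)%C <> 0.
Proof. intros [H _]. apply Copp_neq0; auto. Qed.
Lemma N_c_plus p n : Nsharp p -> (pC p + RtoC (INR n))%C <> 0.
Proof.
  intros (_ & _ & H) E. apply (H n). replace (pC p) with (pC p + RtoC (INR n) - RtoC (INR n))%C by ring. rewrite E, RtoC_opp. ring.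
Qed.
Lemma ybr_neq0 e m M p : Nsharp p -> cexp M = (- pZ p)%C -> ybr e m M <> 0.
Proof.
  intros (_ & H & _) HM E. apply H.
  assert (X := dir_ybr e m M). rewrite E in X.
  assert (EM : M = (- (dir e * RtoC ((2 * INR m + 1) * PI)))%C).
  { replace M with (dir e * RtoC ((2 * INR m + 1) * PI) + M - dir e * RtoC ((2 * INR m + 1) * PI))%C by ring. rewrite <- X. ring. }
  rewrite EM, cexp_opp, cexp_dir_odd in HM. replace (pZ p) with (- - pZ p)%C by ring. rewrite <- HM. field.
Qed.

(** The whole lift [M], not only its end value, is part of the statement: the logarithms [mu] follow
    [ybr e m (M t)], which is a function of the path only after [- z] has been lifted. These two
    levels of logarithms are the reason for two levels of commutators. *)
Definition transport (g : path) (M0 : C) (l0 : nat -> C) (mu0 : bool -> nat -> C) (M1 : C) (l1 : nat -> C) (mu1 : bool -> nat -> C) :=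
  (exists M, lift (neg_z g) M /\ M 0 = M0 /\ M 1 = M1 /\ forall e m, log_lift (fun t => ybr e m (M t)) (mu0 e m) (mu1 e m)) /\
  (forall n, log_lift (c_plus n g) (l0 n) (l1 n)).
(* The data carried along a path: [M = log (- z)], [l n = log (c + n)], [mu e m = log (ybr e m M)]. *)
Definition log_data (M : C) (l : nat -> C) (mu : bool -> nat -> C) (p : pt) :=
  cexp M = (- pZ p)%C /\ (forall n, cexp (l n) = (pC p + RtoC (INR n))%C) /\ (forall e m, cexp (mu e m) = ybr e m M).

Lemma ccont_ybr e m (M : R -> C) x : ccont M x -> ccont (fun t => ybr e m (M t)) x.
Proof. intros H. unfold ybr. apply ccont_minus. apply ccont_const. apply ccont_mult. apply ccont_const. auto. Qed.

Lemma transport_ex g M0 l0 mu0 : path_in_N g -> log_data M0 l0 mu0 (g 0) -> exists M1 l1 mu1, transport g M0 l0 mu0 M1 l1 mu1.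
Proof.
  intros Hg (V1 & V2 & V3). assert (HN := proj1 Hg).
  destruct (lift_ex (neg_z g) M0) as [M [LM EM]]; auto using neg_z_rcont. { intros; apply N_neg_z; auto. }
  destruct (choice (fun n b => log_lift (c_plus n g) (l0 n) b)) as [l1 Hl].
  { intros n. apply log_lift_ex. apply c_plus_rcont; auto. intros; apply N_c_plus; auto. apply V2. }
  assert (HY : forall e, exists f : nat -> C, forall m, log_lift (fun t => ybr e m (M t)) (mu0 e m) (f m)).
  { intros e. apply (choice (fun m b => log_lift (fun t => ybr e m (M t)) (mu0 e m) b)). intros m. apply log_lift_ex.
    - apply rcont_of_ccont. intros x. apply ccont_ybr. apply LM.
    - intros t It. apply (ybr_neq0 e m _ (g t)); auto. apply LM; auto.
    - rewrite EM. apply V3. }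
  destruct (choice (fun e f => forall m, log_lift (fun t => ybr e m (M t)) (mu0 e m) (f m)) HY) as [mu1 Hmu].
  exists (M 1), l1, mu1. split; auto. exists M. auto.
Qed.

Lemma transport_fun g M0 l0 mu0 M1 l1 mu1 M1' l1' mu1' : transport g M0 l0 mu0 M1 l1 mu1 -> transport g M0 l0 mu0 M1' l1' mu1' ->
  M1 = M1' /\ (forall n, l1 n = l1' n) /\ (forall e m, mu1 e m = mu1' e m).
Proof.
  intros [(M & L & E0 & E1 & Y) HL] [(M' & L' & E0' & E1' & Y') HL'].
  assert (EM : forall t, I01 t -> M t = M' t). { apply (lift_unique (neg_z g)); auto. congruence. }
  split; [|split].
  - rewrite <- E1, <- E1'. apply EM, I01_1.
  - intros n. eapply log_lift_fun; eauto.
  - intros e m. eapply log_lift_fun. apply Y. eapply log_lift_ext. 2: apply Y'. intros t It. cbv beta. rewrite EM; auto.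
Qed.

Lemma transport_cat g h M0 l0 mu0 M1 l1 mu1 M2 l2 mu2 : transport g M0 l0 mu0 M1 l1 mu1 -> transport h M1 l1 mu1 M2 l2 mu2 ->
  transport (concat g h) M0 l0 mu0 M2 l2 mu2.
Proof.
  intros [(M & L & E0 & E1 & Y) HL] [(M' & L' & E0' & E1' & Y') HL']. split.
  - exists (catC M M'). split; [|split; [|split]].
    + apply lift_ext with (f := catC (neg_z g) (neg_z h)). intros t _. symmetry. apply (catC_map (fun q => (- pZ q)%C) g h t).
      apply lift_cat; auto. congruence.
    + rewrite catC_0. auto.
    + rewrite catC_1. auto.
    + intros e m. eapply log_lift_ext. 2: eapply log_lift_cat; [apply Y|apply Y']. intros t _. symmetry. apply (catC_map (ybr e m)).
  - intros n. eapply log_lift_ext. 2: eapply log_lift_cat; [apply HL|apply HL']. intros t _. symmetry. apply (catC_map (fun q => (pC q + RtoC (INR n))%C) g h t).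
Qed.
Lemma transport_rev g M0 l0 mu0 M1 l1 mu1 : transport g M0 l0 mu0 M1 l1 mu1 -> transport (rev g) M1 l1 mu1 M0 l0 mu0.
Proof.
  intros [(M & L & E0 & E1 & Y) HL]. split.
  - exists (fun t => M (1 - t)). split; [|split; [|split]].
    + apply (lift_rev _ _ L).
    + rewrite Rminus_0_r. auto.
    + rewrite Rminus_diag. auto.
    + intros e m. apply (log_lift_rev _ _ _ (Y e m)).
  - intros n. apply (log_lift_rev _ _ _ (HL n)).
Qed.
Lemma transport_shift g M0 l0 mu0 M1 l1 mu1 mu0' : transport g M0 l0 mu0 M1 l1 mu1 -> (forall e m, cexp (mu0' e m) = cexp (mu0 e m)) ->
  transport g M0 l0 mu0' M1 l1 (fun e m => mu1 e m + (mu0' e m - mu0 e m))%C.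
Proof.
  intros [(M & L & E0 & E1 & Y) HL] H. split; auto. exists M. repeat (split; auto). intros e m. apply log_lift_shift; auto.
Qed.
Lemma transport_log_data g M0 l0 mu0 M1 l1 mu1 : transport g M0 l0 mu0 M1 l1 mu1 -> log_data M0 l0 mu0 (g 0) /\ log_data M1 l1 mu1 (g 1).
Proof.
  intros [(M & L & E0 & E1 & Y) HL]. subst. split; (split; [|split]).
  - apply L, I01_0.
  - intros n. apply (log_lift_end _ _ _ (HL n)).
  - intros e m. apply (log_lift_end _ _ _ (Y e m)).
  - apply L, I01_1.
  - intros n. apply (log_lift_end _ _ _ (HL n)).
  - intros e m. apply (log_lift_end _ _ _ (Y e m)).
Qed.

(** The homotopy of [- z] is lifted to the square first. The numbers [ybr] of that lift then form a
    homotopy with fixed ends that avoids 0, to which [log_lift_hom] applies once more. *)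
Lemma transport_hom g1 g2 M0 l0 mu0 M1 l1 mu1 : homotopic g1 g2 -> transport g1 M0 l0 mu0 M1 l1 mu1 -> transport g2 M0 l0 mu0 M1 l1 mu1.
Proof.
  intros (H & HN & HC & H0 & H1 & Hs & He) HT. destruct (transport_log_data _ _ _ _ _ _ _ HT) as [(V1 & V2 & V3) _].
  destruct HT as [(M & L & E0 & E1 & Y) HL].
  assert (Cz : rcont2 (fun u t => - pZ (H u t))%C).
  { intros u t Iu It eps Heps. destruct (HC u t Iu It eps Heps) as [d [D0 D1]]. exists d. split; auto. intros u' t' Iu' It' Hu Ht.
    eapply Rle_lt_trans. 2: apply (D1 u' t' Iu' It' Hu Ht). eapply Rle_trans. 2: apply dist3_Z.
    replace (- pZ (H u' t') - - pZ (H u t))%C with (- (pZ (H u' t') - pZ (H u t)))%C by ring. rewrite Cmod_opp. lra. }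
  assert (Cc : forall n, rcont2 (fun u t => pC (H u t) + RtoC (INR n))%C).
  { intros n u t Iu It eps Heps. destruct (HC u t Iu It eps Heps) as [d [D0 D1]]. exists d. split; auto. intros u' t' Iu' It' Hu Ht.
    eapply Rle_lt_trans. 2: apply (D1 u' t' Iu' It' Hu Ht). eapply Rle_trans. 2: apply dist3_C. right. f_equal. ring. }
  destruct (lift2 _ M0 Cz) as (l & LC & LE & LS).
  { intros; apply N_neg_z; auto. } { intros u Iu. rewrite Hs by auto. auto. }
  assert (LEnd := end_const l (- pZ (g1 1))%C LC).
  assert (LEnd' : forall u, I01 u -> l u 1 = l 0 1). { apply LEnd. intros u Iu. rewrite LE, He; auto using I01_1. }
  assert (EM : forall t, I01 t -> M t = l 0 t).
  { apply (lift_unique (neg_z g1)); auto.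
    - split. apply slice_ccont; auto. intros t It. rewrite LE, H0 by auto using I01_0. reflexivity.
    - rewrite LS; auto using I01_0. }
  split.
  - exists (l 1). split; [|split; [|split]].
    + split. apply slice_ccont; auto. intros t It. rewrite LE, H1 by auto using I01_1. reflexivity.
    + apply LS, I01_1.
    + rewrite LEnd' by apply I01_1. rewrite <- EM by apply I01_1. auto.
    + intros e m. apply (log_lift_hom (fun u t => ybr e m (l u t))).
      * apply rcont2_of_ccont. intros p. unfold ybr. apply ccont_minus. apply ccont_const. apply ccont_mult. apply ccont_const. apply LC.
      * intros u t Iu It. apply (ybr_neq0 e m _ (H u t)); auto.
      * intros u Iu. rewrite (LS u Iu), (LS 0 I01_0). auto.
      * intros u Iu. rewrite LEnd'; auto.
      * eapply log_lift_ext. 2: apply Y. intros t It. cbv beta. rewrite EM; auto.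
  - intros n. apply log_lift_ext with (f := fun t => (pC (H 1 t) + RtoC (INR n))%C).
    { intros t It. rewrite H1; auto. }
    apply (log_lift_hom (fun u t => (pC (H u t) + RtoC (INR n))%C)); auto.
    + intros u t Iu It. apply N_c_plus; auto.
    + intros u Iu. rewrite Hs, Hs; auto using I01_0.
    + intros u Iu. rewrite He, He; auto using I01_0.
    + eapply log_lift_ext. 2: apply HL. intros t It. unfold c_plus. rewrite H0; auto.
Qed.

(** * Values at the base point, where every logarithm is real, and loops *)

Definition start_l (n : nat) : C := RtoC (ln (1/2 + INR n)).
Definition start_mu (e : bool) (m : nat) : C := RtoC (ln ((2 * INR m + 1) * PI)).
Lemma cexp_R (x : R) : cexp (RtoC x) = RtoC (exp x).
Proof. apply C_eq; unfold cexp; simpl; rewrite ?cos_0, ?sin_0; ring. Qed.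
Lemma valid0 : log_data 0 start_l start_mu x0'.
Proof.
  split; [|split].
  - rewrite cexp_0. unfold x0', mkpt, pZ; simpl. apply C_eq; simpl; ring.
  - intros n. unfold start_l, x0', mkpt, pC; simpl. rewrite cexp_R, exp_ln. rewrite RtoC_plus. reflexivity.
    assert (X := pos_INR n). lra.
  - intros e m. unfold start_mu, ybr. rewrite cexp_R, exp_ln. ring. assert (X := pos_INR m). assert (Y := PI_RGT_0). nra.
Qed.

Lemma path_cat g h : path_in_N g -> path_in_N h -> g 1 = h 0 -> path_in_N (concat g h).
Proof.
  intros [A1 B1] [A2 B2] E. split.
  - intros t It. unfold concat, I01 in *. destruct Rle_dec; [apply A1|apply A2]; unfold I01; lra.
  - apply (dcont_cat dist3 I01 g h); auto; unfold I01; intros; lra.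
Qed.
Lemma concat_0 g h : concat g h 0 = g 0.
Proof. exact (catC_0 g h). Qed.
Lemma concat_1 g h : concat g h 1 = h 1.
Proof. exact (catC_1 g h). Qed.
Lemma path_rev g : path_in_N g -> path_in_N (rev g).
Proof.
  intros [A B]. split.
  - intros t It. apply A. unfold I01 in *; lra.
  - intros t It eps He. destruct (B (1 - t) ltac:(unfold I01 in *; lra) eps He) as [d [D0 D1]]. exists d. split; auto.
    intros y Iy Hy. apply D1. unfold I01 in *; lra. replace (1 - y - (1 - t)) with (- (y - t)) by ring. rewrite Rabs_Ropp. auto.
Qed.
Lemma loop_cat a b : loop_x0 a -> loop_x0 b -> loop_x0 (concat a b).
Proof.
  intros [[A1 A2] A3] [[B1 B2] B3]. split; [split|].
  apply path_cat; auto. congruence. rewrite concat_0; auto. rewrite concat_1; auto.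
Qed.
Lemma loop_rev a : loop_x0 a -> loop_x0 (rev a).
Proof.
  intros [[A1 A2] A3]. split; [split|]. apply path_rev; auto. unfold rev. rewrite Rminus_0_r; auto. unfold rev. rewrite Rminus_diag; auto.
Qed.
Lemma N_x0 : Nsharp x0'.
Proof.
  unfold Nsharp, x0', mkpt, pZ, pC; simpl. split; [|split].
  - intros E. apply RtoC_inj in E. lra.
  - intros E. apply RtoC_inj in E. lra.
  - intros n E. apply RtoC_inj in E. assert (X := pos_INR n). lra.
Qed.
Lemma loop_const : loop_x0 (cpath x0').
Proof.
  split; [split|]; try reflexivity. split. intros; apply N_x0. intros t It eps He. exists 1. split. lra. intros.
  unfold cpath, dist3. replace (pS x0' - pS x0')%C with (RtoC 0) by ring. replace (pZ x0' - pZ x0')%C with (RtoC 0) by ring. replace (pC x0' - pC x0')%C with (RtoC 0) by ring.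
  rewrite Cmod_0. rewrite (Rmax_left 0 0) by lra. rewrite (Rmax_left 0 0); lra.
Qed.

(** * Increments of logarithms along commutators *)

Definition log_incr (f : R -> C) (d : C) := forall a, cexp a = f 0 -> log_lift f a (a + d)%C.
Lemma log_incr_ex f a b : log_lift f a b -> log_incr f (b - a)%C.
Proof.
  intros HL a' Ha'. destruct (log_lift_end _ _ _ HL) as [E _]. replace (a' + (b - a))%C with (b + (a' - a))%C by ring.
  apply log_lift_shift; auto. congruence.
Qed.
Lemma log_incr_ext f g d : (forall t, I01 t -> f t = g t) -> log_incr f d -> log_incr g d.
Proof. intros H HI a Ha. eapply log_lift_ext. apply H. apply HI. rewrite H; auto using I01_0. Qed.
Lemma log_incr_cat f g d e : f 1 = g 0 -> log_incr f d -> log_incr g e -> log_incr (catC f g) (d + e)%C.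
Proof.
  intros E Hf Hg a Ha. rewrite catC_0 in Ha. specialize (Hf a Ha).
  eapply log_lift_cat. apply Hf. replace (a + (d + e))%C with (a + d + e)%C by ring. apply Hg. rewrite <- E. apply (log_lift_end _ _ _ Hf).
Qed.
Lemma log_incr_rev f d a0 : cexp a0 = f 0 -> log_incr f d -> log_incr (fun t => f (1 - t)) (- d)%C.
Proof.
  intros H0 Hf. assert (X := Hf a0 H0). apply log_lift_rev in X. apply log_incr_ex in X.
  replace (- d)%C with (a0 - (a0 + d))%C by ring. auto.
Qed.

(** Only the first level of logarithms is required to return; the [mu e m] may still change. *)
Definition null_incr (tau : path) := loop_x0 tau /\ log_incr (neg_z tau) 0 /\ forall n, log_incr (c_plus n tau) 0.

Lemma log_incr_neg_z_cat a b d e : a 1 = b 0 -> log_incr (neg_z a) d -> log_incr (neg_z b) e -> log_incr (neg_z (concat a b)) (d + e)%C.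
Proof.
  intros E Ha Hb. eapply log_incr_ext. 2: apply log_incr_cat; [|apply Ha|apply Hb]. intros t _. symmetry. apply (catC_map (fun q => (- pZ q)%C) a b t).
  unfold neg_z. rewrite E; auto.
Qed.
Lemma log_incr_c_plus_cat n a b d e : a 1 = b 0 -> log_incr (c_plus n a) d -> log_incr (c_plus n b) e -> log_incr (c_plus n (concat a b)) (d + e)%C.
Proof.
  intros E Ha Hb. eapply log_incr_ext. 2: apply log_incr_cat; [|apply Ha|apply Hb]. intros t _. symmetry. apply (catC_map (fun q => (pC q + RtoC (INR n))%C) a b t).
  unfold c_plus. rewrite E; auto.
Qed.

(** The increment of a logarithm is additive under concatenation and odd under reversal, so that of
    a commutator is [da + db - da - db = 0]. *)
Lemma pi1'_null_incr tau : pi1' tau -> null_incr tau.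
Proof.
  intros H. induction H as [a b Ha Hb| |a b _ IHa _ IHb|a _ IHa|a b _ IHa Hb Hab].
  - assert (HL : loop_x0 (concat (concat (concat a b) (rev a)) (rev b))) by auto using loop_cat, loop_rev.
    split; auto.
    destruct valid0 as (V1 & V2 & V3).
    assert (Ea0 : a 0 = x0') by apply Ha. assert (Ea1 : a 1 = x0') by apply Ha.
    assert (Eb0 : b 0 = x0') by apply Hb. assert (Eb1 : b 1 = x0') by apply Hb.
    (* Stated for any function on the space that is continuous along paths and has no zero, to cover
       [- z] and all [c + n] at once. *)
    assert (G : forall f : pt -> C, (forall g, path_in_N g -> rcont (fun t => f (g t))) -> (forall p, Nsharp p -> f p <> 0) ->
       forall l, cexp l = f x0' -> log_incr (fun t => f (concat (concat (concat a b) (rev a)) (rev b) t)) 0).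
    { intros f Hc Hn l Hl.
      assert (Hx : forall g, loop_x0 g -> exists d, log_incr (fun t => f (g t)) d).
      { intros g [[G1 G2] G3]. destruct (log_lift_ex (fun t => f (g t)) l) as [c Hcc]; auto. intros t It; apply Hn, G1; auto. rewrite G2; auto.
        eexists. eapply log_incr_ex; eauto. }
      destruct (Hx a Ha) as [da Ia]. destruct (Hx b Hb) as [db Ib].
      assert (Ira := log_incr_rev (fun t => f (a t)) da l ltac:(cbv beta; rewrite Ea0; auto) Ia).
      assert (Irb := log_incr_rev (fun t => f (b t)) db l ltac:(cbv beta; rewrite Eb0; auto) Ib).
      replace (RtoC 0) with (da + db + - da + - db)%C by ring.
      assert (Cat : forall g h d e, g 1 = h 0 -> log_incr (fun t => f (g t)) d -> log_incr (fun t => f (h t)) e -> log_incr (fun t => f (concat g h t)) (d + e)%C).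
      { intros g h d e E Hg Hh. eapply log_incr_ext. 2: apply log_incr_cat; [|apply Hg|apply Hh]. intros t _. symmetry. apply (catC_map f g h t).
        cbv beta. rewrite E; auto. }
      apply Cat; [|apply Cat; [|apply Cat|]|]; auto.
      - rewrite concat_1. unfold rev. rewrite Rminus_0_r, Rminus_diag. congruence.
      - rewrite concat_1. unfold rev. rewrite Rminus_0_r. congruence.
      - congruence. }
    split.
    + apply (G (fun q => - pZ q)%C) with (l := RtoC 0); auto. apply neg_z_rcont. apply N_neg_z.
    + intros n. apply (G (fun q => pC q + RtoC (INR n))%C) with (l := start_l n); auto. apply c_plus_rcont. intros; apply N_c_plus; auto.
  - split. apply loop_const. split.
    + intros c Hc. rewrite Cplus_0_r. apply log_lift_const. intros; rewrite Hc; reflexivity.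
    + intros n c Hc. rewrite Cplus_0_r. apply log_lift_const. intros; rewrite Hc; reflexivity.
  - destruct IHa as (A1 & A2 & A3). destruct IHb as (B1 & B2 & B3).
    assert (E : a 1 = b 0) by (destruct A1 as [_ ->]; destruct B1 as [[_ ->] _]; auto).
    split. apply loop_cat; auto. replace (RtoC 0) with (0 + 0)%C by ring. split.
    + apply log_incr_neg_z_cat; auto.
    + intros n. apply log_incr_c_plus_cat; auto.
  - destruct IHa as (A1 & A2 & A3). destruct valid0 as (V1 & V2 & V3).
    assert (Ea0 : a 0 = x0') by apply A1.
    split. apply loop_rev; auto. replace (RtoC 0) with (- 0)%C by ring. split.
    + apply (log_incr_rev (neg_z a) 0 0); auto. unfold neg_z. rewrite Ea0. auto.
    + intros n. apply (log_incr_rev (c_plus n a) 0 (start_l n)); auto. unfold c_plus. rewrite Ea0. auto.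
  - destruct IHa as (A1 & A2 & A3). split; auto.
    destruct (transport_ex a 0 start_l start_mu) as (M1 & l1 & mu1 & T1). apply A1. destruct A1 as [[_ ->] _]. apply valid0.
    assert (T2 := transport_hom _ _ _ _ _ _ _ _ Hab T1).
    destruct valid0 as (V1 & V2 & V3). assert (Ea0 : a 0 = x0') by apply A1.
    destruct T1 as [(M & L & E0 & E1 & _) HL]. destruct T2 as [(M' & L' & E0' & E1' & _) HL'].
    split.
    + assert (X : log_lift (neg_z a) 0 M1) by (exists M; auto). assert (X' : log_lift (neg_z b) 0 M1) by (exists M'; auto).
      specialize (A2 0 ltac:(unfold neg_z; rewrite Ea0; auto)). rewrite (log_lift_fun _ _ _ _ X A2) in X'.
      apply log_incr_ex in X'. replace (RtoC 0) with (0 + 0 - 0)%C by ring. auto.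
    + intros n. specialize (A3 n (start_l n) ltac:(unfold c_plus; rewrite Ea0; auto)). specialize (HL n). specialize (HL' n).
      rewrite (log_lift_fun _ _ _ _ HL A3) in HL'. apply log_incr_ex in HL'. replace (RtoC 0) with (start_l n + 0 - start_l n)%C by ring. auto.
Qed.

(* The shift [d] does not depend on the starting branch [mu], so it cancels in commutators. *)
Lemma null_incr_transport tau : null_incr tau -> exists d : bool -> nat -> C, forall mu, (forall e m, cexp (mu e m) = ybr e m 0) ->
  transport tau 0 start_l mu 0 start_l (fun e m => mu e m + d e m)%C.
Proof.
  intros (H1 & H2 & H3). assert (E0 : tau 0 = x0') by apply H1.
  destruct valid0 as (V1 & V2 & V3).
  destruct (transport_ex tau 0 start_l start_mu) as (M1 & l1 & mu1 & T1). apply H1. rewrite E0. apply valid0.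
  assert (EM : M1 = 0).
  { destruct T1 as [(M & L & F0 & F1 & _) _]. assert (X : log_lift (neg_z tau) 0 M1) by (exists M; auto).
    specialize (H2 0 ltac:(unfold neg_z; rewrite E0; auto)). rewrite (log_lift_fun _ _ _ _ X H2). ring. }
  assert (El : l1 = start_l).
  { extensionality n. destruct T1 as [_ HL]. specialize (H3 n (start_l n) ltac:(unfold c_plus; rewrite E0; auto)).
    rewrite (log_lift_fun _ _ _ _ (HL n) H3). ring. }
  subst. exists (fun e m => mu1 e m - start_mu e m)%C. intros mu Hmu.
  assert (X := transport_shift _ _ _ _ _ _ _ mu T1 ltac:(intros; rewrite Hmu, V3; auto)).
  replace (fun e m => mu e m + (mu1 e m - start_mu e m))%C with (fun e m => mu1 e m + (mu e m - start_mu e m))%C; auto.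
  extensionality e. extensionality m. ring.
Qed.

(** Loops of the commutator subgroup act on the branches of [mu] by translations, and translations
    commute. *)
Lemma pi1''_transport tau : pi1'' tau -> loop_x0 tau /\ transport tau 0 start_l start_mu 0 start_l start_mu.
Proof.
  assert (V3 : forall e m, cexp (start_mu e m) = ybr e m 0) by apply valid0.
  intros H. induction H as [a b Ha Hb| |a b _ IHa _ IHb|a _ IHa|a b _ IHa Hb Hab].
  - apply pi1'_null_incr in Ha. apply pi1'_null_incr in Hb.
    split. { destruct Ha as [La _]. destruct Hb as [Lb _]. auto using loop_cat, loop_rev. }
    destruct (null_incr_transport a Ha) as [da Ta]. destruct (null_incr_transport b Hb) as [db Tb].
    assert (T1 := Ta start_mu V3).
    assert (W1 : forall e m, cexp (start_mu e m + da e m)%C = ybr e m 0) by apply (transport_log_data _ _ _ _ _ _ _ T1).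
    assert (T2 := Tb _ W1). cbv beta in T2.
    assert (W2 : forall e m, cexp (start_mu e m + da e m + db e m)%C = ybr e m 0) by apply (transport_log_data _ _ _ _ _ _ _ T2).
    assert (T4 := Tb start_mu V3).
    assert (W3 : forall e m, cexp (start_mu e m + db e m)%C = ybr e m 0) by apply (transport_log_data _ _ _ _ _ _ _ T4).
    assert (T3 := Ta _ W3). cbv beta in T3.
    (* Here commutativity enters: [b] followed by [a] ends on the same branch as [a] followed by
       [b], so that the reversed transports [T3] and [T4] can be attached to [T1] and [T2]. *)
    replace (fun e m => start_mu e m + db e m + da e m)%C with (fun e m => start_mu e m + da e m + db e m)%C in T3.
    2: { extensionality e; extensionality m; ring. }
    apply transport_rev in T3. apply transport_rev in T4.
    eapply transport_cat. eapply transport_cat. eapply transport_cat. apply T1. apply T2. apply T3. apply T4.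
  - split. apply loop_const. split.
    + exists (fun _ => RtoC 0). split; [|split; [|split]]; auto.
      * split. intros; apply ccont_const. intros t _. apply valid0.
      * intros e m. apply log_lift_const. intros; auto.
    + intros n. apply log_lift_const. intros t _. symmetry. apply valid0.
  - destruct IHa, IHb. split. apply loop_cat; auto. eapply transport_cat; eauto.
  - destruct IHa. split. apply loop_rev; auto. apply transport_rev; auto.
  - destruct IHa. split; auto. eapply transport_hom; eauto.
Qed.

(** * The continuation *)

Definition half_shift (N : nat) (c : C) : C := (c + RtoC (INR N - 1 / 2))%C.
(* [N] terms of the Lerch series, the rest being given by the reflected sum at [b = c + N - 1/2]. *)
Definition Zval (J N : nat) (p : pt) (M : C) (l : nat -> C) (mu : bool -> nat -> C) : C :=
  (csum (fun n => Cpow (pZ p) n * cexp (- (pS p * l n))) N +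
   alt_sign N * cexp (RtoC (INR N - 1 / 2) * M) * Phi_half J (pS p) (half_shift N (pC p)) M mu)%C.
(** The bound is 1/2 rather than 0 so that [half_shift n c] lies in the right half-plane. *)
Definition principal_l (l : nat -> C) (c : C) (N0 : nat) :=
  forall n, (N0 <= n)%nat -> 1 / 2 < fst (c + RtoC (INR n))%C /\ l n = Clog (c + RtoC (INR n))%C.

Lemma Cpow_z (z M : C) n : cexp M = (- z)%C -> Cpow z n = (alt_sign n * cexp (RtoC (INR n) * M))%C.
Proof.
  intros H. induction n.
  - simpl. unfold alt_sign; simpl. replace (0 * M)%C with (RtoC 0) by ring. rewrite cexp_0. ring.
  - rewrite Cpow_S, IHn, alt_sign_S, S_INR, RtoC_plus.
    replace ((INR n + 1) * M)%C with (INR n * M + M)%C by ring. rewrite cexp_plus, H. ring.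
Qed.

Lemma half_shift_pos N c : 1 / 2 < fst (c + RtoC (INR N))%C -> 0 < fst (half_shift N c).
Proof. unfold half_shift. simpl. lra. Qed.

(** At [b = c + N - 1/2] the midpoint [b + 1/2] in [Phi_half_shift] is [c + N], so the right side of
    that identity, multiplied by the prefactor of [Zval], is the next term of the series. *)
Lemma Zval_stepN J0 J N p M l mu : log_data M l mu p -> principal_mu M mu J0 -> (J0 <= J)%nat ->
  1 / 2 < fst (pC p + RtoC (INR N))%C -> l N = Clog (pC p + RtoC (INR N))%C -> Zval J (S N) p M l mu = Zval J N p M l mu.
Proof.
  intros (V1 & V2 & V3) Hp HJ Hc Hl. unfold Zval. rewrite csum_S.
  assert (Hb := half_shift_pos N (pC p) Hc). set (s := pS p). set (b := half_shift N (pC p)) in *.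
  assert (Eb : half_shift (S N) (pC p) = (b + 1)%C).
  { unfold b, half_shift. rewrite S_INR. replace (INR N + 1 - 1/2) with (INR N - 1/2 + 1) by ring. rewrite RtoC_plus. ring. }
  assert (Eb2 : (b + 1 / 2)%C = (pC p + RtoC (INR N))%C).
  { unfold b, half_shift. replace (INR N) with (INR N - 1/2 + 1/2) at 2 by ring. rewrite RtoC_plus, (RtoC_div 1 2) by lra. ring. }
  assert (X := Phi_half_shift J0 J s b M mu Hb V3 Hp HJ). rewrite Eb2, <- Hl in X.
  rewrite Eb. rewrite (Cpow_z (pZ p) M N V1), alt_sign_S.
  assert (E1 : cexp (RtoC (INR (S N) - 1/2) * M)%C = (cexp (RtoC (INR N - 1/2) * M) * cexp M)%C).
  { rewrite <- cexp_plus. f_equal. rewrite S_INR. replace (INR N + 1 - 1/2) with (INR N - 1/2 + 1) by ring. rewrite RtoC_plus. ring. }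
  assert (E2 : cexp (RtoC (INR N) * M)%C = (cexp (RtoC (INR N - 1/2) * M) * cexp (M / 2))%C).
  { rewrite <- cexp_plus. f_equal. replace (INR N) with (INR N - 1/2 + 1/2) at 1 by ring. rewrite RtoC_plus, (RtoC_div 1 2) by lra. field. }
  replace (Phi_half J s b M mu) with (cexp (M / 2 - s * l N) - cexp M * Phi_half J s (b + 1) M mu)%C by (rewrite <- X; ring).
  rewrite E1, E2. unfold Cminus at 2. rewrite cexp_plus. ring.
Qed.

Lemma Zval_indep J0 N0 J N p M l mu : log_data M l mu p -> principal_mu M mu J0 -> principal_l l (pC p) N0 -> (J0 <= J)%nat -> (N0 <= N)%nat ->
  Zval J N p M l mu = Zval J0 N0 p M l mu.
Proof.
  intros HV Hp Hc HJ HN. transitivity (Zval J0 N p M l mu).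
  - unfold Zval. rewrite (Phi_half_indep J0 J) by (auto; apply half_shift_pos, (Hc N HN)). reflexivity.
  - induction HN as [|m HN IH]. reflexivity. rewrite <- IH. destruct (Hc m HN). apply (Zval_stepN J0 J0); auto.
Qed.

(** A relation, since [J] and [N] are any thresholds beyond which all logarithms are principal;
    [Zval_indep] shows that the choice is immaterial. *)
Definition ZtVal (g : path) (X : C) := exists M l mu J N, transport g 0 start_l start_mu M l mu /\ principal_mu M mu J /\ principal_l l (pC (g 1)) N /\
  X = Zval J N (g 1) M l mu.

Lemma ZtVal_fun g X Y : ZtVal g X -> ZtVal g Y -> X = Y.
Proof.
  intros (M & l & mu & J & N & T1 & P & Q & ->) (M' & l' & mu' & J' & N' & T2 & P' & Q' & ->).
  destruct (transport_fun _ _ _ _ _ _ _ _ _ _ T1 T2) as (E1 & E2 & E3). subst M'.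
  assert (l = l') by (extensionality n; auto). assert (mu = mu') by (extensionality e; extensionality m; auto). subst l' mu'.
  destruct (transport_log_data _ _ _ _ _ _ _ T1) as [_ V].
  rewrite <- (Zval_indep J N (Nat.max J J') (Nat.max N N') (g 1) M l mu) by (auto; lia).
  rewrite <- (Zval_indep J' N' (Nat.max J J') (Nat.max N N') (g 1) M l mu) by (auto; lia). reflexivity.
Qed.

Lemma Clog_R (x : R) : 0 < x -> Clog (RtoC x) = RtoC (ln x).
Proof.
  intros H. unfold Clog. rewrite Cmod_R, Rabs_right by lra. apply C_eq; simpl; auto. unfold Rdiv. rewrite Rmult_0_l. apply atan_0.
Qed.

(** As long as [ybr] stays in the right half-plane, its continuous logarithm and the principal one
    start at the same real value and hence coincide along the path. *)
Lemma principal_mu_mu g M l mu Mf e m : lift (neg_z g) Mf -> Mf 0 = 0 -> transport g 0 start_l start_mu M l mu ->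
  (forall t, I01 t -> 0 < fst (ybr e m (Mf t))) -> 0 < fst (ybr e m M) /\ mu e m = Clog (ybr e m M).
Proof.
  intros HL H0 [(M' & L' & E0 & E1 & Y) _] Hp.
  assert (EM : forall t, I01 t -> M' t = Mf t) by (apply (lift_unique (neg_z g)); auto; congruence).
  rewrite <- E1, EM by apply I01_1. split. apply Hp, I01_1.
  assert (X : log_lift (fun t => ybr e m (Mf t)) (Clog (ybr e m (Mf 0))) (Clog (ybr e m (Mf 1)))).
  { apply (log_lift_Clog (fun t => ybr e m (Mf t))); auto. apply rcont_of_ccont. intros x; apply ccont_ybr. apply HL. }
  eapply log_lift_fun. 2: apply X.
  replace (Clog (ybr e m (Mf 0))) with (start_mu e m). eapply log_lift_ext. 2: apply Y. intros t It; cbv beta; rewrite EM; auto.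
  rewrite H0. unfold ybr, start_mu. replace (RtoC ((2 * INR m + 1) * PI) - dir e * 0)%C with (RtoC ((2 * INR m + 1) * PI)) by ring.
  rewrite Clog_R; auto. assert (Z := pos_INR m). assert (Z2 := PI_RGT_0). nra.
Qed.
Lemma principal_mu_l g M l mu n : path_from_x0 g -> transport g 0 start_l start_mu M l mu ->
  (forall t, I01 t -> 0 < fst (c_plus n g t)) -> l n = Clog (pC (g 1) + RtoC (INR n))%C.
Proof.
  intros [Hg Hg0] [_ HL] Hp.
  assert (X := log_lift_Clog (c_plus n g) (c_plus_rcont n g Hg) Hp).
  eapply log_lift_fun. 2: apply X. replace (Clog (c_plus n g 0)) with (start_l n). apply HL.
  unfold c_plus. rewrite Hg0. unfold x0', start_l, mkpt, pC; simpl. rewrite <- RtoC_plus. rewrite Clog_R; auto. assert (Z := pos_INR n). lra.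
Qed.

Lemma ybr_re_bound e m M : (2 * INR m + 1) * 3 - Cmod M <= fst (ybr e m M).
Proof.
  unfold ybr. change (fst (RtoC ((2 * INR m + 1) * PI) - dir e * M)%C) with ((2 * INR m + 1) * PI - fst (dir e * M)%C).
  assert (fst (dir e * M)%C <= Cmod M). { eapply Rle_trans. apply Rle_abs. eapply Rle_trans. apply Cmod_fst. rewrite Cmod_mult, dir_mod by apply dir_unit. lra. }
  assert (X := PI2_3_2). assert (Y := pos_INR m). nra.
Qed.

Lemma principal_mu_of_bound g M l mu Mf K J : lift (neg_z g) Mf -> Mf 0 = 0 -> transport g 0 start_l start_mu M l mu ->
  (forall t, I01 t -> Cmod (Mf t) <= K) -> K <= INR J -> principal_mu M mu J.
Proof.
  intros HL H0 HT HK HJ e m Hm. apply (principal_mu_mu g M l mu Mf); auto. intros t It.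
  assert (X := ybr_re_bound e m (Mf t)). specialize (HK t It). apply le_INR in Hm. assert (Y := pos_INR m). lra.
Qed.
Lemma principal_l_of_bound g M l mu K N : path_from_x0 g -> transport g 0 start_l start_mu M l mu ->
  (forall t, I01 t -> Cmod (pC (g t)) <= K) -> K + 1 <= INR N -> principal_l l (pC (g 1)) N.
Proof.
  intros Hg HT HK HN n Hn. apply le_INR in Hn.
  assert (Hp : forall t, I01 t -> 1 / 2 < fst (c_plus n g t)).
  { intros t It. specialize (HK t It). unfold c_plus. simpl. assert (X := Cmod_fst (pC (g t))).
    assert (Y : Rabs (fst (pC (g t))) <= K) by lra. apply Rabs_le_between in Y. lra. }
  split. apply (Hp 1 I01_1). apply (principal_mu_l g M l mu); auto. intros t It. specialize (Hp t It). lra.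
Qed.

Lemma path_bounds g Mf : path_in_N g -> lift (neg_z g) Mf -> exists K, 0 <= K /\ forall t, I01 t -> Cmod (Mf t) <= K /\ Cmod (pC (g t)) <= K.
Proof.
  intros Hg HL.
  destruct (ccont_bounded Mf 0 1 Rle_0_1 (proj1 HL)) as [K1 [P1' B1]].
  destruct (ccont_bounded (fun t => c_plus 0 g (clamp t)) 0 1 Rle_0_1 (rcont_clamp _ (c_plus_rcont 0 g Hg))) as [K2 [P2 B2]].
  exists (K1 + K2). split. lra. intros t It. specialize (B1 t It). specialize (B2 t It). rewrite clamp_id in B2 by auto.
  unfold c_plus in B2. simpl in B2. rewrite Cplus_0_r in B2. lra.
Qed.

Lemma ZtVal_ex g : path_from_x0 g -> exists X, ZtVal g X.
Proof.
  intros [Hg H0].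
  destruct (transport_ex g 0 start_l start_mu Hg) as (M & l & mu & HT). rewrite H0; apply valid0.
  destruct (HT) as [(Mf & L & E0 & E1 & _) _].
  destruct (path_bounds g Mf Hg L) as (K & HK0 & HK).
  destruct (nfloor_ex K HK0) as [N HN].
  (* [S N] exceeds the bound [K] for [M]; one more unit keeps [Re (c + n)] above 1/2 along the
     path. *)
  exists (Zval (S N) (S (S N)) (g 1) M l mu), M, l, mu, (S N), (S (S N)). repeat split; auto.
  - apply HT.
  - apply HT.
  - eapply (principal_mu_of_bound g M l mu Mf K); eauto. intros; apply HK; auto. rewrite S_INR; lra.
  - eapply (principal_mu_of_bound g M l mu Mf K); eauto. intros; apply HK; auto. rewrite S_INR; lra.
  - eapply (principal_l_of_bound g M l mu K); eauto. split; auto. intros; apply HK; auto. rewrite !S_INR; lra.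
  - eapply (principal_l_of_bound g M l mu K); eauto. split; auto. intros; apply HK; auto. rewrite !S_INR; lra.
Qed.

(* The second clause only concerns [z] in [0,1): the segment from [-1] to [z] then meets the puncture [0]. *)
Definition Zt (g : path) : C := epsilon (inhabits (RtoC 0))
  (fun X => (path_from_x0 g -> ZtVal g X) /\ (~ path_from_x0 g -> lerch_sum (g 1) X)).
Lemma Zt_path g : path_from_x0 g -> ZtVal g (Zt g).
Proof.
  intros Hg. destruct (ZtVal_ex g Hg) as [X HX].
  assert (S := epsilon_spec (inhabits (RtoC 0)) (fun X => (path_from_x0 g -> ZtVal g X) /\ (~ path_from_x0 g -> lerch_sum (g 1) X))).
  apply S; auto. exists X. split; auto. tauto.
Qed.
Lemma Zt_val g X : path_from_x0 g -> ZtVal g X -> Zt g = X.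
Proof. intros Hg HX. apply (ZtVal_fun g); auto. apply Zt_path; auto. Qed.
Lemma Zt_nopath g X : ~ path_from_x0 g -> lerch_sum (g 1) X -> lerch_sum (g 1) (Zt g).
Proof.
  intros Hg HX.
  assert (S := epsilon_spec (inhabits (RtoC 0)) (fun X => (path_from_x0 g -> ZtVal g X) /\ (~ path_from_x0 g -> lerch_sum (g 1) X))).
  apply S; auto. exists X. split; auto. tauto.
Qed.

Lemma Zt_hom g1 g2 : path_from_x0 g1 -> path_from_x0 g2 -> g1 1 = g2 1 -> homotopic g1 g2 -> Zt g1 = Zt g2.
Proof.
  intros H1 H2 E Hh. apply Zt_val; auto. destruct (Zt_path g2 H2) as (M & l & mu & J & N & HT & P & Q & EX).
  destruct (Zt_path g1 H1) as (M' & l' & mu' & J' & N' & HT' & P' & Q' & EX').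
  assert (X := transport_hom _ _ _ _ _ _ _ _ Hh HT').
  destruct (transport_fun _ _ _ _ _ _ _ _ _ _ X HT) as (E1 & E2 & E3). subst M'.
  assert (l' = l) by (extensionality n; auto). assert (mu' = mu) by (extensionality e; extensionality m; auto). subst l' mu'.
  exists M, l, mu, J, N. rewrite E. auto.
Qed.

(** After [tau] all transported data are back at their starting values, so [g] carries them to the
    same end as without [tau]. *)
Lemma Zt_mono tau g : pi1'' tau -> path_from_x0 g -> Zt (concat tau g) = Zt g.
Proof.
  intros Ht Hg. destruct (pi1''_transport tau Ht) as [[[L1 L2] L3] T].
  assert (Hc : path_from_x0 (concat tau g)).
  { split. apply path_cat; auto. apply Hg. destruct Hg as [_ ->]; auto. rewrite concat_0; auto. }
  apply Zt_val; auto. destruct (Zt_path g Hg) as (M & l & mu & J & N & HT & P & Q & EX).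
  exists M, l, mu, J, N. rewrite concat_1. split; auto. eapply transport_cat; eauto.
Qed.

(** * Local charts at the end point of a path *)

Lemma dist3_lub p q M : Cmod (pS p - pS q)%C <= M -> Cmod (pZ p - pZ q)%C <= M -> Cmod (pC p - pC q)%C <= M -> dist3 p q <= M.
Proof. intros. unfold dist3. repeat apply Rmax_lub; auto. Qed.
Lemma dist3_pos p q : 0 <= dist3 p q.
Proof. eapply Rle_trans. 2: apply dist3_S. apply Cmod_ge_0. Qed.
Lemma dist3_add p h q : dist3 (padd p h) q <= nrm h + dist3 p q.
Proof.
  assert (A := nrm_S h). assert (B := nrm_Z h). assert (C0 := nrm_C h).
  assert (A' := dist3_S p q). assert (B' := dist3_Z p q). assert (C0' := dist3_C p q).
  assert (E : forall a b c : C, Cmod (a + b - c)%C <= Cmod b + Cmod (a - c)%C).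
  { intros. replace (a + b - c)%C with (b + (a - c))%C by ring. apply Cmod_triangle. }
  apply dist3_lub; (eapply Rle_trans; [apply E|apply Rplus_le_compat; assumption]).
Qed.

Lemma seg_0 p q : seg p q 0 = p.
Proof. destruct p as [[a b] c]. unfold seg, mkpt, pS, pZ, pC; simpl. f_equal; [f_equal|]; ring. Qed.
Lemma seg_1 p q : seg p q 1 = q.
Proof. destruct q as [[a b] c]. unfold seg, mkpt, pS, pZ, pC; simpl. f_equal; [f_equal|]; ring. Qed.
Lemma seg_lip p q t t' : dist3 (seg p q t') (seg p q t) <= Rabs (t' - t) * dist3 q p.
Proof.
  assert (A := dist3_S q p). assert (B := dist3_Z q p). assert (C0 := dist3_C q p). assert (Z := Rabs_pos (t' - t)).
  assert (E : forall a b : C, Cmod (a + t' * (b - a) - (a + t * (b - a)))%C = Rabs (t' - t) * Cmod (b - a)%C).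
  { intros. rewrite <- Cmod_R, <- Cmod_mult. f_equal. rewrite RtoC_minus. ring. }
  apply dist3_lub; (eapply Rle_trans; [right; apply E|apply Rmult_le_compat_l; assumption]).
Qed.
Lemma seg_dist p q t : I01 t -> dist3 (seg p q t) p <= dist3 q p.
Proof.
  intros [T0 T1]. assert (X := seg_lip p q 0 t). rewrite seg_0, Rminus_0_r, Rabs_right in X by lra.
  assert (Y := dist3_pos q p). nra.
Qed.
Lemma seg_path p q : (forall t, I01 t -> Nsharp (seg p q t)) -> path_in_N (seg p q).
Proof.
  intros H. split; auto. intros t It eps He. assert (D := dist3_pos q p).
  exists (eps / (dist3 q p + 1)). split. apply Rdiv_lt_0_compat; lra. intros t' _ Ht.
  eapply Rle_lt_trans. apply seg_lip. apply Rlt_div_r in Ht; [|lra]. assert (Z := Rabs_pos (t' - t)). nra.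
Qed.

(** Half the modulus puts [f / f0] within [1/2] of 1, the range of the estimates for
    [Clog (1 + q)]. *)
Definition near (f0 f : C) := Cmod (f - f0)%C <= Cmod f0 / 2.
Lemma near_ratio (f0 f : C) : f0 <> 0 -> near f0 f -> 0 < fst (f / f0)%C /\ Cmod (Clog (f / f0)%C) <= 2 * (Cmod (f - f0)%C / Cmod f0).
Proof.
  intros Hn H. unfold near in H. assert (Hm := proj1 (Cmod_gt_0 f0) Hn).
  assert (Hq : Cmod ((f - f0) / f0)%C <= 1/2). { rewrite Cmod_div by auto. apply Rle_div_l; lra. }
  replace (f / f0)%C with (1 + (f - f0) / f0)%C by (field; auto). split.
  - apply Clog_1_re; auto.
  - rewrite <- Cmod_div by auto. apply Clog_1_bound1; auto.
Qed.
Lemma near_lift (f : R -> C) (a : C) : rcont f -> f 0 <> 0 -> cexp a = f 0 -> (forall t, I01 t -> near (f 0) (f t)) ->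
  lift f (fun t => a + Clog (f (clamp t) / f 0))%C.
Proof.
  intros Hc Hn Ha Hq. split.
  - intros x. apply ccont_plus. apply ccont_const. apply ccont_Clog.
    apply ccont_div. apply rcont_clamp; auto. apply ccont_const. auto.
    apply near_ratio; auto. apply Hq, clamp_I.
  - intros t It. rewrite cexp_plus, cexp_Clog, Ha, clamp_id by (auto; apply near_ratio; auto; apply Hq, clamp_I). field; auto.
Qed.
Lemma Clog_self (a : C) : a <> 0 -> Clog (a / a)%C = 0.
Proof. intros. replace (a / a)%C with (RtoC 1) by (field; auto). apply Clog_1. Qed.
Lemma near_log_lift (f : R -> C) (a : C) : rcont f -> f 0 <> 0 -> cexp a = f 0 -> (forall t, I01 t -> near (f 0) (f t)) ->
  log_lift f a (a + Clog (f 1 / f 0))%C.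
Proof.
  intros. exists (fun t => a + Clog (f (clamp t) / f 0))%C. split. apply near_lift; auto.
  rewrite !clamp_id by auto using I01_0, I01_1. split; auto. rewrite Clog_self by auto. ring.
Qed.

Section Chart.
Variables (p0 : pt) (M0 : C) (l0 : nat -> C) (mu0 : bool -> nat -> C).
Hypothesis HV : log_data M0 l0 mu0 p0.
Hypothesis HN : Nsharp p0.
Variable rho : R.
Hypothesis rho_pos : 0 < rho.
Hypothesis rhoz : rho <= Cmod (pZ p0) / 2.
Hypothesis rhoz1 : rho <= Cmod (pZ p0 - 1)%C / 2.
Hypothesis rhoc : forall n, rho <= Cmod (pC p0 + RtoC (INR n))%C / 2.
Hypothesis rhoy : forall e m, 2 * (rho / Cmod (pZ p0)) <= Cmod (ybr e m M0) / 2.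

(** [M_at], [l_at] and [mu_at] are the logarithms transported along the segment from [p0] to [w], in
    closed form. Being built from principal logarithms of ratios near 1, they are visibly
    holomorphic in [w]. *)
Definition M_at (w : pt) : C := (M0 + Clog (- pZ w / - pZ p0))%C.
Definition l_at (w : pt) (n : nat) : C := (l0 n + Clog ((pC w + RtoC (INR n)) / (pC p0 + RtoC (INR n))))%C.
Definition mu_at (w : pt) (e : bool) (m : nat) : C := (mu0 e m + Clog (ybr e m (M_at w) / ybr e m M0))%C.

Lemma chart_near w : dist3 w p0 < rho -> near (- pZ p0)%C (- pZ w)%C /\ (forall n, near (pC p0 + RtoC (INR n))%C (pC w + RtoC (INR n))%C).
Proof.
  intros H. assert (B := dist3_Z w p0). assert (C0 := dist3_C w p0). unfold near. split.
  - rewrite Cmod_opp. replace (- pZ w - - pZ p0)%C with (- (pZ w - pZ p0))%C by ring. rewrite Cmod_opp. lra.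
  - intros n. replace (pC w + RtoC (INR n) - (pC p0 + RtoC (INR n)))%C with (pC w - pC p0)%C by ring. specialize (rhoc n). lra.
Qed.
Lemma chart_M w : dist3 w p0 < rho -> Cmod (M_at w - M0)%C <= 2 * (rho / Cmod (pZ p0)) /\ Cmod (M_at w - M0)%C <= 1.
Proof.
  intros H. destruct (chart_near w H) as [Hz _].
  destruct (near_ratio _ _ (N_neg_z p0 HN) Hz) as [_ B]. unfold M_at. replace (M0 + Clog (- pZ w / - pZ p0) - M0)%C with (Clog (- pZ w / - pZ p0)) by ring.
  unfold near in Hz. rewrite Cmod_opp in *. assert (Hm : 0 < Cmod (pZ p0)) by lra. split.
  - eapply Rle_trans. apply B. apply Rmult_le_compat_l. lra. apply Rmult_le_compat_r. left; apply Rinv_0_lt_compat; lra.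
    assert (X := dist3_Z w p0). replace (- pZ w - - pZ p0)%C with (- (pZ w - pZ p0))%C by ring. rewrite Cmod_opp. lra.
  - eapply Rle_trans. apply B. assert (Cmod (- pZ w - - pZ p0)%C / Cmod (pZ p0) <= 1 / 2) by (apply Rle_div_l; lra). lra.
Qed.
(** [ybr e m] is affine in [M] with a slope of modulus 1, so it moves exactly as far as [M] does;
    [rhoy] compares that displacement with half the modulus of [ybr]. *)
Lemma chart_y w e m : dist3 w p0 < rho -> near (ybr e m M0) (ybr e m (M_at w)).
Proof.
  intros H. destruct (chart_M w H) as [X _]. unfold near. specialize (rhoy e m).
  replace (ybr e m (M_at w) - ybr e m M0)%C with (- dir e * (M_at w - M0))%C by (unfold ybr; ring).
  rewrite Cmod_mult, Cmod_opp, dir_mod by apply dir_unit. lra.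
Qed.
Lemma chart_N w : dist3 w p0 < rho -> Nsharp w.
Proof.
  intros H. assert (B := dist3_Z w p0). assert (C0 := dist3_C w p0). split; [|split].
  - intros E. rewrite E in B. replace (0 - pZ p0)%C with (- pZ p0)%C in B by ring. rewrite Cmod_opp in B. lra.
  - intros E. rewrite E, Cmod_minus_sym in B. lra.
  - intros n E. rewrite E in C0. specialize (rhoc n). replace (RtoC (- INR n) - pC p0)%C with (- (pC p0 + RtoC (INR n)))%C in C0 by (rewrite RtoC_opp; ring).
    rewrite Cmod_opp in C0. lra.
Qed.
Lemma chart_seg w : dist3 w p0 < rho -> path_in_N (seg p0 w).
Proof. intros H. apply seg_path. intros t It. apply chart_N. eapply Rle_lt_trans. apply seg_dist; auto. auto. Qed.

Lemma chart_transport w : dist3 w p0 < rho ->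
  exists Mf, lift (neg_z (seg p0 w)) Mf /\ Mf 0 = M0 /\ (forall t, I01 t -> Mf t = M_at (seg p0 w t)) /\
   transport (seg p0 w) M0 l0 mu0 (M_at w) (l_at w) (mu_at w).
Proof.
  intros H. assert (HP := chart_seg w H). destruct HV as (V1 & V2 & V3).
  assert (Hd : forall t, I01 t -> dist3 (seg p0 w t) p0 < rho) by (intros; eapply Rle_lt_trans; [apply seg_dist; auto|auto]).
  set (Mf := fun t => (M0 + Clog (neg_z (seg p0 w) (clamp t) / neg_z (seg p0 w) 0))%C).
  assert (Z0 : neg_z (seg p0 w) 0 = (- pZ p0)%C) by (unfold neg_z; rewrite seg_0; auto).
  assert (LM : lift (neg_z (seg p0 w)) Mf).
  { apply near_lift. apply neg_z_rcont; auto. rewrite Z0. apply N_neg_z; auto. rewrite Z0; auto.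
    intros t It. rewrite Z0. apply chart_near. auto. }
  assert (EM : forall t, I01 t -> Mf t = M_at (seg p0 w t)).
  { intros t It. unfold Mf. rewrite clamp_id by auto. rewrite Z0. reflexivity. }
  assert (E0 : Mf 0 = M0). { rewrite EM by apply I01_0. unfold M_at. rewrite seg_0, Clog_self by (apply N_neg_z; auto). ring. }
  exists Mf. repeat (split; auto).
  - exists Mf. split; auto. split; auto. split. rewrite EM, seg_1 by apply I01_1. auto.
    intros e m.
    assert (X := near_log_lift (fun t => ybr e m (Mf t)) (mu0 e m)). cbv beta in X.
    rewrite E0 in X. rewrite (EM 1 I01_1), seg_1 in X. apply X; auto.
    + apply rcont_of_ccont. intros x. apply ccont_ybr. apply LM.
    + apply (ybr_neq0 e m M0 p0); auto.
    + intros t It. rewrite EM by auto. apply chart_y; auto.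
  - intros n. assert (X := near_log_lift (c_plus n (seg p0 w)) (l0 n) (c_plus_rcont n _ HP)).
    assert (C0 : c_plus n (seg p0 w) 0 = (pC p0 + RtoC (INR n))%C) by (unfold c_plus; rewrite seg_0; auto).
    rewrite C0 in X. unfold c_plus in X at 3. rewrite seg_1 in X. apply X; auto. apply N_c_plus; auto.
    intros t It. apply chart_near. auto.
Qed.

Lemma chart_hol J N q : dist3 q p0 < rho -> (forall e, 0 < fst (ybr e J (M_at q))) -> 0 < fst (half_shift N (pC q)) ->
  hol (fun w => Zval J N w (M_at w) (l_at w) (mu_at w)) q.
Proof.
  intros Hq Hy Hb. destruct (chart_near q Hq) as [Nz Nc].
  assert (HM : hol M_at q).
  { unfold M_at. apply hol_plus. apply hol_const. apply hol_Clog. apply near_ratio; auto. apply N_neg_z; auto.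
    unfold Cdiv. apply hol_mult. apply hol_opp, hol_Z. apply hol_const. }
  assert (Hl : forall n, hol (fun w => l_at w n) q).
  { intros n. unfold l_at. apply hol_plus. apply hol_const. apply hol_Clog. apply near_ratio; auto. apply N_c_plus; auto.
    unfold Cdiv. apply hol_mult. apply hol_plus. apply hol_C. apply hol_const. apply hol_const. }
  assert (Hyd : forall e m, hol (fun w => ybr e m (M_at w)) q).
  { intros e m. unfold ybr. apply hol_minus. apply hol_const. apply hol_mult. apply hol_const. auto. }
  assert (Hmu : forall e m, hol (fun w => mu_at w e m) q).
  { intros e m. unfold mu_at. apply hol_plus. apply hol_const. apply hol_Clog. apply near_ratio. apply (ybr_neq0 e m M0 p0); auto. apply HV. apply chart_y; auto.
    unfold Cdiv. apply hol_mult. auto. apply hol_const. }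
  assert (Hcsum : forall (f : pt -> nat -> C) n, (forall m, hol (fun w => f w m) q) -> hol (fun w => csum (f w) n) q).
  { intros f n Hf. induction n. apply (hol_const q 0). apply (hol_plus (fun w => csum (f w) n) (fun w => f w n)); auto. }
  assert (HbN : hol (fun w => half_shift N (pC w)) q).
  { unfold half_shift. apply hol_plus. apply hol_C. apply hol_const. }
  unfold Zval. apply hol_plus.
  - apply (Hcsum (fun w n => (Cpow (pZ w) n * cexp (- (pS w * l_at w n)))%C)). intros n. apply hol_mult. apply hol_pow, hol_Z. apply hol_exp, hol_opp, hol_mult. apply hol_S. auto.
  - apply hol_mult. apply hol_mult. apply hol_const. apply hol_exp, hol_mult. apply hol_const. auto.
    assert (HF : forall e, hol (fun w => dir_sum e J (pS w) (half_shift N (pC w)) (M_at w) (mu_at w e)) q).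
    { intros e. unfold dir_sum. apply hol_plus.
      - apply (Hcsum (fun w m => (alt_sign m * ray_cont (dir e) (mkpt (pS w) (half_shift N (pC w)) (mu_at w e m)))%C)).
        intros m. apply hol_mult. apply hol_const. apply (hol_comp (ray_cont (dir e)) pS (fun w => half_shift N (pC w)) (fun w => mu_at w e m)); auto using hol_S.
        apply hol_ray_cont; auto. apply dir_unit.
      - apply hol_mult. apply hol_const. apply (hol_comp (ray_tail (dir e)) pS (fun w => half_shift N (pC w)) (fun w => ybr e J (M_at w))); auto using hol_S.
        apply hol_ray_tail; auto. apply dir_unit. apply (Hy e). }
    unfold Phi_half. apply hol_plus; apply HF.
Qed.
End Chart.

(** A chart needs one radius for infinitely many branch points. The real parts of [ybr e m M0] grow
    with [m], so beyond [Cmod M0] the bound 1 holds and finitely many nonzero numbers remain. *)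
Lemma inf_ybr M0 p0 : Nsharp p0 -> cexp M0 = (- pZ p0)%C -> exists eta, 0 < eta /\ forall e m, eta <= Cmod (ybr e m M0).
Proof.
  intros HN HM. destruct (nfloor_ex (Cmod M0) (Cmod_ge_0 M0)) as [N HNf].
  assert (Hfin : forall k, exists eta, 0 < eta /\ forall e m, (m < k)%nat -> eta <= Cmod (ybr e m M0)).
  { induction k as [|k [eta [H0 H1]]]. exists 1. split. lra. intros; lia.
    assert (A := proj1 (Cmod_gt_0 _) (ybr_neq0 true k M0 p0 HN HM)). assert (B := proj1 (Cmod_gt_0 _) (ybr_neq0 false k M0 p0 HN HM)).
    set (a := Cmod (ybr true k M0)) in *. set (b := Cmod (ybr false k M0)) in *.
    exists (Rmin eta (Rmin a b)). split. repeat apply Rmin_pos; auto.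
    assert (X1 := Rmin_l eta (Rmin a b)). assert (X2 := Rmin_r eta (Rmin a b)). assert (X3 := Rmin_l a b). assert (X4 := Rmin_r a b).
    intros e m Hm. destruct (Nat.eq_dec m k) as [->|Hne].
    - destruct e; [fold a|fold b]; lra.
    - specialize (H1 e m ltac:(lia)). lra. }
  destruct (Hfin (S N)) as [eta [H0 H1]]. exists (Rmin eta 1). split. apply Rmin_pos; lra.
  assert (X := Rmin_l eta 1). assert (Y := Rmin_r eta 1).
  intros e m. destruct (Nat.le_gt_cases (S N) m) as [G|L].
  - assert (Z := ybr_re_bound e m M0). apply le_INR in G. rewrite S_INR in G.
    assert (Q := Cmod_fst (ybr e m M0)). assert (Q2 := Rle_abs (fst (ybr e m M0))). assert (Q3 := pos_INR m). lra.
  - specialize (H1 e m L). lra.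
Qed.
Lemma inf_cn p0 : Nsharp p0 -> exists eta, 0 < eta /\ forall n, eta <= Cmod (pC p0 + RtoC (INR n))%C.
Proof.
  intros HN. destruct (nfloor_ex (Cmod (pC p0)) (Cmod_ge_0 _)) as [N HNf].
  assert (Hfin : forall k, exists eta, 0 < eta /\ forall m, (m < k)%nat -> eta <= Cmod (pC p0 + RtoC (INR m))%C).
  { induction k as [|k [eta [H0 H1]]]. exists 1. split. lra. intros; lia.
    assert (A := proj1 (Cmod_gt_0 _) (N_c_plus p0 k HN)). set (a := Cmod (pC p0 + RtoC (INR k))%C) in *.
    exists (Rmin eta a). split. repeat apply Rmin_pos; auto. assert (X1 := Rmin_l eta a). assert (X2 := Rmin_r eta a).
    intros m Hm. destruct (Nat.eq_dec m k) as [->|Hne]. fold a. lra. specialize (H1 m ltac:(lia)). lra. }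
  destruct (Hfin (S (S N))) as [eta [H0 H1]]. exists (Rmin eta 1). split. apply Rmin_pos; lra.
  assert (X := Rmin_l eta 1). assert (Y := Rmin_r eta 1).
  intros n. destruct (Nat.le_gt_cases (S (S N)) n) as [G|L].
  - apply le_INR in G. rewrite !S_INR in G.
    assert (Q := Cmod_tri_sub (RtoC (INR n)) (- pC p0)%C). rewrite Cmod_opp, Cmod_R, Rabs_right in Q by (apply Rle_ge, pos_INR).
    replace (RtoC (INR n) - - pC p0)%C with (pC p0 + RtoC (INR n))%C in Q by ring. lra.
  - specialize (H1 n L). lra.
Qed.

Lemma Zt_chart g : path_from_x0 g ->
  exists r : R, 0 < r /\ (forall w, dist3 w (g 1) < r -> Nsharp w) /\
    holo_on (fun w => dist3 w (g 1) < r) (fun w => Zt (concat g (seg (g 1) w))).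
Proof.
  intros Hg. destruct Hg as [Hg Hg0]. set (p0 := g 1).
  assert (HN : Nsharp p0) by (apply Hg, I01_1).
  destruct (transport_ex g 0 start_l start_mu Hg) as (M0 & l0 & mu0 & HT). rewrite Hg0; apply valid0.
  assert (HV := proj2 (transport_log_data _ _ _ _ _ _ _ HT)). fold p0 in HV.
  destruct (inf_ybr M0 p0 HN (proj1 HV)) as [ey [Hey0 Hey]]. destruct (inf_cn p0 HN) as [ec [Hec0 Hec]].
  assert (Hz : 0 < Cmod (pZ p0)) by (apply Cmod_gt_0, HN).
  assert (Hz1 : 0 < Cmod (pZ p0 - 1)%C). { apply Cmod_gt_0. apply Cminus_eq_contra. apply HN. }
  assert (HR : exists rho, 0 < rho /\ rho <= 1 /\ rho <= Cmod (pZ p0) / 2 /\ rho <= Cmod (pZ p0 - 1)%C / 2 /\ rho <= ec / 2 /\ rho <= ey / 4 * Cmod (pZ p0)).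
  { set (a := Cmod (pZ p0) / 2). set (b := Cmod (pZ p0 - 1)%C / 2). set (c := ey / 4 * Cmod (pZ p0)).
    assert (0 < a) by (unfold a; lra). assert (0 < b) by (unfold b; lra). assert (0 < c) by (unfold c; nra).
    exists (Rmin (Rmin 1 a) (Rmin b (Rmin (ec / 2) c))). split. repeat apply Rmin_pos; lra.
    assert (Y1 := Rmin_l (Rmin 1 a) (Rmin b (Rmin (ec / 2) c))). assert (Y2 := Rmin_r (Rmin 1 a) (Rmin b (Rmin (ec / 2) c))).
    assert (Y3 := Rmin_l 1 a). assert (Y4 := Rmin_r 1 a). assert (Y5 := Rmin_l b (Rmin (ec/2) c)). assert (Y6 := Rmin_r b (Rmin (ec/2) c)).
    assert (Y7 := Rmin_l (ec/2) c). assert (Y8 := Rmin_r (ec/2) c). lra. }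
  destruct HR as (rho & R0 & R1 & R2 & R3 & R4 & R5).
  assert (Rc : forall n, rho <= Cmod (pC p0 + RtoC (INR n))%C / 2) by (intros n; specialize (Hec n); lra).
  assert (Ry : forall e m, 2 * (rho / Cmod (pZ p0)) <= Cmod (ybr e m M0) / 2).
  { intros e m. specialize (Hey e m). assert (rho / Cmod (pZ p0) <= ey / 4) by (apply Rle_div_l; lra). lra. }
  exists rho. split; auto. split. { intros w Hw. apply (chart_N p0 rho); auto. }
  destruct (HT) as [(Mg & LMg & EMg0 & EMg1 & _) _].
  destruct (path_bounds g Mg Hg LMg) as (K & HK0 & HK).
  (* Over the ball of radius [rho] both [M] and [c] move by at most 1, so a single pair [J], [N]
     computed from [K + 1] serves all end points. *)
  destruct (nfloor_ex (K + 1) ltac:(lra)) as [NN HNN]. set (J := S NN). set (N := S (S NN)).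
  assert (HJ : K + 1 <= INR J) by (unfold J; rewrite S_INR; lra).
  assert (HNb : K + 1 + 1 <= INR N) by (unfold N; rewrite !S_INR; lra).
  set (F := fun w => Zval J N w (M_at p0 M0 w) (l_at p0 l0 w) (mu_at p0 M0 mu0 w)).
  assert (Main : forall w, dist3 w p0 < rho -> Zt (concat g (seg p0 w)) = F w /\ principal_mu (M_at p0 M0 w) (mu_at p0 M0 mu0 w) J /\ principal_l (l_at p0 l0 w) (pC w) N).
  { intros w Hw. assert (HP := chart_seg p0 rho R0 R2 R3 Rc w Hw).
    destruct (chart_transport p0 M0 l0 mu0 HV HN rho R0 R2 R3 Rc Ry w Hw) as (Mf & LMf & EMf0 & EMf & HTs).
    assert (Hc : path_from_x0 (concat g (seg p0 w))).
    { split. apply path_cat; auto. rewrite seg_0; auto. rewrite concat_0; auto. }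
    assert (HTc := transport_cat _ _ _ _ _ _ _ _ _ _ _ HT HTs).
    assert (P : principal_mu (M_at p0 M0 w) (mu_at p0 M0 mu0 w) J).
    { apply (principal_mu_of_bound (concat g (seg p0 w)) _ (l_at p0 l0 w) _ (catC Mg Mf) (K + 1)); auto.
      - apply lift_ext with (f := catC (neg_z g) (neg_z (seg p0 w))). intros t _. symmetry. apply (catC_map (fun q => (- pZ q)%C) g (seg p0 w) t).
        apply lift_cat; auto. congruence.
      - rewrite catC_0. auto.
      - intros t It. unfold catC. unfold I01 in It. destruct Rle_dec.
        + destruct (HK (2 * t) ltac:(unfold I01; lra)). lra.
        + rewrite EMf by (unfold I01; lra).
          assert (Hd : dist3 (seg p0 w (2 * t - 1)) p0 < rho). { eapply Rle_lt_trans. apply seg_dist. unfold I01; lra. auto. }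
          destruct (chart_M p0 M0 HN rho R0 R2 Rc _ Hd) as [_ B].
          assert (HM0 : Cmod M0 <= K). { rewrite <- EMg1. apply HK, I01_1. }
          assert (X := Cmod_tri_sub (M_at p0 M0 (seg p0 w (2 * t - 1))) M0). lra. }
    assert (Q : principal_l (l_at p0 l0 w) (pC w) N).
    { assert (X := principal_l_of_bound (concat g (seg p0 w)) _ _ _ (K + 1) N Hc HTc). rewrite concat_1, seg_1 in X. apply X; auto.
      intros t It. unfold concat. unfold I01 in It. destruct Rle_dec.
      - destruct (HK (2 * t) ltac:(unfold I01; lra)). lra.
      - assert (Hd : dist3 (seg p0 w (2 * t - 1)) p0 < rho). { eapply Rle_lt_trans. apply seg_dist. unfold I01; lra. auto. }
        assert (Z := dist3_C (seg p0 w (2 * t - 1)) p0). assert (Z2 := Cmod_tri_sub (pC (seg p0 w (2 * t - 1))) (pC p0)).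
        assert (Hc0 : Cmod (pC p0) <= K) by (apply HK, I01_1). lra. }
    split; [|split; auto]. apply Zt_val; auto. exists (M_at p0 M0 w), (l_at p0 l0 w), (mu_at p0 M0 mu0 w), J, N.
    rewrite concat_1, seg_1. auto. }
  intros q Hq. destruct (Main q Hq) as (_ & P & Q).
  assert (HF : hol F q).
  { apply (chart_hol p0 M0 l0 mu0 HV HN rho R0 R2 Rc Ry J N q Hq).
    - intros e. apply P; auto.
    - apply half_shift_pos. apply Q; auto. }
  assert (HZ : hol (fun w => Zt (concat g (seg p0 w))) q).
  { apply (hol_local q F _ (rho - dist3 q p0)); auto. lra. intros h Hh. symmetry. apply Main.
    eapply Rle_lt_trans. apply dist3_add. lra. }
  destruct HZ as [D HD]. apply (fdiff_holo _ _ _ HD).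
Qed.

(** * Agreement with the Lerch series *)

Lemma cpow_Clog (w a : C) : 0 < fst w -> cpow w a = cexp (a * Clog w)%C.
Proof.
  intros Hw. unfold cpow. assert (X := Cmod_pos_fst w Hw). destruct Req_EM_T. lra.
  f_equal. f_equal. unfold clog, Clog, carg. destruct Rlt_dec; [auto|tauto].
Qed.
Lemma lerch_csum (s z c : C) N : 0 < fst c -> lerch_partial s z c N = csum (fun n => Cpow z n * cexp (- (s * Clog (c + RtoC (INR n)))))%C N.
Proof.
  intros Hc. induction N. reflexivity.
  change (lerch_partial s z c (S N)) with (lerch_partial s z c N + Cpow z N * cpow (RtoC (INR N) + c) (- s))%C.
  rewrite csum_S, IHN. f_equal. f_equal. rewrite cpow_Clog. rewrite (Cplus_comm (RtoC (INR N))). f_equal. ring.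
  simpl. assert (X := pos_INR N). lra.
Qed.

Lemma pow_bound (s w : C) r0 : 0 < r0 -> r0 <= fst w -> 0 <= fst s ->
  Cmod (cexp (- (s * Clog w))%C) <= exp (fst s * Rabs (ln r0) + Cmod s * (PI / 2)).
Proof.
  intros H0 Hw Hs. rewrite Cmod_cexp. apply exp_mono.
  assert (I := Clog_im w). assert (Y := Cmod_snd s). assert (Z := Cmod_ge_0 s).
  assert (Hm : r0 <= Cmod w). { assert (X := Cmod_fst w). assert (X2 := Rle_abs (fst w)). lra. }
  assert (L : ln r0 <= ln (Cmod w)). { destruct Hm as [Hm|Hm]. left; apply ln_increasing; auto. rewrite <- Hm; lra. }
  assert (A := Rle_abs (- ln r0)). rewrite Rabs_Ropp in A.
  replace (fst (- (s * Clog w))%C) with (- fst s * ln (Cmod w) + snd s * snd (Clog w)) by (unfold Clog; simpl; ring).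
  assert (B : snd s * snd (Clog w) <= Cmod s * (PI / 2)).
  { eapply Rle_trans. apply Rle_abs. rewrite Rabs_mult. apply Rmult_le_compat; auto using Rabs_pos. lra. }
  assert (fst s * - ln (Cmod w) <= fst s * Rabs (ln r0)) by (apply Rmult_le_compat_l; lra). lra.
Qed.

(** For [|w| >= 1], [Re w > 0] and [Re s >= 0] the power [w^(-s)] is bounded by [e^(|s| PI / 2)].
    The bound is therefore uniform in [b], which is sent to infinity with the number of terms. *)
Lemma ray_tail_unif d (s b y : C) : unit_dir d -> 1 <= fst b -> 0 < fst y -> 0 <= fst s ->
  Cmod (ray_tail d (mkpt s b y)) <= exp (Cmod s * (PI / 2)) / fst y.
Proof.
  intros Hd Hb Hy Hs. apply CInt_inf_bound; auto. intros; apply ccont_ray_fun; auto using weight_tail_weight. change (0 < fst b); lra.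
  intros r Hr. unfold ray_fun, mkpt, pS, pZ, pC; simpl. rewrite Cmod_mult, Cmod_R.
  destruct (proj2 weight_tail_weight r Hr) as [W0 W1]. rewrite Rabs_right by lra.
  replace (- (y * r) - s * Clog (b + d * r))%C with (- (y * r) + - (s * Clog (b + d * r)))%C by ring.
  rewrite cexp_plus, Cmod_mult.
  assert (X := pow_bound s (b + d * r)%C 1 Rlt_0_1 ltac:(rewrite dir_Re; auto) Hs).
  rewrite ln_1, Rabs_R0, Rmult_0_r, Rplus_0_l in X.
  rewrite Cmod_cexp. replace (fst (- (y * r))%C) with (- fst y * r) by (simpl; ring).
  set (u := Cmod (cexp (- (s * Clog (b + d * r))))) in *. set (v := exp (- fst y * r)).
  assert (0 < v) by apply exp_pos. assert (0 <= u) by apply Cmod_ge_0.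
  apply Rle_trans with (1 * (v * u)). apply Rmult_le_compat_r; auto. nra. nra.
Qed.

(** Meant for the points whose segment from the base point is not a path in the space: no
    continuation supplies a limit there, so convergence is proved by comparison with a geometric
    series. *)
Lemma Dom_convergent w : Dom w -> exists l, lerch_sum w l.
Proof.
  intros (Hs & Hz & Hc0 & Hc1). set (s := pS w) in *. set (z := pZ w) in *. set (c := pC w) in *.
  set (t := fun n => (Cpow z n * cexp (- (s * Clog (c + RtoC (INR n)))))%C).
  set (K := exp (fst s * Rabs (ln (fst c)) + Cmod s * (PI / 2))).
  assert (Ht : forall n, Cmod (t n) <= K * Cmod z ^ n).
  { intros n. unfold t. rewrite Cmod_mult, Cmod_pow, Rmult_comm. apply Rmult_le_compat_r. apply pow_le, Cmod_ge_0.
    apply pow_bound; auto. simpl. assert (X := pos_INR n). lra. lra. }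
  assert (EG : ex_series (fun n => K * Cmod z ^ n)).
  { apply (ex_series_scal (V := R_NormedModule) K (fun n => Cmod z ^ n)). apply ex_series_geom. rewrite Rabs_right; auto. apply Rle_ge, Cmod_ge_0. }
  assert (S1 : ex_series (fun n => fst (t n))).
  { apply (ex_series_le (V := R_CompleteNormedModule) _ (fun n => K * Cmod z ^ n)); auto. intros n. eapply Rle_trans. apply (Cmod_fst (t n)). apply Ht. }
  assert (S2 : ex_series (fun n => snd (t n))).
  { apply (ex_series_le (V := R_CompleteNormedModule) _ (fun n => K * Cmod z ^ n)); auto. intros n. eapply Rle_trans. apply (Cmod_snd (t n)). apply Ht. }
  destruct S1 as [l1 S1]. destruct S2 as [l2 S2]. apply is_series_Reals in S1. apply is_series_Reals in S2.
  exists (l1, l2). intros eps He.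
  destruct (S1 (eps/2) ltac:(lra)) as [N1 HN1]. destruct (S2 (eps/2) ltac:(lra)) as [N2 HN2].
  exists (S (N1 + N2)). intros N HN. destruct N as [|n]. lia.
  fold s z c. rewrite lerch_csum by auto. fold t.
  assert (E : forall n, csum t (S n) = (sum_f_R0 (fun k => fst (t k)) n, sum_f_R0 (fun k => snd (t k)) n)).
  { induction n0. simpl. apply C_eq; simpl; ring. rewrite csum_S, IHn0. apply C_eq; reflexivity. }
  rewrite E. eapply Rle_lt_trans. apply Cmod_le_sum.
  change (Rabs (sum_f_R0 (fun k => fst (t k)) n - l1) + Rabs (sum_f_R0 (fun k => snd (t k)) n - l2) < eps).
  specialize (HN1 n ltac:(lia)). specialize (HN2 n ltac:(lia)). unfold R_dist in *. lra.
Qed.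

(** The number [1 + zeta / |zeta|] points along the bisector of the directions of 1 and [zeta].
    Multiplying by its conjugate brings both ends of the segment from 1 to [zeta] into the right
    half-plane, hence the whole segment. *)
Lemma seg_log_strip (zeta : C) t : 0 < fst (1 + zeta / RtoC (Cmod zeta))%C -> zeta <> 0 -> I01 t ->
  let e := Cconj (1 + zeta / RtoC (Cmod zeta))%C in 0 < fst (e * (1 + t * (zeta - 1)))%C.
Proof.
  intros Hp Hn [T0 T1] e. assert (Hm := proj1 (Cmod_gt_0 zeta) Hn). set (m := Cmod zeta) in *.
  assert (A : fst e = 1 + fst zeta / m). { unfold e. simpl. field. lra. }
  assert (B : fst (e * zeta)%C = m * (1 + fst zeta / m)).
  { assert (Q : fst zeta * fst zeta + snd zeta * snd zeta = m * m). { unfold m, Cmod. rewrite sqrt_sqrt. ring. generalize (pow2_ge_0 (fst zeta)) (pow2_ge_0 (snd zeta)). lra. }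
    unfold e. simpl. transitivity (fst zeta + (fst zeta * fst zeta + snd zeta * snd zeta) / m). field; lra. rewrite Q. field; lra. }
  replace (e * (1 + t * (zeta - 1)))%C with (RtoC (1 - t) * e + RtoC t * (e * zeta))%C by (rewrite RtoC_minus; ring).
  assert (Hp' : 0 < 1 + fst zeta / m). { rewrite <- A. exact (eq_ind _ (fun x => 0 < x) Hp _ eq_refl). }
  change (0 < ((1 - t) * fst e - 0 * snd e) + (t * fst (e * zeta)%C - 0 * snd (e * zeta)%C)).
  rewrite A, B. set (x := 1 + fst zeta / m) in *.
  assert (0 <= t * (m * x)) by (repeat apply Rmult_le_pos; lra). assert (0 <= (1 - t) * x) by (apply Rmult_le_pos; lra).
  destruct (Req_dec t 1). subst. assert (0 < m * x) by (apply Rmult_lt_0_compat; lra). lra.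
  assert (0 < (1 - t) * x) by (apply Rmult_lt_0_compat; lra). lra.
Qed.

(** Along the segment [|Im M| < PI], so every [ybr] stays in the right half-plane and [J = 0] is
    admissible. The value is then [Zval 0 N] for all [N >= 1]: the partial sum plus
    [e^((N - 1/2) M)], up to sign, times a bounded quantity, and [Re M < 0]. *)
Lemma Zt_Dom_path w : Dom w -> path_from_x0 (seg x0' w) -> lerch_sum w (Zt (seg x0' w)).
Proof.
  intros (Hs & Hz & Hc0 & Hc1) Hg. set (g := seg x0' w) in *. assert (HP := PI_RGT_0).
  destruct Hg as [Hg Hg0]. assert (Hg' : path_from_x0 g) by (split; auto).
  assert (Eg1 : g 1 = w) by apply seg_1.
  set (zeta := (- pZ w)%C).
  assert (HNw : Nsharp w) by (rewrite <- Eg1; apply Hg, I01_1).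
  assert (Hzn : zeta <> 0) by (apply N_neg_z; auto).
  assert (Hm := proj1 (Cmod_gt_0 zeta) Hzn).
  assert (Hzm : Cmod zeta < 1) by (unfold zeta; rewrite Cmod_opp; auto).
  assert (Ezf : forall t, neg_z g t = (1 + t * (zeta - 1))%C).
  { intros t. unfold neg_z, g, zeta, seg, x0', mkpt, pZ; simpl. ring. }
  assert (Hpos : 0 < fst (1 + zeta / RtoC (Cmod zeta))%C).
  { replace (fst (1 + zeta / RtoC (Cmod zeta))%C) with (1 + fst zeta / Cmod zeta) by (simpl; field; lra).
    apply Rnot_le_lt. intros Hle.
    assert (Hf : fst zeta <= - Cmod zeta). { assert (fst zeta / Cmod zeta <= -1) by lra. apply Rle_div_l in H; lra. }
    assert (Hs0 : snd zeta = 0).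
    { assert (Q : fst zeta * fst zeta + snd zeta * snd zeta = Cmod zeta * Cmod zeta). { unfold Cmod. rewrite sqrt_sqrt. ring. generalize (pow2_ge_0 (fst zeta)) (pow2_ge_0 (snd zeta)). lra. }
      nra. }
    set (a := - fst zeta). assert (Ha : 0 < a) by (unfold a; lra).
    (* the segment would run through the puncture [z = 0] *)
    set (t := / (1 + a)). assert (It : I01 t). { unfold t, I01. split. left; apply Rinv_0_lt_compat; lra. rewrite <- Rinv_1. apply Rinv_le_contravar; lra. }
    apply (N_neg_z (g t)). apply Hg; auto. change (- pZ (g t))%C with (neg_z g t). rewrite Ezf.
    clearbody zeta. apply C_eq; simpl; rewrite Hs0; unfold t, a; field; unfold a in Ha; lra. }
  set (e := Cconj (1 + zeta / RtoC (Cmod zeta))%C).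
  assert (Hep : forall t, I01 t -> 0 < fst (e * neg_z g t)%C) by (intros; rewrite Ezf; apply seg_log_strip; auto).
  assert (Hfe : 0 < fst e) by exact Hpos.
  (* The lift of [- z] as a difference of two principal logarithms after the rotation by [e]; two
     arguments below [PI / 2] differ by less than [PI]. *)
  set (Mf := fun t => (Clog (e * neg_z g (clamp t)) - Clog e)%C).
  assert (Z0 : neg_z g 0 = 1) by (rewrite Ezf; ring).
  assert (LM : lift (neg_z g) Mf).
  { split.
    - intros x. apply ccont_minus. 2: apply ccont_const. apply ccont_Clog. apply ccont_mult. apply ccont_const. apply rcont_clamp. apply neg_z_rcont; auto.
      apply Hep, clamp_I.
    - intros t It. unfold Mf. rewrite clamp_id by auto. rewrite cexp_minus, !cexp_Clog by auto. field. apply Cmod_neq0, Cmod_pos_fst; auto. }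
  assert (EM0 : Mf 0 = 0). { unfold Mf. rewrite clamp_id by apply I01_0. rewrite Z0. replace (e * 1)%C with e by ring. ring. }
  assert (HMim : forall t, Rabs (snd (Mf t)) < PI).
  { intros t. unfold Mf. assert (A := Clog_im (e * neg_z g (clamp t))%C). assert (B := Clog_im e).
    change (snd (Clog (e * neg_z g (clamp t)) - Clog e)%C) with (snd (Clog (e * neg_z g (clamp t))%C) + - snd (Clog e)).
    apply Rabs_def2 in A. apply Rabs_def2 in B. apply Rabs_def1; lra. }
  destruct (transport_ex g 0 start_l start_mu Hg) as (M & l & mu & HT). rewrite Hg0; apply valid0.
  assert (V := proj2 (transport_log_data _ _ _ _ _ _ _ HT)). rewrite Eg1 in V.
  assert (P : principal_mu M mu 0).
  { intros d m _. apply (principal_mu_mu g M l mu Mf); auto. intros t It. specialize (HMim t). apply Rabs_def2 in HMim.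
    assert (X : fst (ybr d m (Mf t)) = (2 * INR m + 1) * PI + (if d then snd (Mf t) else - snd (Mf t))). { unfold ybr, dir. destruct d; simpl; ring. }
    rewrite X. assert (Y := pos_INR m). assert (0 <= INR m * PI) by (apply Rmult_le_pos; lra). destruct d; lra. }
  assert (Hct : forall n t, I01 t -> 0 < fst (c_plus n g t)).
  { intros n t [T0 T1]. unfold c_plus, g, seg, x0', mkpt, pC in *; simpl in *. assert (Y := pos_INR n).
    set (cw := fst (snd w)) in *. assert (0 <= t * (cw * 1)) by nra. nra. }
  assert (El : forall n, l n = Clog (pC w + RtoC (INR n))%C).
  { intros n. rewrite <- Eg1. apply (principal_mu_l g M l mu); auto. }
  (* The threshold is 1 and not 0, as [Re c] may be below 1/2. *)
  assert (Q : principal_l l (pC w) 1).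
  { intros n Hn. split; auto. simpl. apply le_INR in Hn. simpl in Hn. lra. }
  assert (EZ : Zt g = Zval 0 1 w M l mu).
  { apply Zt_val; auto. exists M, l, mu, 0%nat, 1%nat. rewrite Eg1. auto. }
  rewrite EZ.
  assert (HReM : fst M < 0).
  { destruct V as [V1 _]. assert (X := Cmod_cexp M). rewrite V1, Cmod_opp in X. rewrite <- ln_1. rewrite <- (ln_exp (fst M)). apply ln_increasing. apply exp_pos. lra. }
  destruct (P true 0%nat (le_n _)) as [Y1 _]. destruct (P false 0%nat (le_n _)) as [Y2 _].
  set (K := exp (Cmod (pS w) * (PI / 2)) / fst (ybr true 0 M) + exp (Cmod (pS w) * (PI / 2)) / fst (ybr false 0 M)).
  intros eps He.
  destruct (exp_decay_small (- fst M) eps K ltac:(lra) He) as [A [HA0 HA]].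
  destruct (nfloor_ex A HA0) as [N0 HN0].
  exists (S (S N0)). intros N HN.
  assert (HNr : A + 1 <= INR N). { apply le_INR in HN. rewrite !S_INR in HN. lra. }
  (* Ensures [Re (c + N - 1/2) >= 1], where [ray_tail_unif] applies. *)
  assert (HN2 : 2 <= INR N). { apply le_INR in HN. rewrite !S_INR in HN. assert (X := pos_INR N0). lra. }
  rewrite <- (Zval_indep 0 1 0 N w M l mu) by (auto; lia).
  rewrite lerch_csum by auto.
  unfold Zval. rewrite (csum_ext (fun n => Cpow (pZ w) n * cexp (- (pS w * l n)))%C (fun n => Cpow (pZ w) n * cexp (- (pS w * Clog (pC w + RtoC (INR n)))))%C) by (intros; rewrite El; auto).
  match goal with |- Cmod (?a - (?a + ?b))%C < _ => replace (a - (a + b))%C with (- b)%C by ring end.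
  rewrite Cmod_opp, !Cmod_mult, alt_sign_mod, Rmult_1_l, Cmod_cexp.
  assert (Hb : 1 <= fst (half_shift N (pC w))) by (unfold half_shift; simpl; lra).
  assert (BF : Cmod (Phi_half 0 (pS w) (half_shift N (pC w)) M mu) <= K).
  { unfold Phi_half, dir_sum. replace (alt_sign 0) with (RtoC 1) by reflexivity. simpl csum. rewrite !Cplus_0_l, !Cmult_1_l.
    eapply Rle_trans. apply Cmod_triangle. unfold K. apply Rplus_le_compat; apply ray_tail_unif; auto using dir_unit; lra. }
  specialize (HA (INR N - 1/2) ltac:(lra)).
  replace (fst (RtoC (INR N - 1/2) * M)%C) with (- - fst M * (INR N - 1/2)) by (simpl; ring).
  eapply Rle_lt_trans. 2: apply HA. rewrite Rmult_comm. apply Rmult_le_compat_r; auto. left; apply exp_pos.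
Qed.

Lemma Zt_Dom w : Dom w -> lerch_sum w (Zt (seg x0' w)).
Proof.
  intros Hw. destruct (classic (path_from_x0 (seg x0' w))) as [Hg|Hg].
  - apply Zt_Dom_path; auto.
  - destruct (Dom_convergent w Hw) as [l Hl].
    assert (X := Zt_nopath (seg x0' w) l Hg). rewrite seg_1 in X. auto.
Qed.

Theorem theorem3p6 :
  exists Zt : path -> C,
    (* single-valued on the universal cover: depends only on the homotopy class *)
    (forall g1 g2 : path, path_from_x0 g1 -> path_from_x0 g2 ->
       g1 1 = g2 1 -> homotopic g1 g2 -> Zt g1 = Zt g2) /\
    (* holomorphic on the universal cover (in the canonical local charts) *)
    (forall g : path, path_from_x0 g ->
       exists r : R, 0 < r /\ (forall w, dist3 w (g 1) < r -> Nsharp w) /\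
         holo_on (fun w => dist3 w (g 1) < r) (fun w => Zt (concat g (seg (g 1) w)))) /\
    (* it continues the Lerch transcendent from its domain of convergence *)
    (forall w : pt, Dom w -> lerch_sum w (Zt (seg x0' w))) /\
    (* all monodromies along the second commutator subgroup vanish *)
    (forall tau : path, pi1'' tau -> forall g : path, path_from_x0 g ->
       monodromy tau Zt g = RtoC 0).
Proof.
  exists Zt. split; [exact Zt_hom | split; [exact Zt_chart | split; [exact Zt_Dom |]]].
  intros tau Ht g Hg. unfold monodromy. rewrite (Zt_mono tau g Ht Hg). ring.
Qed.
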